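(* Let $(R,\mathfrak m)$ be a commutative noetherian local ring, $I,J$ ideals of $R$ such that $I+J$ is $\mathfrak m$-primary, and $M$ a finitely generated $R$-module. Then $$\sup\{\, i \mid H^i_{I,J}(M)\neq 0\,\} = \dim M/JM.$$
   Context: All rings are commutative and noetherian. For ideals $I,J$ of a ring $R$ and an $R$-module $M$, $\Gamma_{I,J}(M)=\{x\in M : I^n x\subseteq Jx \text{ for some integer } n\ge 1\}$; this is a submodule, $\Gamma_{I,J}$ is a left exact additive functor on $R$-modules, and $H^i_{I,J}$ denotes its $i$-th right derived functor. Conventions: $\sup\emptyset=-\infty$... and the dimension of the zero module is $-1$.
   Formalization: For M = 0 the stated conventions give −∞ on the left and −1 on the right, so the equality fails literally; the formal statement identifies these two values (all H^i vanish exactly when M/JM = 0) and is unchanged for M ≠ 0. *)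

(* Defs.v *)
From HB Require Import structures.
From mathcomp Require Import all_boot all_order all_algebra.
Set Implicit Arguments. Unset Strict Implicit. Unset Printing Implicit Defensive.
Import GRing.Theory.
Local Open Scope ring_scope.

Definition psubset {T : Type} (A B : T -> Prop) := forall x, A x -> B x.

Inductive fsum (V : nmodType) (S : V -> Prop) : V -> Prop :=
  | fsum0 : fsum S 0
  | fsumD x y : S x -> fsum S y -> fsum S (x + y).

Section RingDefs.
Variable R : comNzRingType.

Definition is_ideal (I : R -> Prop) : Prop :=
  I 0 /\ (forall a b, I a -> I b -> I (a + b)) /\ (forall r a, I a -> I (r * a)).

Definition is_prime_ideal (P : R -> Prop) : Prop :=
  is_ideal P /\ ~ P 1 /\ (forall a b, P (a * b) -> P a \/ P b).

Definition is_maximal_ideal (m : R -> Prop) : Prop :=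
  is_ideal m /\ ~ m 1 /\
  (forall I, is_ideal I -> psubset m I -> psubset I m \/ I 1).

Definition noetherian_ring : Prop :=
  forall c : nat -> R -> Prop, (forall n, is_ideal (c n)) ->
  (forall n, psubset (c n) (c n.+1)) ->
  exists N, forall n, (N <= n)%N -> psubset (c n) (c N).

Definition local_ring (m : R -> Prop) : Prop :=
  is_maximal_ideal m /\
  (forall m', is_maximal_ideal m' -> forall x, m' x <-> m x).

Definition ideal_add (I J : R -> Prop) : R -> Prop :=
  fun x => exists a b, I a /\ J b /\ x = a + b.

Definition ideal_mul (I J : R -> Prop) : R -> Prop :=
  fsum (fun x => exists a b, I a /\ J b /\ x = a * b).

Fixpoint ideal_pow (I : R -> Prop) (k : nat) : R -> Prop :=
  match k with
  | 0 => fun _ => True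
  | k'.+1 => ideal_mul (ideal_pow I k') I
  end.

Definition radical (I : R -> Prop) : R -> Prop :=
  fun x => exists n, I (x ^+ n).

Definition is_primary_to (q m : R -> Prop) : Prop :=
  is_ideal q /\ ~ q 1 /\
  (forall a b, q (a * b) -> ~ q a -> radical q b) /\
  (forall x, radical q x <-> m x).

Definition is_linear (U V : lmodType R) (f : U -> V) : Prop :=
  forall (r : R) (x y : U), f (r *: x + y) = r *: f x + f y.

Definition fin_gen (V : lmodType R) : Prop :=
  exists s : seq V, forall x : V,
    fsum (fun y => exists (r : R) (v : V), v \in s /\ y = r *: v) x.

Definition ideal_mod (J : R -> Prop) (V : lmodType R) : V -> Prop :=
  fsum (fun y => exists (r : R) (v : V), J r /\ y = r *: v).

Definition ann_quot (J : R -> Prop) (V : lmodType R) : R -> Prop :=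
  fun r => forall x : V, @ideal_mod J V (r *: x).

Definition gammaIJ (I J : R -> Prop) (V : lmodType R) (x : V) : Prop :=
  exists k, (0 < k)%N /\
    forall a, ideal_pow I k a -> exists b, J b /\ a *: x = b *: x.

(* injective R-module (w.r.t. R-modules of the lmodType universe) *)
Definition is_injective_mod (E : lmodType R) : Prop :=
  forall (A B : lmodType R) (f : A -> B) (g : A -> E),
    is_linear f -> injective f -> is_linear g ->
    exists h : B -> E, is_linear h /\ forall a, h (f a) = g a.

Record inj_res (V : lmodType R) := InjRes {
  ir_E : nat -> lmodType R;
  ir_eps : V -> ir_E 0;
  ir_d : forall (n : nat), ir_E n -> ir_E n.+1;
  ir_inj : forall n, is_injective_mod (ir_E n);
  ir_eps_lin : is_linear ir_eps;
  ir_d_lin : forall n, is_linear (@ir_d n);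
  ir_eps_mono : injective ir_eps;
  ir_exact0 : forall y, @ir_d 0 y = 0 <-> exists x, ir_eps x = y;
  ir_exact : forall n y, @ir_d n.+1 y = 0 <-> exists x, @ir_d n x = y
}.

Definition res_coh_nz (I J : R -> Prop) (V : lmodType R) (X : inj_res V)
    (i : nat) : Prop :=
  match i with
  | 0 => exists x : @ir_E _ X 0, gammaIJ I J x /\ @ir_d _ X 0 x = 0 /\ x <> 0
  | i'.+1 => exists x : @ir_E _ X i'.+1, gammaIJ I J x /\ @ir_d _ X i'.+1 x = 0 /\
             ~ (exists y : @ir_E _ X i', gammaIJ I J y /\ @ir_d _ X i' y = x)
  end.

Definition HIJ_nonzero (I J : R -> Prop) (V : lmodType R) (i : nat) : Prop :=
  exists X : inj_res V, res_coh_nz I J X i.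

Definition prime_chain_above (A : R -> Prop) (n : nat) : Prop :=
  exists c : nat -> R -> Prop,
    (forall k, (k <= n)%N -> is_prime_ideal (c k) /\ psubset A (c k)) /\
    (forall k, (k < n)%N -> psubset (c k) (c k.+1) /\ ~ psubset (c k.+1) (c k)).

End RingDefs.

(* o is the supremum of the set P of naturals; None encodes the sup of the
   empty set (-oo), resp. the dimension -1 of the zero module. *)
Definition is_sup_opt (P : nat -> Prop) (o : option nat) : Prop :=
  match o with
  | None => forall i, ~ P i
  | Some n => P n /\ forall i, P i -> (i <= n)%N
  end.

(* dim V/JV = dim R/Ann(V/JV) (Krull dimension), as an option *)
Definition dim_quot (R : comNzRingType) (J : R -> Prop) (V : lmodType R)
    (o : option nat) : Prop :=
  is_sup_opt (prime_chain_above (ann_quot J V)) o.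

(* Main.v *)
(* Write Gam for the functor Gamma_{I,J}. Since I + J is m-primary, x lies in Gam
   exactly when for every y in m some y^n - j with j in J kills x, so Gam is a
   finite intersection of torsion functors for multiplicative sets. Over a
   noetherian ring such functors preserve Baer's extension property, and each one
   raises the cohomological amplitude of a complex of injectives by at most 1, or
   by 0 when the cohomology is already torsion. If y_1, ..., y_d are parameters
   modulo J + Ann M, with d minimal, this gives vanishing above d.

   For nonvanishing at d one passes from an injective resolution X of M to the
   Koszul complexes on X of sequences L containing generators of J. By Melkersson's
   criterion the cohomology of Gam (kos L X) is artinian, so it has finitely many
   attached primes. An element x of m avoiding those different from m makes the top
   cohomology H nearly divisible: H/xH is killed by a power of every y in m.
   Comparing with the vanishing bound for x, y^e, noetherian induction on
   Ann M + (L) shows that vanishing from degree c on would produce fewer than c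
   parameters (MacDonald and Sharp's proof of Grothendieck's nonvanishing theorem,
   carried out on complexes).

   That d is the Krull dimension is Krull's height theorem together with prime
   avoidance. *)
Require Import Defs.
From HB Require Import structures.
From mathcomp Require Import all_boot all_order all_algebra.
From mathcomp Require Import boolp classical_sets.
From mathcomp Require Import ring zify.
From Stdlib Require List.
Set Implicit Arguments. Unset Strict Implicit. Unset Printing Implicit Defensive.
Import GRing.Theory Num.Theory.
Local Open Scope ring_scope.

(** * Submodules, ideals and the determinant trick *)

(** The modules H^i_{I,J}(M) need not be artinian, since elements of Gamma_{I,J} are m-torsion only
    up to J; this obstructs the classical nonvanishing argument. Putting generators of J into the
    Koszul sequence L removes the obstacle: elements of J become nilpotent on cohomology, so y^n u =
    j u makes every y in m nilpotent too. Passing from M to M/xM is replaced by taking a cone on the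
    resolution, so that a single complex of injectives serves throughout; the price is a degree
    shift by the length of L, hence bounds such as [c + size L]. Localizations are replaced by
    saturated ideals, maps between cohomology modules by linear relations between subquotients, and
    injectivity by Baer's extension property, which passes to the submodules Gamma(E). Vanishing and
    nonvanishing are shown for every injective resolution, so one resolution must also be built:
    this is the role of Hom_Z(R, (Q/Z)^W). Finally Ann(M/JM) and J + Ann M may differ but have the
    same radical, hence the same chains of primes above them. *)

Lemma dependent_choice (T : Type) (Q : T -> T -> Prop) (t0 : T) :
  (forall t, exists t', Q t t') ->
  exists f : nat -> T, f 0%N = t0 /\ forall n, Q (f n) (f n.+1).
Proof.
move=> H; have [g gP] := choice H.
by exists (fun n => iter n g t0); split=> // n; apply: gP.
Qed.

Section Submodules.
Variable R : comNzRingType.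

Definition submod (V : lmodType R) (P : V -> Prop) :=
  P 0 /\ forall r x y, P x -> P y -> P (r *: x + y).

Section One.
Variables (V : lmodType R) (P : V -> Prop).
Hypothesis sP : submod P.

Lemma submod0 : P 0. Proof. by case: sP. Qed.
Lemma submodD x y : P x -> P y -> P (x + y).
Proof. by case: sP => _ H Px Py; rewrite -[x]scale1r; apply: H. Qed.
Lemma submodZ r x : P x -> P (r *: x).
Proof. by case: sP => P0 H Px; rewrite -[_ *: _]addr0; apply: H. Qed.
Lemma submodN x : P x -> P (- x).
Proof. by move=> Px; rewrite -scaleN1r; apply: submodZ. Qed.
Lemma submodB x y : P x -> P y -> P (x - y).
Proof. by move=> Px Py; apply: submodD => //; apply: submodN. Qed.
Lemma submod_subl x y : P (x - y) -> P y -> P x.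
Proof. by move=> Pxy Py; rewrite -[x](subrK y); apply: submodD. Qed.
Lemma submod_subr x y : P (x - y) -> P x -> P y.
Proof. by move=> Pxy Px; rewrite -[y](subKr x); apply: submodB. Qed.
End One.

(** This is B + A vs, encoded by peeling off one multiple per generator: dropping a generator, the
    induction step of the determinant trick, then amounts to enlarging B. *)
Fixpoint lspan (V : lmodType R) (A : R -> Prop) (B : V -> Prop) (vs : seq V)
    (x : V) : Prop :=
  match vs with
  | [::] => B x
  | v :: vs' => exists2 j, A j & lspan A B vs' (x - j *: v)
  end.

Section Span.
Variables (V : lmodType R) (A : R -> Prop).
Hypothesis iA : is_ideal A.

Lemma lspan_submod (B : V -> Prop) vs : submod B -> submod (lspan A B vs).
Proof.
case: iA => A0 [AD AM]; move=> sB; elim: vs => [//|v vs IH] /=; split.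
  by exists 0; rewrite // scale0r subr0; apply: submod0.
move=> r x y [j Aj Hj] [k Ak Hk]; exists (r * j + k); first by apply: AD => //; apply: AM.
have -> : r *: x + y - (r * j + k) *: v = r *: (x - j *: v) + (y - k *: v).
  by rewrite scalerBr scalerA scalerDl addrACA opprD.
by case: IH => _; apply.
Qed.

Lemma lspan_base (B : V -> Prop) vs x : B x -> lspan A B vs x.
Proof.
case: iA => A0 _; elim: vs x => [//|v vs IH] x Bx /=.
by exists 0; rewrite // scale0r subr0; apply: IH.
Qed.

Lemma lspan_gen (B : V -> Prop) vs v j :
  submod B -> v \in vs -> A j -> lspan A B vs (j *: v).
Proof.
move=> sB; elim: vs => [//|w vs IH]; rewrite inE => /orP[/eqP <-|wv] Aj /=.
  by exists j; rewrite // subrr; apply: submod0; apply: lspan_submod.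
by case: (iA) => A0 _; exists 0; rewrite // scale0r subr0; apply: IH.
Qed.

Lemma lspan_min (B : V -> Prop) vs (P : V -> Prop) :
  submod P -> (forall x, B x -> P x) ->
  (forall v j, v \in vs -> A j -> P (j *: v)) ->
  forall x, lspan A B vs x -> P x.
Proof.
move=> sP BP; elim: vs => [_ x /BP //|v vs IH] H x.
move=> [j Aj Hx]; apply: (@submod_subl _ _ sP _ (j *: v)).
  by apply: IH Hx => w k wv Ak; apply: H; rewrite // inE wv orbT.
by apply: H; rewrite // inE eqxx.
Qed.

End Span.

Definition Rtrue : R -> Prop := fun _ => True.
Lemma Rtrue_ideal : is_ideal Rtrue. Proof. by split. Qed.

Lemma ideal_submod (b : R -> Prop) : is_ideal b <-> @submod R^o b.
Proof.
split=> [[b0 [bD bM]]|sb]; first by split=> // r x y bx by_; apply: bD => //; apply: bM.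
split; first exact: (submod0 sb).
by split=> [x y|r x]; [apply: (submodD sb) | apply: (submodZ sb)].
Qed.

Lemma ideal0 (b : R -> Prop) : is_ideal b -> b 0.
Proof. by case. Qed.
Lemma idealD (b : R -> Prop) x y : is_ideal b -> b x -> b y -> b (x + y).
Proof. by case=> _ [H _]; apply: H. Qed.
Lemma idealMl (b : R -> Prop) r x : is_ideal b -> b x -> b (r * x).
Proof. by case=> _ [_ H]; apply: H. Qed.
Lemma idealMr (b : R -> Prop) r x : is_ideal b -> b x -> b (x * r).
Proof. by rewrite mulrC; apply: idealMl. Qed.
Lemma idealN (b : R -> Prop) x : is_ideal b -> b x -> b (- x).
Proof. by move=> ib bx; rewrite -mulN1r; apply: idealMl. Qed.
Lemma idealB (b : R -> Prop) x y : is_ideal b -> b x -> b y -> b (x - y).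
Proof. by move=> ib bx by_; apply: idealD => //; apply: idealN. Qed.
Lemma idealX (b : R -> Prop) x n : is_ideal b -> b x -> b (x ^+ n.+1).
Proof. by move=> ib bx; rewrite exprS; apply: idealMr. Qed.
Lemma idealX_le (b : R -> Prop) x n k :
  is_ideal b -> (n <= k)%N -> b (x ^+ n) -> b (x ^+ k).
Proof. by move=> ib nk bx; rewrite -(subnK nk) exprD; apply: idealMl. Qed.

(* Generalized determinant trick, proved by removing generators one at a time:
   if r multiplies the span of vs into B + A vs then some r^n + t with t in A
   multiplies it into B. Nakayama's lemma is the case r = 1. *)
Lemma determinant_trick (V : lmodType R) (A : R -> Prop) (B : V -> Prop)
    (vs : seq V) (r : R) : is_ideal A -> submod B ->
  (forall v, v \in vs -> lspan A B vs (r *: v)) ->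
  exists n t, A t /\ forall v, v \in vs -> B ((r ^+ n + t) *: v).
Proof.
move=> iA; elim: vs B => [|v vs IH] B sB H.
  by exists 0%N, 0; split=> //; apply: ideal0.
have sB1 : submod (lspan Rtrue B [:: v]) by apply: lspan_submod => //; exact: Rtrue_ideal.
have [n [t [At Ht]]] : exists n t, A t /\ forall w, w \in vs -> lspan Rtrue B [:: v] ((r ^+ n + t) *: w).
  apply: IH => // w wvs.
  have := H w; rewrite inE wvs orbT => /(_ isT).
  apply: lspan_min; first exact: lspan_submod.
    by move=> x Bx; apply: lspan_base => //; apply: lspan_base => //; exact: Rtrue_ideal.
  move=> u j; rewrite inE => /orP[/eqP -> _|uvs Aj]; last exact: lspan_gen.
  by apply: lspan_base => //; apply: lspan_gen; rewrite ?inE //; exact: Rtrue_ideal.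
set s := r ^+ n + t in Ht.
(* [s] sends each element of [vs] into B + R v, so it sends A-multiples of them into B + A v; hence
   [s * r - a] sends v into B. *)
have [a Aa Ha] : exists2 a, A a & B (s *: (r *: v) - a *: v).
  have := H v; rewrite inE eqxx => /(_ isT).
  apply: (@lspan_min V A B (v :: vs) (fun x => exists2 a, A a & B (s *: x - a *: v))).
  - split; first by exists 0; rewrite ?scaler0 ?scale0r ?subr0; [apply: ideal0|apply: submod0].
    move=> q x y [a Aa Ba] [b Ab Bb]; exists (q * a + b).
      by apply: idealD => //; apply: idealMl.
    have -> : s *: (q *: x + y) - (q * a + b) *: v
              = q *: (s *: x - a *: v) + (s *: y - b *: v).
      by rewrite scalerDr !scalerA scalerBr !scalerA (mulrC s) scalerDl opprD addrACA.
    by case: sB => _; apply.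
  - move=> x Bx; exists 0; first exact: ideal0.
    by rewrite scale0r subr0; apply: submodZ.
  - move=> w j; rewrite inE => /orP[/eqP -> Aj|wvs Aj].
      exists (s * j); first exact: idealMl.
      by rewrite scalerA subrr; apply: submod0.
    have [c _ Bc] := Ht w wvs; exists (j * c); first exact: idealMr.
    by rewrite -!scalerA !scalerA (mulrC s) -!scalerA -scalerBr; apply: submodZ.
set u := s * r - a.
have Bu : B (u *: v) by rewrite scalerBl -scalerA.
(* The witness expands u s with u = r^(n+1) + (t r - a) and s = r^n + t: s brings [vs] into B + R v,
   and u brings v into B. *)
exists (n + n.+1)%N, (r ^+ n * (t * r - a) + t * u); split.
  apply: idealD => //; last exact: idealMr.
  by apply: idealMl => //; apply: idealB => //; apply: idealMr.
have -> : r ^+ (n + n.+1) + (r ^+ n * (t * r - a) + t * u) = u * s.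
  by rewrite /u /s exprD exprS; ring.
move=> w; rewrite inE => /orP[/eqP ->|wvs].
  by rewrite mulrC -scalerA; apply: submodZ.
have [c _ Bc] := Ht w wvs.
rewrite -scalerA; apply: (@submod_subl _ _ sB _ (u *: (c *: v))).
  by rewrite -scalerBr; apply: submodZ.
by rewrite scalerA mulrC -scalerA; apply: submodZ.
Qed.

(** The ideal b + (ys): parameters are added on top of a base ideal such as 0, J or Ann M. *)
Definition igen (b : R -> Prop) (ys : seq R) : R -> Prop :=
  @lspan R^o Rtrue b ys.

Lemma igen_ideal b ys : is_ideal b -> is_ideal (igen b ys).
Proof.
by move=> ib; apply/ideal_submod/lspan_submod; [exact: Rtrue_ideal|apply/ideal_submod].
Qed.
Lemma igen_base (b : R -> Prop) ys x : b x -> igen b ys x.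
Proof. by apply: lspan_base; exact: Rtrue_ideal. Qed.
Lemma igen_gen b ys y : is_ideal b -> y \in ys -> igen b ys y.
Proof.
move=> ib yys; have -> : y = (1 : R) *: (y : R^o) by rewrite scale1r.
by apply: lspan_gen => //; apply/ideal_submod.
Qed.
Lemma igen_min b ys (c : R -> Prop) :
  is_ideal c -> (forall x, b x -> c x) -> (forall y, y \in ys -> c y) ->
  forall x, igen b ys x -> c x.
Proof.
move=> ic bc yc; apply: (@lspan_min R^o Rtrue b ys c) => //; first by apply/ideal_submod.
by move=> v j vys _; apply: idealMl => //; apply: yc.
Qed.
Lemma igen_sub b ys b' ys' : is_ideal b' -> (forall x, b x -> igen b' ys' x) ->
  (forall y, y \in ys -> igen b' ys' y) -> forall x, igen b ys x -> igen b' ys' x.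
Proof. by move=> ib' H1 H2; apply: igen_min => //; apply: igen_ideal. Qed.

Lemma igen1P b y x : is_ideal b -> igen b [:: y] x <-> exists r, b (x - r * y).
Proof. by move=> ib; split=> [[r _ H]|[r H]]; exists r. Qed.

Definition Rzero : R -> Prop := fun x => x = 0.
Lemma Rzero_ideal : is_ideal Rzero.
Proof. by split=> //; split=> [x y -> ->|r x ->]; rewrite /Rzero ?addr0 ?mulr0. Qed.

Lemma radical_add (b : R -> Prop) x y : is_ideal b -> radical b x -> radical b y -> radical b (x + y).
Proof.
move=> ib [n bn] [k bk]; exists (n + k)%N.
rewrite exprDn; elim/big_ind: _ => [|u v|i _]; [exact: ideal0|exact: idealD|].
rewrite -mulr_natr; apply: idealMr => //.
have [ik|ki] := leqP i k.
  by apply: idealMr => //; apply: idealX_le bn => //; rewrite -addnBA // leq_addr.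
by apply: idealMl => //; apply: idealX_le bk => //; exact: ltnW.
Qed.

Lemma radical_ideal (b : R -> Prop) : is_ideal b -> is_ideal (radical b).
Proof.
move=> ib; split; first by exists 1%N; rewrite expr1; apply: ideal0.
split=> [x y|r x [n bn]]; first exact: radical_add.
by exists n; rewrite exprMn; apply: idealMl.
Qed.

Lemma radical_base (b : R -> Prop) x : b x -> radical b x.
Proof. by exists 1%N; rewrite expr1. Qed.

Lemma radical_mono (b c : R -> Prop) x : (forall x, b x -> c x) -> radical b x -> radical c x.
Proof. by move=> bc [n bn]; exists n; apply: bc. Qed.

Lemma radical_radical (b : R -> Prop) x : radical (radical b) x -> radical b x.
Proof. by move=> [n [k]]; rewrite -exprM; exists (n * k)%N. Qed.

Lemma prime_exp (P : R -> Prop) x n : is_prime_ideal P -> P (x ^+ n) -> P x.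
Proof.
move=> [iP [P1 PM]]; elim: n => [//|n IH]; rewrite exprS => /PM[//|]; exact: IH.
Qed.

End Submodules.

Section Noetherian.
Variable R : comNzRingType.
Hypothesis noeth : noetherian_ring R.

Lemma noeth_ind (Phi : (R -> Prop) -> Prop) :
  (forall b, is_ideal b ->
     (forall b', is_ideal b' -> psubset b b' -> ~ psubset b' b -> Phi b') -> Phi b) ->
  forall b, is_ideal b -> Phi b.
Proof.
move=> step b ib; apply: contrapT => nb.
pose T := {b : R -> Prop | is_ideal b /\ ~ Phi b}.
pose Q (t t' : T) := psubset (sval t) (sval t') /\ ~ psubset (sval t') (sval t).
have [|f [_ fP]] := @dependent_choice T Q (exist _ b (conj ib nb)).
  move=> [c [ic nc]]; apply: contrapT => H; apply: (nc); apply: step => // b' ib' s1 s2.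
  by apply: contrapT => nb'; apply: H; exists (exist _ b' (conj ib' nb')).
have [n|n|N HN] := noeth (c := fun n => sval (f n)).
- by case: (svalP (f n)).
- by case: (fP n).
by case: (fP N) => _; apply; apply: HN.
Qed.

Lemma noeth_fg_over (b I : R -> Prop) : is_ideal b -> is_ideal I ->
  psubset b I -> exists gs, forall x, I x <-> igen b gs x.
Proof.
move=> ib iI; move: b ib; apply: noeth_ind => b ib IH bI.
have [Ib|nIb] := pselect (psubset I b).
  by exists [::] => x; split; [apply: Ib|apply: bI].
have [x /not_implyP[Ix nbx]] : exists x, ~ (I x -> b x) by apply/existsNP.
have [||//||gs gsP] := IH (igen b [:: x]).
- exact: igen_ideal.
- by move=> y; apply: igen_base.
- by move=> H; apply: nbx; apply: H; apply: igen_gen; rewrite ?inE.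
- by apply: igen_min => //= y; rewrite inE => /eqP->.
exists (x :: gs) => y; split.
  move=> /gsP; apply: igen_sub => //; last first.
    by move=> z zgs; apply: igen_gen; rewrite // inE zgs orbT.
  apply: igen_sub => //; first by move=> z; apply: igen_base.
  by move=> z; rewrite inE => /eqP->; apply: igen_gen; rewrite // inE eqxx.
apply: igen_min => // z; rewrite inE => /orP[/eqP-> //|zgs].
by apply/gsP; apply: igen_gen; rewrite //; apply: igen_ideal.
Qed.

Lemma noeth_fg (I : R -> Prop) : is_ideal I ->
  exists gs, forall x, I x <-> igen (@Rzero R) gs x.
Proof.
move=> iI; apply: noeth_fg_over => //; first exact: Rzero_ideal.
by move=> x ->; apply: ideal0.
Qed.

(** An ideal maximal among those missing S is prime, and noetherian induction reaches one: if x y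
    lies in b but neither factor does, then b + (x) or b + (y) misses S, as otherwise b would
    contain a product of two elements of S. *)
Lemma prime_avoiding_mult (S b : R -> Prop) :
  S 1 -> (forall x y, S x -> S y -> S (x * y)) ->
  is_ideal b -> (forall x, b x -> ~ S x) ->
  exists P, [/\ is_prime_ideal P, psubset b P & forall x, P x -> ~ S x].
Proof.
move=> S1 SM; move: b; apply: noeth_ind => b ib IH bS.
have [pb|npb] := pselect (is_prime_ideal b); first by exists b; split.
have [x [y [bxy [nbx nby]]]] : exists x y, b (x * y) /\ ~ b x /\ ~ b y.
  apply: contrapT => H; apply: npb; split=> //; split; first by move=> b1; apply: (bS 1).
  move=> x y bxy; apply: contrapT => /not_orP[nx ny]; apply: H; by exists x, y.
have up z : ~ b z -> psubset b (igen b [:: z]) /\ ~ psubset (igen b [:: z]) b.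
  move=> nz; split; first by move=> w; apply: igen_base.
  by move=> H; apply: nz; apply: H; apply: igen_gen; rewrite ?inE.
have [d1|/existsNP[s /not_implyP[bs /contrapT Ss]]] :=
    pselect (forall s, igen b [:: x] s -> ~ S s).
  have [u1 u2] := up _ nbx.
  have [P [pP bP PS]] := IH _ (igen_ideal _ ib) u1 u2 d1.
  by exists P; split=> // w bw; apply: bP; apply: u1.
have [d2|/existsNP[t /not_implyP[bt /contrapT St]]] :=
    pselect (forall s, igen b [:: y] s -> ~ S s).
  have [u1 u2] := up _ nby.
  have [P [pP bP PS]] := IH _ (igen_ideal _ ib) u1 u2 d2.
  by exists P; split=> // w bw; apply: bP; apply: u1.
exfalso; apply: (bS (s * t)); last exact: SM.
move: bs bt => /igen1P-/(_ ib)[p bp] /igen1P-/(_ ib)[q bq].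
have -> : s * t = t * (s - p * x) + p * x * (t - q * y) + p * q * (x * y) by ring.
by apply: idealD => //; [apply: idealD => //|]; apply: idealMl.
Qed.

(** If x y lies in b but neither factor does, a prime over b lies over b + (x) or b + (y), so the
    two lists are concatenated. The result covers the minimal primes over b and may contain
    others. *)
Lemma finite_primes_below (b : R -> Prop) : is_ideal b ->
  exists Ps : seq (R -> Prop),
    (forall P, List.In P Ps -> is_prime_ideal P /\ psubset b P) /\
    forall P, is_prime_ideal P -> psubset b P ->
      exists2 P', List.In P' Ps & psubset P' P.
Proof.
move: b; apply: noeth_ind => b ib IH.
have [b1|nb1] := pselect (b 1).
  by exists [::]; split=> // P [_ [P1 _]] bP; exfalso; apply: P1; apply: bP.
have [pb|npb] := pselect (is_prime_ideal b).
  exists [:: b]; split; first by move=> P /= [<-|//]; split.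
  by move=> P _ bP; exists b => //; left.
have [x [y [bxy [nbx nby]]]] : exists x y, b (x * y) /\ ~ b x /\ ~ b y.
  apply: contrapT => H; apply: npb; split=> //; split=> //.
  move=> x y bxy; apply: contrapT => /not_orP[nx ny]; apply: H; by exists x, y.
have up z : ~ b z -> psubset b (igen b [:: z]) /\ ~ psubset (igen b [:: z]) b.
  move=> nz; split; first by move=> w; apply: igen_base.
  by move=> H; apply: nz; apply: H; apply: igen_gen; rewrite ?inE.
have [x1 x2] := up _ nbx; have [y1 y2] := up _ nby.
have [Ps [Ps1 Ps2]] := IH _ (igen_ideal _ ib) x1 x2.
have [Qs [Qs1 Qs2]] := IH _ (igen_ideal _ ib) y1 y2.
exists (Ps ++ Qs); split.
  move=> P /List.in_app_iff[/Ps1[pP H]|/Qs1[pP H]]; split=> // z bz; apply: H.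
    exact: x1.
  exact: y1.
move=> P pP bP; have [iP [_ PM]] := (pP); have [Px|Py] := PM _ _ (bP _ bxy).
  have [|P' i1 i2] := Ps2 P pP.
    by apply: igen_min => // z; rewrite inE => /eqP->.
  by exists P' => //; apply/List.in_app_iff; left.
have [|P' i1 i2] := Qs2 P pP.
  by apply: igen_min => // z; rewrite inE => /eqP->.
by exists P' => //; apply/List.in_app_iff; right.
Qed.

End Noetherian.

(** * Prime avoidance and local rings *)

Section PrimeAvoidance.
Variable R : comNzRingType.

Lemma prime_avoid_inter (m P : R -> Prop) Ps z0 : is_ideal m -> is_prime_ideal P ->
  m z0 -> ~ P z0 ->
  (forall P', List.In P' Ps -> is_ideal P' /\ ~ psubset P' P) ->
  exists z, [/\ m z, ~ P z & forall P', List.In P' Ps -> P' z].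
Proof.
move=> im pP mz0 nPz0; have [_ [_ PM]] := (pP).
elim: Ps => [|P' Ps IH] H; first by exists z0.
have [|z [mz nPz Hz]] := IH; first by move=> Q HQ; apply: H; right.
have [iP' /existsNP[w /not_implyP[P'w nPw]]] := H P' (or_introl erefl).
exists (z * w); split; first exact: idealMr.
  by move=> /PM[].
move=> Q [<-|HQ]; first exact: idealMl.
apply: idealMr; first by case: (H Q (or_intror HQ)).
exact: Hz.
Qed.

Lemma prime_avoidance (m : R -> Prop) Ps : is_ideal m ->
  (forall P, List.In P Ps -> is_prime_ideal P /\ ~ psubset m P) ->
  exists2 x, m x & forall P, List.In P Ps -> ~ P x.
Proof.
move=> im; move: {2}(size Ps) (leqnn (size Ps)) => n.
elim: n Ps => [|n IH] [|P Ps]; try by exists 0 => //; exact: ideal0.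
rewrite /= ltnS => sz H; have [pP /existsNP[z0 /not_implyP[mz0 nPz0]]] := H P (or_introl erefl).
have [[P' [inP' P'P]]|nP'] :=
    pselect (exists P', List.In P' Ps /\ psubset P' P).
  have [l1 [l2 e]] := List.in_split _ _ inP'.
  have [||x mx Hx] := IH (P :: l1 ++ l2).
  - by move: sz; rewrite e !size_cat /= size_cat; lia.
  - move=> Q HQ; apply: H; case: HQ => [->|HQ]; [by left|right].
    by rewrite e; move/List.in_app_iff: HQ => [HQ|HQ]; apply/List.in_app_iff; [left|right; right].
  exists x => // Q [<-|]; first by apply: Hx; left.
  rewrite e => /List.in_app_iff[HQ|[<-|HQ]].
  - by apply: Hx; right; apply/List.in_app_iff; left.
  - by move=> /P'P; apply: Hx; left.
  - by apply: Hx; right; apply/List.in_app_iff; right.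
have [||x mx Hx] := IH Ps; rewrite //; first by move=> Q HQ; apply: H; right.
have [Px|nPx] := pselect (P x); last by exists x => // Q [<-//|]; exact: Hx.
have [|z [mz nPz Hz]] := prime_avoid_inter im pP mz0 nPz0 (Ps := Ps).
  move=> Q HQ; split; first by case: (H Q (or_intror HQ)) => -[].
  by move=> QP; apply: nP'; exists Q.
exists (x + z); first exact: idealD.
move=> Q [<-|HQ] Qxz.
  by apply: nPz; rewrite -[z](addKr x) addrC; apply: idealB => //; case: pP.
have [[iQ _] _] := H Q (or_intror HQ).
by apply: (Hx Q HQ); rewrite -[x](addrK z); apply: idealB => //; apply: Hz.
Qed.

End PrimeAvoidance.

Section Local.
Variable R : comNzRingType.
Hypothesis noeth : noetherian_ring R.
Variable m : R -> Prop.
Hypothesis loc : local_ring m.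

Lemma local_ideal : is_ideal m.
Proof. by case: loc => -[]. Qed.

Lemma local_n1 : ~ m 1.
Proof. by case: loc => -[_ []]. Qed.

Lemma proper_sub_local (b : R -> Prop) : is_ideal b -> ~ b 1 -> psubset b m.
Proof.
move=> ib nb1.
suff [m' [mm' bm']] : exists m', is_maximal_ideal m' /\ psubset b m'.
  by case: loc => _ H x bx; apply/(H _ mm'); apply: bm'.
move: b ib nb1; apply: noeth_ind => // b ib IH nb1.
have [mb|nmb] := pselect (is_maximal_ideal b); first by exists b; split.
have [c [ic [bc [ncb nc1]]]] : exists c, is_ideal c /\ psubset b c /\ ~ psubset c b /\ ~ c 1.
  apply: contrapT => H; apply: nmb; split=> //; split=> // c ic bc.
  by apply: contrapT => /not_orP[h1 h2]; apply: H; exists c.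
have [m' [h1 h2]] := IH c ic bc ncb nc1.
by exists m'; split=> // x /bc; apply: h2.
Qed.

Lemma local_unit r : ~ m r -> exists r', r' * r = 1.
Proof.
move=> nmr; apply: contrapT => H; apply: nmr.
have iz := Rzero_ideal R.
apply: (proper_sub_local (b := igen (@Rzero R) [:: r])); first exact: igen_ideal.
  by move=> /igen1P-/(_ iz)[s /subr0_eq e]; apply: H; exists s.
by apply: igen_gen; rewrite ?inE.
Qed.

Lemma local_prime : is_prime_ideal m.
Proof.
split; first exact: local_ideal.
split=> [|a b mab]; first exact: local_n1.
have [ma|/local_unit[a' e]] := pselect (m a); [by left|right].
by rewrite -[b]mul1r -e -mulrA; apply: idealMl => //; exact: local_ideal.
Qed.

Lemma prime_sub_local P : is_prime_ideal P -> psubset P m.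
Proof. by case=> iP [P1 _]; apply: proper_sub_local. Qed.

Lemma local_scale_inv (V : lmodType R) (B : V -> Prop) s x :
  submod B -> ~ m s -> B (s *: x) -> B x.
Proof.
move=> sB /local_unit[t e] Bx.
by rewrite -[x]scale1r -e -scalerA; apply: submodZ.
Qed.

Lemma exists_prime_not_local (b : R -> Prop) : is_ideal b ->
  ~ psubset m (radical b) -> exists P, [/\ is_prime_ideal P, psubset b P & ~ psubset m P].
Proof.
move=> ib /existsNP[z /not_implyP[mz nbz]].
have [||//||P [pP bP PS]] := @prime_avoiding_mult R noeth (fun x => exists n, x = z ^+ n) b.
- by exists 0%N.
- by move=> x y [n ->] [k ->]; exists (n + k)%N; rewrite exprD.
- by move=> x bx [n e]; apply: nbz; exists n; rewrite -e.
exists P; split=> // mP; apply: (PS z); last by exists 1%N.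
exact: mP.
Qed.

End Local.

(** * Powers of ideals and radicals *)

Section IdealPow.
Variable R : comNzRingType.

Lemma fsum_add (V : nmodType) (S : V -> Prop) x y : fsum S x -> fsum S y -> fsum S (x + y).
Proof.
move=> Sx Sy; elim: Sx => [|u v Su _ IH]; first by rewrite add0r.
by rewrite -addrA; apply: fsumD.
Qed.

Lemma fsum_min (V : nmodType) (S P : V -> Prop) : P 0 ->
  (forall x y, P x -> P y -> P (x + y)) -> (forall x, S x -> P x) ->
  forall x, fsum S x -> P x.
Proof. by move=> P0 PD SP x; elim=> // u v Su _ IH; apply: PD => //; apply: SP. Qed.

Lemma fsum_in (V : nmodType) (S : V -> Prop) x : S x -> fsum S x.
Proof. by move=> Sx; rewrite -[x]addr0; apply: fsumD => //; apply: fsum0. Qed.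

Lemma ideal_mul_ideal (I J : R -> Prop) : is_ideal I -> is_ideal (ideal_mul I J).
Proof.
move=> iI; split; first exact: fsum0.
split; first by move=> a b; apply: fsum_add.
move=> r; apply: fsum_min; first by rewrite mulr0; apply: fsum0.
  by move=> x y Hx Hy; rewrite mulrDr; apply: fsum_add.
move=> x [a [b [Ia [Jb ->]]]]; apply: fsum_in; exists (r * a), b.
by split; [apply: idealMl|rewrite mulrA].
Qed.

Lemma ideal_pow_ideal (I : R -> Prop) n : is_ideal (ideal_pow I n).
Proof. by elim: n => [|n IH] //=; apply: ideal_mul_ideal. Qed.

Lemma ideal_pow_mem (I : R -> Prop) n x : I x -> ideal_pow I n (x ^+ n).
Proof.
move=> Ix; elim: n => //= n IH; apply: fsum_in; exists (x ^+ n), x.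
by rewrite exprSr.
Qed.

Lemma ideal_pow_decr (I : R -> Prop) n k x : (n <= k)%N -> ideal_pow I k x -> ideal_pow I n x.
Proof.
move=> nk; rewrite -(subnKC nk); elim: (k - n)%N x => [|l IH] x; first by rewrite addn0.
rewrite addnS /= => H; apply: IH; move: x H.
have iI := ideal_pow_ideal I (n + l).
apply: fsum_min; [exact: ideal0|by move=> *; apply: idealD|].
by move=> _ [a [b [Ha [_ ->]]]]; apply: idealMr.
Qed.

Lemma ideal_pow_sub_prod (I C : R -> Prop) k n : is_ideal C ->
  psubset (ideal_pow I k) C -> psubset (ideal_pow I (n * k)) (ideal_pow C n).
Proof.
move=> iC IC; elim: n => [//|n IH] x; rewrite mulSn addnC => H.
(* Powers grow by one factor of I at a time, so the inclusion of I^(nk+l) in I^(nk) I^l needs its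
   own induction on l. *)
suff : forall l x, ideal_pow I (n * k + l) x ->
    fsum (fun x => exists a b, ideal_pow I (n * k) a /\ ideal_pow I l b /\ x = a * b) x.
  move=> /(_ k x H); apply: fsum_min; first exact: fsum0.
    by move=> u v; apply: fsum_add.
  move=> _ [a [b [Ha [Hb ->]]]]; apply: fsum_in; exists a, b.
  by split; [apply: IH|split; [apply: IC|]].
elim=> [|l IHl] {H}y.
  by rewrite addn0 => H; apply: fsum_in; exists y, 1; rewrite mulr1.
rewrite addnS /=; apply: fsum_min; first exact: fsum0.
  by move=> u v; apply: fsum_add.
move=> _ [a [b [/IHl Ha [Ib ->]]]]; move: a Ha.
apply: fsum_min; first by rewrite mul0r; apply: fsum0.
  by move=> u v Hu Hv; rewrite mulrDl; apply: fsum_add.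
move=> _ [c [e [Hc [He ->]]]]; apply: fsum_in; exists c, (e * b); rewrite mulrA.
by do 2 split=> //; apply: fsum_in; exists e, b.
Qed.

Lemma ideal_pow_igen1 (c : R -> Prop) g n : is_ideal c -> forall x,
  ideal_pow (igen c [:: g]) n x -> igen c [:: g ^+ n] x.
Proof.
move=> ic; elim: n => [|n IH] x; first by move=> _; apply/igen1P => //; exists x; rewrite expr0 mulr1 subrr; apply: ideal0.
have ii k := igen_ideal [:: g ^+ k] ic.
apply: fsum_min; [exact: ideal0|by move=> *; apply: idealD|].
move=> _ [a [b [/IH/igen1P-/(_ ic)[r Hr] [/igen1P-/(_ ic)[s Hs] ->]]]].
apply/igen1P => //; exists (r * s).
have -> : a * b - r * s * g ^+ n.+1 = (a - r * g ^+ n) * b + r * g ^+ n * (b - s * g).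
  by rewrite exprSr; ring.
by apply: idealD => //; [apply: idealMr|apply: idealMl].
Qed.

(** Generators are absorbed one at a time: if I^k lies in C + (g) and g^n in C, then I^(nk) lies in
    (C + (g))^n, hence in C + (g^n) = C. *)
Lemma ideal_pow_sub_of_radical (I C : R -> Prop) gs : is_ideal C ->
  (forall g, g \in gs -> radical C g) -> psubset I (igen C gs) ->
  exists k, psubset (ideal_pow I k) C.
Proof.
elim: gs C => [|g gs IH] C iC gC IC.
  exists 1%N; apply: fsum_min; [exact: ideal0|by move=> *; apply: idealD|].
  by move=> _ [a [b [_ [Ib ->]]]]; apply: idealMl => //; apply: IC.
have iC1 := igen_ideal [:: g] iC.
have [||k Hk] := IH (igen C [:: g]) iC1.
- move=> h hgs; have [|n Cn] := gC h; first by rewrite inE hgs orbT.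
  by exists n; apply: igen_base.
- move=> x /IC; apply: igen_sub => //; first by move=> y Cy; do 2 apply: igen_base.
  move=> y.
  rewrite inE => /orP[/eqP->|ygs]; last exact: igen_gen.
  by apply: igen_base; apply: igen_gen; rewrite ?inE.
have [|n Cn] := gC g; first by rewrite inE eqxx.
exists (n * k)%N => x /(ideal_pow_sub_prod iC1 Hk) /(ideal_pow_igen1 iC).
by apply: igen_min => // y; rewrite inE => /eqP->.
Qed.

End IdealPow.

(** * Chain conditions on subquotients *)

Section ChainConditions.
Variable R : comNzRingType.

(** One boolean lets both chain conditions share their proofs; [up_to (~~ asc)] is the reverse
    inclusion, which for a monotone chain expresses stabilization. *)
Definition up_to (asc : bool) {T} (A B : T -> Prop) :=
  if asc then psubset A B else psubset B A.

Lemma up_to_refl asc T (A : T -> Prop) : up_to asc A A.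
Proof. by case: asc => x. Qed.

Lemma up_to_mono asc T (P : nat -> T -> Prop) n k : (forall n, up_to asc (P n) (P n.+1)) ->
  (n <= k)%N -> up_to asc (P n) (P k).
Proof.
move=> H nk; rewrite -(subnKC nk); elim: (k - n)%N => [|l IH].
  by rewrite addn0; apply: up_to_refl.
rewrite addnS; have := H (n + l)%N; case: asc {H} IH => /= IH H x Px.
  by apply: H; apply: IH.
by apply: IH; apply: H.
Qed.

Lemma up_to_stable asc T (P : nat -> T -> Prop) N M n : (forall n, up_to asc (P n) (P n.+1)) ->
  (forall n, (N <= n)%N -> up_to (~~ asc) (P N) (P n)) ->
  (N <= M)%N -> (M <= n)%N -> up_to (~~ asc) (P M) (P n).
Proof.
move=> mon H NM Mn; have := H n (leq_trans NM Mn); have := up_to_mono mon NM.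
by case: asc {mon H} => /= h1 h2 x Px; [apply: h1; apply: h2|apply: h2; apply: h1].
Qed.

(* cc true Z B (resp. cc false Z B): the ascending (resp. descending) chain
   condition for the quotient Z/B. *)
Definition cc (asc : bool) (V : lmodType R) (Z B : V -> Prop) :=
  forall P : nat -> V -> Prop, (forall n, submod (P n)) ->
  (forall n, psubset B (P n)) -> (forall n, psubset (P n) Z) ->
  (forall n, up_to asc (P n) (P n.+1)) ->
  exists N, forall n, (N <= n)%N -> up_to (~~ asc) (P N) (P n).

(** Stands for a map between subquotients that is determined only after choosing lifts, such as a
    connecting homomorphism; a relation may stay multivalued. *)
Definition linear_rel (V W : lmodType R) (rho : V -> W -> Prop) :=
  rho 0 0 /\ forall r u w u' w', rho u w -> rho u' w' -> rho (r *: u + u') (r *: w + w').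

(** The hypotheses on [rho] make Z/B a subquotient of Z1/B1. A chain P is pushed forward to [P'],
    its image plus B1, and inclusions are reflected back. *)
Lemma cc_subquotient asc (V W : lmodType R) (Z B : V -> Prop) (Z1 B1 : W -> Prop) rho :
  linear_rel rho -> submod Z -> submod Z1 -> submod B1 -> psubset B1 Z1 ->
  (forall u, Z u -> exists2 w, Z1 w & rho u w) ->
  (forall u w, Z u -> rho u w -> B1 w -> B u) ->
  cc asc Z1 B1 -> cc asc Z B.
Proof.
move=> [rho0 rhoL] sZ sZ1 sB1 BZ1 Zex inj c1 P sP BP PZ monP.
pose P' n w := Z1 w /\ exists u w', [/\ P n u, B1 w' & rho u (w - w')].
have key a b : psubset (P' a) (P' b) -> psubset (P a) (P b).
  move=> sub u Pu; have [w Z1w ruw] := Zex u (PZ _ _ Pu).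
  have [|_ [u' [w' [Pu' Bw' r']]]] := sub w.
    by split=> //; exists u, 0; split=> //; [apply: submod0|rewrite subr0].
  apply: (submod_subl (sP b) (y := u')) => //; apply: BP.
  apply: (inj _ w') => //; first by apply: submodB => //; apply: PZ; eassumption.
  have := rhoL (-1) _ _ _ _ r' ruw.
  by rewrite !scaleN1r opprB subrK addrC.
have mono a b : psubset (P a) (P b) -> psubset (P' a) (P' b).
  by move=> sub w [Z1w [u [w' [Pu Bw' r]]]]; split=> //; exists u, w'; split=> //; apply: sub.
have [n|n|n|n|N HN] := c1 P'.
- split.
    split; first exact: submod0.
    by exists 0, 0; rewrite subr0; split=> //; apply: submod0.
  move=> r x y [Zx [u [w' [Pu Bw' h]]]] [Zy [v [x' [Pv Bx' h']]]]; split.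
    by case: sZ1 => _; apply.
  exists (r *: u + v), (r *: w' + x'); split.
  + by case: (sP n) => _; apply.
  + by case: sB1 => _; apply.
  + by rewrite opprD addrACA -scalerBr; apply: rhoL.
- move=> w Bw; split; first exact: BZ1.
  by exists 0, w; split=> //; [apply: submod0|rewrite subrr].
- by move=> w [].
- by have := monP n; case: asc {c1 monP} => /=; apply: mono.
exists N => n /HN; case: asc {c1 HN monP} => /=; exact: key.
Qed.

(** Modular law: a monotone chain is constant as soon as its traces [P1] on Z' and its sums [P2]
    with Z' are. *)
Lemma cc_ext asc (V : lmodType R) (Z Z' B : V -> Prop) :
  submod Z -> submod Z' -> psubset B Z' -> psubset Z' Z ->
  cc asc Z' B -> cc asc Z Z' -> cc asc Z B.
Proof.
move=> sZ sZ' BZ' Z'Z c1 c2 P sP BP PZ monP.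
pose P1 n u := P n u /\ Z' u.
pose P2 n u := exists2 v, P n v & Z' (u - v).
have mon1 n : up_to asc (P1 n) (P1 n.+1).
  by have := monP n; case: asc {c1 c2 monP} => /= H x [Px Zx]; split=> //; apply: H.
have mon2 n : up_to asc (P2 n) (P2 n.+1).
  by have := monP n; case: asc {c1 c2 monP mon1} => /= H x [v Pv Zv]; exists v => //; apply: H.
have [n|n|n|//|N1 HN1] := c1 P1.
- split; first by split; apply: submod0.
  by move=> r x y [Px Zx] [Py Zy]; split; [case: (sP n)|case: sZ'] => _; apply.
- by move=> x Bx; split; [apply: BP|apply: BZ'].
- by move=> x [].
have [n|n|n|//|N2 HN2] := c2 P2.
- split; first by exists 0; rewrite ?subr0; apply: submod0.
  move=> r x y [x' Px Zx] [y' Py Zy]; exists (r *: x' + y').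
    by case: (sP n) => _; apply.
  by rewrite opprD addrACA -scalerBr; case: sZ' => _; apply.
- by move=> x Zx; exists 0; rewrite ?subr0 //; apply: submod0.
- move=> x [v Pv Zv]; apply: (submod_subl sZ (y := v)); first exact: Z'Z.
  exact: (PZ n).
have key a b : psubset (P b) (P a) -> psubset (P1 a) (P1 b) -> psubset (P2 a) (P2 b) ->
    psubset (P a) (P b).
  move=> ba s1 s2 u Pu; have [|v Pv Zv] := s2 u.
    by exists u; rewrite // subrr; apply: submod0.
  apply: (submod_subl (sP b) (y := v)) => //.
  by apply: (s1 _ _).1; split=> //; apply: submodB => //; apply: ba.
exists (maxn N1 N2) => n mn.
have h1 := up_to_stable mon1 HN1 (leq_maxl _ _) mn.
have h2 := up_to_stable mon2 HN2 (leq_maxr _ _) mn.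
have h := up_to_mono monP mn.
by case: asc {c1 c2 monP HN1 HN2 mon1 mon2} h1 h2 h => /= h1 h2 h; apply: key.
Qed.

(* Over a prime ideal killing a noetherian subquotient Z/B, the members of a
   strictly descending saturated chain supply vectors independent modulo B. *)
Lemma noeth_killed_dcc (V : lmodType R) (Pr : R -> Prop) (Z B : V -> Prop) (D : nat -> V -> Prop) :
  cc true Z B -> submod Z -> submod B ->
  (forall p u, Pr p -> Z u -> B (p *: u)) ->
  (forall n, submod (D n)) -> (forall n, psubset B (D n)) -> (forall n, psubset (D n) Z) ->
  (forall n, psubset (D n.+1) (D n)) ->
  (forall n s u, ~ Pr s -> D n (s *: u) -> D n u) ->
  exists N, forall n, (N <= n)%N -> psubset (D N) (D n).
Proof.
move=> cZ sZ sB kill sD BD DZ Dd Dsat; apply: contrapT => H.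
have /choice[g gP] : forall N, exists p : nat * V,
    [/\ (N <= p.1)%N, D N p.2 & ~ D p.1 p.2].
  move=> N; apply: contrapT => H'; apply: H; exists N => n Nn x Dx.
  by apply: contrapT => nDx; apply: H'; exists (n, x).
pose nn k := iter k (fun N => (g N).1) 0%N; pose u k := (g (nn k)).2.
have Du k : D (nn k) (u k) by case: (gP (nn k)).
have nDu k : ~ D (nn k.+1) (u k) by case: (gP (nn k)).
have Ddec a b : (a <= b)%N -> psubset (D b) (D a).
  by move=> ab; apply: (@up_to_mono false _ D).
have nnS k : (nn k <= nn k.+1)%N by case: (gP (nn k)).
have nnM a b : (a <= b)%N -> (nn a <= nn b)%N.
  move=> ab; rewrite -(subnKC ab); elim: (b - a)%N => [|l IH]; first by rewrite addn0.
  by rewrite addnS; apply: leq_trans IH _.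
have iT := Rtrue_ideal R.
(* If a combination of u_i, ..., u_(i+l-1) modulo B lies in [D] at stage i+l, its terms after c u_i
   all lie in [D (nn i.+1)], so c u_i does too. As u_i does not, saturation forces c into [Pr],
   which kills u_i modulo B. *)
have key l : forall i x, lspan (@Rtrue R) B [seq u j | j <- iota i l] x ->
    D (nn (i + l)%N) x -> B x.
  elim: l => [//|l IH] i x /= [c _ Hx] Dx.
  have Dcu : D (nn i.+1) (c *: u i).
    apply: (submod_subr (sD _) (x := x)); last first.
      by apply: Ddec Dx; apply: nnM; lia.
    apply: lspan_min Hx; [exact: sD|exact: BD|].
    move=> v j /mapP[k]; rewrite mem_iota => /andP[ik _] -> _.
    by apply: submodZ => //; apply: Ddec (Du k); apply: nnM.
  have Bcu : B (c *: u i).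
    have [Pc|nPc] := pselect (Pr c); first by apply: kill => //; apply: DZ (Du i).
    by exfalso; apply: (nDu i); apply: Dsat nPc _.
  apply: (submod_subl sB) (Bcu); apply: IH Hx _.
  by apply: submodB; [exact: sD|rewrite addSnnS|exact: BD].
pose E k := lspan (@Rtrue R) B [seq u j | j <- iota 0 k].
have BZ : psubset B Z by move=> x /(BD 0%N); apply: DZ.
have [k|k|k|k|N HN] := cZ E.
- exact: lspan_submod.
- by move=> x; apply: lspan_base.
- apply: lspan_min => // v j /mapP[i _ ->] _.
  by apply: submodZ => //; apply: DZ (Du i).
- move=> x; apply: lspan_min; [by apply: lspan_submod|by move=> *; apply: lspan_base|].
  move=> v j vs _; apply: lspan_gen => //.
  by move: vs; rewrite -[k.+1]addn1 iotaD map_cat mem_cat => ->.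
have BuN : B (u N).
  apply: (key N 0%N); last exact: Du.
  apply: (HN N.+1) => //; rewrite -[u N]scale1r; apply: lspan_gen => //.
  by apply: map_f; rewrite mem_iota add0n ltnSn.
by apply: (nDu N); apply: BD.
Qed.

End ChainConditions.

(** * Krull's height theorem *)

Section Height.
Variable R : comNzRingType.
Hypothesis noeth : noetherian_ring R.

Lemma noeth_ring_cc (Z B : R -> Prop) : @cc R true R^o Z B.
Proof.
move=> P sP _ _ H; have [n|//|N HN] := noeth (c := P); first by apply/ideal_submod.
by exists N.
Qed.

(* The contraction to R of the extension of D to the localization at P. *)
Definition saturation (P D : R -> Prop) : R -> Prop := fun r => exists2 s, ~ P s & D (s * r).

Section Saturation.
Variable P : R -> Prop.
Hypothesis pP : is_prime_ideal P.

Lemma prime_nM s t : ~ P s -> ~ P t -> ~ P (s * t).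
Proof. by case: pP => _ [_ PM] ns nt /PM[]. Qed.

Lemma prime_nX s n : ~ P s -> ~ P (s ^+ n).
Proof. by move=> ns /(prime_exp pP). Qed.

Lemma prime_n1 : ~ P 1. Proof. by case: pP => _ []. Qed.

Lemma prime_nadd s p : ~ P s -> P p -> ~ P (s + p).
Proof.
move=> ns Pp Psp; apply: ns; rewrite -[s](addrK p); apply: idealB => //.
by case: pP.
Qed.

Lemma saturation_ideal (D : R -> Prop) : is_ideal D -> is_ideal (saturation P D).
Proof.
move=> iD; split; first by exists 1; [exact: prime_n1|rewrite mulr0; apply: ideal0].
split=> [a b [s ns Da] [t nt Db]|r a [s ns Da]].
  exists (s * t); first exact: prime_nM.
  have -> : s * t * (a + b) = t * (s * a) + s * (t * b) by ring.
  by apply: idealD => //; apply: idealMl.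
by exists s; rewrite // mulrCA; apply: idealMl.
Qed.

Lemma saturation_base (D : R -> Prop) x : D x -> saturation P D x.
Proof. by exists 1; [exact: prime_n1|rewrite mul1r]. Qed.

Lemma saturation_sat (D : R -> Prop) s x : ~ P s -> saturation P D (s * x) -> saturation P D x.
Proof. by move=> ns [t nt Dx]; exists (t * s); [exact: prime_nM|rewrite -mulrA]. Qed.

Lemma saturation_mono (D E : R -> Prop) x : (forall x, D x -> E x) ->
  saturation P D x -> saturation P E x.
Proof. by move=> DE [s ns Ds]; exists s => //; apply: DE. Qed.

Lemma saturation_min (D E : R -> Prop) : (forall x, D x -> E x) ->
  (forall s x, ~ P s -> E (s * x) -> E x) -> forall x, saturation P D x -> E x.
Proof. by move=> DE sat x [s ns Ds]; apply: (sat s) => //; apply: DE. Qed.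

Lemma common_scale (V : lmodType R) (B : V -> Prop) (gs : seq V) : submod B ->
  (forall g, g \in gs -> exists2 s, ~ P s & B (s *: g)) ->
  exists2 s, ~ P s & forall g, g \in gs -> B (s *: g).
Proof.
move=> sB; elim: gs => [|g gs IH] H; first by exists 1; [exact: prime_n1|].
have [s ns Hs] := H g (mem_head _ _).
have [|t nt Ht] := IH; first by move=> h hgs; apply: H; rewrite inE hgs orbT.
exists (s * t); first exact: prime_nM.
move=> h; rewrite inE => /orP[/eqP->|hgs].
  by rewrite mulrC -scalerA; apply: submodZ.
by rewrite -scalerA; apply: submodZ => //; apply: Ht.
Qed.

Lemma local_nakayama (V : lmodType R) (B : V -> Prop) (gs : seq V) : submod B ->
  (forall g, g \in gs -> exists2 s, ~ P s & lspan P B gs (s *: g)) ->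
  exists2 s, ~ P s & forall g, g \in gs -> B (s *: g).
Proof.
move=> sB H; have [iP _] := pP.
have [s ns Hs] := common_scale (lspan_submod iP _ sB) H.
have [n [t [Pt Ht]]] := determinant_trick iP sB Hs.
by exists (s ^+ n + t) => //; apply: prime_nadd => //; apply: prime_nX.
Qed.

(* The localization at P modulo c is artinian when c contains a power of P. *)
Lemma saturated_dcc (c : R -> Prop) N (D : nat -> R -> Prop) : is_ideal c ->
  psubset (ideal_pow P N) (saturation P c) ->
  (forall n, is_ideal (D n)) -> (forall n, psubset c (D n)) ->
  (forall n, psubset (D n.+1) (D n)) ->
  (forall n s x, ~ P s -> D n (s * x) -> D n x) ->
  exists M, forall n, (M <= n)%N -> psubset (D M) (D n).
Proof.
move=> ic Nc iD cD Dd Dsat.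
pose F i := saturation P (ideal_add (ideal_pow P i) c).
have iadd i : is_ideal (ideal_add (ideal_pow P i) c).
  have ip := ideal_pow_ideal P i; split.
    by exists 0, 0; rewrite addr0; do 2! (split; first exact: ideal0).
  split=> [_ _ [a [b [Ha [Hb ->]]]] [a' [b' [Ha' [Hb' ->]]]]|r _ [a [b [Ha [Hb ->]]]]].
    by exists (a + a'), (b + b'); do 2! (split; first exact: idealD); rewrite addrACA.
  by exists (r * a), (r * b); do 2! (split; first exact: idealMl); rewrite mulrDr.
have iF i : is_ideal (F i) by apply: saturation_ideal.
have FN n : psubset (F N) (D n).
  apply: saturation_min; last by move=> s x; apply: Dsat.
  move=> _ [a [b [/Nc Ha [Hb ->]]]]; apply: idealD => //; last exact: cD.
  by move: a Ha; apply: saturation_min; [exact: cD|exact: Dsat].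
have Ddec a b : (a <= b)%N -> psubset (D b) (D a).
  by move=> ab; apply: (@up_to_mono false _ D).
(* The powers of P cut out layers F i / F i.+1 killed by P, each with the descending chain
   condition. The induction adds one layer at a time, starting from F N, which lies in every
   [D n]. *)
suff key k : exists M, forall n, (M <= n)%N ->
    psubset (fun x => D M x /\ F (N - k)%N x) (D n).
  have [M HM] := key N; exists M => n Mn x Dx; apply: (HM n Mn); split=> //.
  rewrite subnn; apply: saturation_base; exists x, 0.
  by rewrite addr0; do 2 split=> //; apply: ideal0.
elim: k => [|k [M1 HM1]]; first by exists 0%N => n _ x [_]; rewrite subn0; apply: FN.
have [Nk|kN] := leqP N k.
  exists M1 => n Mn x H; apply: (HM1 n Mn); move: H.
  by have -> : (N - k.+1 = N - k)%N by lia.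
set i := (N - k.+1)%N; have ei : (N - k = i.+1)%N by rewrite /i; lia.
rewrite ei in HM1.
pose D1 n := saturation P (fun x => exists2 d, D n d & F i d /\ F i.+1 (x - d)).
have iD1' n : is_ideal (fun x => exists2 d, D n d & F i d /\ F i.+1 (x - d)).
  split; first by exists 0; rewrite ?subr0; do ?split; apply: ideal0.
  split=> [x y [d Dd' [Fd Fx]] [e De [Fe Fy]]|r x [d Dd' [Fd Fx]]].
    exists (d + e); first exact: idealD.
    by split; [exact: idealD|rewrite opprD addrACA; apply: idealD].
  exists (r * d); first exact: idealMl.
  by split; [exact: idealMl|rewrite -mulrBr; apply: idealMl].
have iD1 n : is_ideal (D1 n) by apply: saturation_ideal.
have FFi : psubset (F i.+1) (F i).
  move=> x; apply: saturation_mono => _ [a [b [Ha [Hb ->]]]]; exists a, b; split=> //.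
  exact: ideal_pow_decr Ha.
have [||p u Pp|n|n|n|n|n s u ns|M2 HM2] :=
    @noeth_killed_dcc _ R^o P (F i) (F i.+1) D1 (@noeth_ring_cc _ _).
- exact/ideal_submod.
- exact/ideal_submod.
- move=> [s ns [a [b [Ha [Hb e]]]]]; exists s => //; exists (a * p), (b * p).
  split; first by apply: fsum_in; exists a, p.
  split; first exact: idealMr.
  by rewrite -mulrDl -e mulrCA mulrC.
- exact/ideal_submod.
- move=> x Fx; apply: saturation_base; exists 0; first exact: ideal0.
  by rewrite subr0; split=> //; apply: ideal0.
- apply: saturation_min; last by move=> s x; apply: saturation_sat.
  by move=> x [d _ [Fd Fx]]; rewrite -[x](subrK d); apply: idealD => //; apply: FFi.
- by move=> x; apply: saturation_mono => y [d Dn H]; exists d => //; apply: Dd.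
- exact: saturation_sat.
exists (maxn M1 M2) => n; rewrite geq_max => /andP[n1 n2] x [Dx Fx].
have /(HM2 n n2)[s ns [d Dn [Fd Fsx]]] : D1 M2 x.
  apply: saturation_base; exists x; first exact: Ddec (leq_maxr _ _) _ Dx.
  by split=> //; rewrite subrr; apply: ideal0.
apply: (Dsat n s) => //; rewrite -[s * x](subrK d); apply: idealD => //.
apply: (HM1 n n1); split=> //; apply: idealB => //.
  by apply: idealMl => //; apply: Ddec Dx; apply: leq_maxl.
exact: (Ddec M1 n).
Qed.

End Saturation.

(* covers P b: the ideal b becomes primary to the maximal ideal in the
   localization at P, i.e. P is minimal over b. *)
Definition covers (P b : R -> Prop) := psubset P (radical (saturation P b)).

Lemma ideal_add_ideal (I J : R -> Prop) : is_ideal I -> is_ideal J -> is_ideal (ideal_add I J).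
Proof.
move=> iI iJ; split; first by exists 0, 0; rewrite addr0; do 2! (split; first exact: ideal0).
split=> [_ _ [a [b [Ha [Hb ->]]]] [a' [b' [Ha' [Hb' ->]]]]|r _ [a [b [Ha [Hb ->]]]]].
  by exists (a + a'), (b + b'); do 2! (split; first exact: idealD); rewrite addrACA.
by exists (r * a), (r * b); do 2! (split; first exact: idealMl); rewrite mulrDr.
Qed.

(* The symbolic powers of Q are eventually constant modulo b because the
   localization at P modulo b + (y) is artinian. *)
Lemma principal_ideal_theorem (P Q b : R -> Prop) y :
  is_prime_ideal P -> is_prime_ideal Q -> is_ideal b ->
  psubset b Q -> psubset Q P -> P y -> ~ Q y -> covers P (igen b [:: y]) -> covers Q b.
Proof.
move=> pP pQ ib bQ QP Py nQy cov; have [iP [_ PM]] := pP; have [iQ [_ QM]] := pQ.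
pose Qs n := saturation Q (ideal_add (ideal_pow Q n) b).
have iQs n : is_ideal (Qs n).
  by apply: saturation_ideal => //; apply: ideal_add_ideal => //; apply: ideal_pow_ideal.
have bQs n x : b x -> Qs n x.
  move=> bx; apply: saturation_base => //; exists 0, x; rewrite add0r.
  by split=> //; apply: ideal0; apply: ideal_pow_ideal.
have Qsd n : psubset (Qs n.+1) (Qs n).
  move=> x; apply: saturation_mono => _ [u [v [Hu [Hv ->]]]]; exists u, v.
  by split=> //; apply: ideal_pow_decr Hu.
pose D n := saturation P (igen (Qs n) [:: y]).
have [gs gsP] := noeth_fg noeth iP.
have iby := igen_ideal [:: y] ib.
have [|||N HN] := @ideal_pow_sub_of_radical _ P (saturation P (igen b [:: y])) gs.
- exact: saturation_ideal.
- by move=> g ggs; apply: cov; apply/gsP; apply: igen_gen => //; exact: Rzero_ideal.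
- move=> x /gsP; apply: igen_sub; first exact: saturation_ideal.
    by move=> z ->; apply: ideal0; apply: igen_ideal; apply: saturation_ideal.
  by move=> z zgs; apply: igen_gen => //; apply: saturation_ideal.
have [n|n|n|n s x|M HM] := @saturated_dcc P pP (igen b [:: y]) N D iby HN.
- by apply: saturation_ideal => //; apply: igen_ideal.
- move=> x Hx; apply: saturation_base => //; move: x Hx; apply: igen_sub => //.
    by move=> x bx; apply: igen_base; apply: bQs.
  by move=> z zy; apply: igen_gen.
- move=> x; apply: saturation_mono; apply: igen_sub => //.
    by move=> z /Qsd; apply: igen_base.
  by move=> z zy; apply: igen_gen.
- exact: saturation_sat.
(* Stability of [D] at M gives s r = t y modulo [Qs M.+1]; since y is outside Q and [Qs M] is
   saturated, t is again in [Qs M]. Thus locally at P, [Qs M] lies in [Qs M.+1] + y [Qs M], and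
   Nakayama yields [QsE]. *)
have step r : Qs M r -> exists2 s, ~ P s & exists2 t, Qs M t & Qs M.+1 (s * r - t * y).
  move=> Qr; have [|s ns /igen1P-/(_ (iQs _))[t Ht]] := HM M.+1 (leqnSn M) r.
    by apply: saturation_base => //; apply: igen_base.
  have Qyt : Qs M (y * t).
    rewrite mulrC -[t * y](subKr (s * r)); apply: (idealB (iQs M)); last exact: Qsd.
    exact: (idealMl _ (iQs M)).
  by exists s => //; exists t => //; apply: (saturation_sat pQ nQy).
have QsE : psubset (Qs M) (Qs M.+1).
  have [hs hsP] := noeth_fg noeth (iQs M).
  have [|g ghs|s ns Hs] := @local_nakayama P pP R^o (Qs M.+1) hs.
  - exact/ideal_submod.
  - have /step[s ns [t Qt Hst]] : Qs M g.
      by apply/hsP; apply: igen_gen => //; exact: Rzero_ideal.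
    exists s => //.
    have sl : @submod R R^o (lspan P (Qs M.+1 : R^o -> Prop) hs).
      by apply: lspan_submod => //; exact/ideal_submod.
    apply: (submod_subl sl (y := (t * y : R^o))); first exact: (@lspan_base R R^o P iP _ _ _ Hst).
    move/hsP: Qt; apply: (@lspan_min R R^o (@Rtrue R) (@Rzero R) hs
      (fun t => lspan P (Qs M.+1 : R^o -> Prop) hs (t * y : R^o))).
    + split; first by rewrite mul0r; apply: submod0.
      move=> r a c Ha Hc; rewrite mulrDl -[_ * y]mulrA.
      by case: sl => _; apply.
    + by move=> x ->; rewrite mul0r; apply: submod0.
    + move=> v j vs _; have -> : (j *: v : R^o) * y = (j * y) *: v.
        by rewrite /GRing.scale /=; ring.
      by apply: lspan_gen => //; [exact/ideal_submod|apply: idealMl].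
  move=> x /hsP; apply: igen_min => //; first by move=> z ->; apply: ideal0.
  move=> h hhs; apply: (saturation_sat pQ (s := s)); last exact: Hs.
  by move=> /QP.
(* Nakayama again, now at Q: locally Q^M lies in Q^(M+1) + b, so a single s outside Q multiplies Q^M
   into b. *)
have [hs hsP] := noeth_fg noeth (ideal_pow_ideal Q M).
have [|g ghs|s ns Hs] := @local_nakayama Q pQ R^o b hs.
- exact/ideal_submod.
- have /QsE[s ns [u [v [Hu [bv e]]]]] : Qs M g.
    apply: saturation_base => //; exists g, 0; rewrite addr0.
    split; last by split=> //; apply: ideal0.
    by apply/hsP; apply: igen_gen => //; exact: Rzero_ideal.
  exists s => //; rewrite [s *: g]e.
  have sl : @submod R R^o (lspan Q (b : R^o -> Prop) hs).
    by apply: lspan_submod => //; exact/ideal_submod.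
  apply: (submodD sl); last exact: (@lspan_base R R^o Q iQ _ _ _ bv).
  move: u Hu {e} => /=; apply: fsum_min; first exact: (submod0 sl).
    by move=> *; apply: (submodD sl).
  move=> _ [a [c [/hsP Ha [Qc ->]]]].
  move: a Ha; apply: (@lspan_min R R^o (@Rtrue R) (@Rzero R) hs
      (fun a => lspan Q (b : R^o -> Prop) hs (a * c : R^o))).
  + split; first by rewrite mul0r; apply: submod0.
    move=> r x z Hx Hz; rewrite mulrDl -[_ * c]mulrA.
    by case: sl => _; apply.
  + by move=> x ->; rewrite mul0r; apply: submod0.
  + move=> w j vs _; have -> : (j *: w : R^o) * c = (j * c) *: w.
      by rewrite /GRing.scale /=; ring.
    by apply: lspan_gen => //; [exact/ideal_submod|apply: idealMl].
move=> z Qz; exists M, s => //.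
have /hsP Hz := ideal_pow_mem M Qz.
suff : forall x, igen (@Rzero R) hs x -> b (s * x) by apply.
apply: (@igen_min R _ _ (fun x => b (s * x))) => //.
- split; first by rewrite mulr0; apply: ideal0.
  split=> [x x' Hx Hx'|r x Hx]; first by rewrite mulrDr; apply: idealD.
  by rewrite mulrCA; apply: idealMl.
- by move=> x ->; rewrite mulr0; apply: ideal0.
Qed.

Lemma maximal_prime_below (P Q0 : R -> Prop) : is_prime_ideal Q0 -> psubset Q0 P -> ~ psubset P Q0 ->
  exists Q, [/\ is_prime_ideal Q, psubset Q0 Q, psubset Q P, ~ psubset P Q &
    forall Q', is_prime_ideal Q' -> psubset Q Q' -> psubset Q' P ->
      psubset Q' Q \/ psubset P Q'].
Proof.
move=> pQ0 Q0P nPQ0; have [iQ0 _] := pQ0; move: pQ0 Q0P nPQ0.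
move: Q0 iQ0; apply: noeth_ind => // Q iQ IH pQ QP nPQ.
have [H|] := pselect (forall Q', is_prime_ideal Q' -> psubset Q Q' -> psubset Q' P ->
      psubset Q' Q \/ psubset P Q'); first by exists Q; split.
move=> /existsNP[Q' /not_implyP[pQ' /not_implyP[QQ' /not_implyP[Q'P /not_orP[n1 n2]]]]].
have iQ' : is_ideal Q' by case: pQ'.
have [Q'' [h1 h2 h3 h4 h5]] := IH Q' iQ' QQ' n1 pQ' Q'P n2.
by exists Q''; split=> // x /QQ'; apply: h2.
Qed.

(** The last but one prime of the chain is enlarged to a Q maximal strictly below P, and some y of
    [ys] lies outside Q. Locally at P a power of every other generator lies in Q + (y), so that
    generator is traded for an element of Q; the principal ideal theorem over b plus these elements
    passes from P to Q with one generator fewer. The base ideal b makes the statement stable under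
    this step. *)
Lemma height_bound ys : forall (P b : R -> Prop), is_prime_ideal P -> is_ideal b ->
  psubset b P -> (forall y, y \in ys -> P y) -> covers P (igen b ys) ->
  forall n (c : nat -> R -> Prop),
    (forall k, (k <= n)%N -> is_prime_ideal (c k) /\ psubset b (c k)) ->
    (forall k, (k < n)%N -> psubset (c k) (c k.+1) /\ ~ psubset (c k.+1) (c k)) ->
    psubset (c n) P -> (n <= size ys)%N.
Proof.
move: {2}(size ys) (erefl (size ys)) => d.
elim: d ys => [|d IH] ys sz P b pP ib bP ysP cov [//|n] c cpr cst cP.
  exfalso; move/size0nil: sz => e; have [h1 h2] := cst n (ltnSn n).
  have [pc bc] := cpr n (leqnSn n); apply: h2 => x /cP /cov.
  rewrite e => -[k [s ns Hs]]; apply: (prime_exp pc (n := k)).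
  have [ic [_ cM]] := pc; have [cs|//] := cM _ _ (bc _ Hs).
  by exfalso; apply: ns; apply: cP; apply: h1.
rewrite sz ltnS; have [h1 h2] := cst n (ltnSn n).
have [pc bc] := cpr n (leqnSn n).
have [||Q [pQ cQ QP nPQ Qmax]] := @maximal_prime_below P (c n) pc.
- by move=> x /h1; apply: cP.
- by move=> H; apply: h2 => x /cP; apply: H.
have [iQ [_ QM]] := pQ; have bQ : psubset b Q by move=> x /bc; apply: cQ.
have [y yys nQy] : exists2 y, y \in ys & ~ Q y.
  apply: contrapT => H; apply: nPQ => x /cov[k [s ns Hs]].
  apply: (prime_exp pQ (n := k)).
  have /QM[Qs|//] : Q (s * x ^+ k).
    move: Hs; apply: igen_min => // y yys; apply: contrapT => nQy.
    by apply: H; exists y.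
  by case: ns; apply: QP.
have iQy := igen_ideal [:: y] iQ.
(* By maximality of Q, a prime over Q + (y) inside P must be P itself, so no such prime can miss all
   products s v^k with s outside P. *)
have red v : P v -> exists w, Q w /\ exists s k r, ~ P s /\ s * v ^+ k = w + r * y.
  move=> Pv; apply: contrapT => H.
  have [||//|x Hx [s [k [ns e]]]|P' [pP' QP' P'S]] := @prime_avoiding_mult R noeth
     (fun x => exists s k, ~ P s /\ x = s * v ^+ k) (igen Q [:: y]).
  - by exists 1, 0%N; rewrite mul1r; split=> //; apply: prime_n1.
  - move=> _ _ [s [k [ns ->]]] [t [l [nt ->]]]; exists (s * t), (k + l)%N.
    by split; [apply: prime_nM|rewrite exprD mulrACA].
  - move: Hx; rewrite e => /igen1P-/(_ iQ)[r Hr]; apply: H.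
    by exists (s * v ^+ k - r * y); split=> //; exists s, k, r; rewrite subrK.
  have P'P : psubset P' P.
    move=> x P'x; apply: contrapT => nPx; apply: (P'S x) => //.
    by exists x, 0%N; rewrite mulr1.
  have QP'' : psubset Q P' by move=> x Qx; apply: QP'; apply: igen_base.
  have P'y : P' y by apply: QP'; apply: igen_gen; rewrite ?inE.
  have [/(_ y P'y)//|/(_ v Pv) P'v] := Qmax P' pP' QP'' P'P.
  apply: (P'S v) => //; exists 1, 1%N; split; first exact: prime_n1.
  by rewrite mul1r.
have /choice[f fP] : forall v, exists w, P v -> Q w /\ exists s k r, ~ P s /\ s * v ^+ k = w + r * y.
  move=> v; have [Pv|nPv] := pselect (P v); last by exists 0.
  by have [w Hw] := red v Pv; exists w.
pose ws := map f (rem y ys).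
have wsz : size ws = d by rewrite size_map size_rem // sz.
have wsQ w : w \in ws -> Q w.
  by move=> /mapP[v /mem_rem vys ->]; case: (fP v (ysP v vys)).
have iws := igen_ideal ws ib.
have iwsy := igen_ideal [:: y] iws.
have cov' : covers P (igen (igen b ws) [:: y]).
  have isat := saturation_ideal pP iwsy.
  suff sub : forall x, igen b ys x -> radical (saturation P (igen (igen b ws) [:: y])) x.
    move=> z /cov[k [s ns /sub[l [t nt Ht]]]]; exists (k * l)%N, (t * s ^+ l).
      by apply: prime_nM => //; apply: prime_nX.
    by rewrite -mulrA exprM -exprMn.
  apply: igen_min; first exact: radical_ideal.
    by move=> x bx; apply: radical_base; apply: saturation_base => //; do 2 apply: igen_base.
  move=> v vys; have [->|nvy] := eqVneq v y.
    by apply: radical_base; apply: saturation_base => //; apply: igen_gen; rewrite ?inE.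
  have [_ [s [k [r [ns e]]]]] := fP v (ysP v vys).
  exists k, s => //; rewrite e; apply: idealD => //.
    apply: igen_base; apply: igen_gen => //; apply: map_f.
    by move: vys; rewrite (perm_mem (perm_to_rem yys)) inE (negPf nvy).
  by apply: idealMl => //; apply: igen_gen; rewrite ?inE.
rewrite -wsz; apply: (IH ws wsz Q b pQ ib bQ wsQ _ n c) => //.
- apply: (principal_ideal_theorem pP pQ iws _ QP _ nQy cov'); last exact: ysP.
  exact: igen_min.
- by move=> k kn; apply: cpr; apply: leqW.
- by move=> k kn; apply: cst; apply: leqW.
Qed.

Variable m : R -> Prop.
Hypothesis loc : local_ring m.

Lemma chain_length_le (a : R -> Prop) ys n : is_ideal a -> (forall y, y \in ys -> m y) ->
  psubset m (radical (igen a ys)) -> prime_chain_above a n -> (n <= size ys)%N.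
Proof.
move=> ia ysm mrad [c [cpr cst]].
have pm := local_prime noeth loc.
have cm k : (k <= n)%N -> psubset (c k) m.
  by move=> /cpr[pc _]; apply: (prime_sub_local noeth loc).
apply: (@height_bound ys m a) (cpr) cst (cm n _) => //.
- by move=> x ax; apply: (cm 0%N) => //; case: (cpr 0%N isT) => _; apply.
- by move=> x /mrad; apply: radical_mono => z; apply: saturation_base.
Qed.

(** While i < d, m is not in the radical of a + (ys), so the next element can be taken outside all
    listed primes over a + (ys) that do not contain m. Each such choice lengthens by one the chain
    below every prime over the new ideal. *)
Lemma chain_of_parameters (a : R -> Prop) d : is_ideal a -> ~ a 1 ->
  (forall ys, (forall y, y \in ys -> m y) -> psubset m (radical (igen a ys)) -> (d <= size ys)%N) ->
  prime_chain_above a d.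
Proof.
move=> ia na1 dmin; have im := local_ideal loc; have pm := local_prime noeth loc.
suff key i : (i <= d)%N -> exists ys, [/\ size ys = i, forall y, y \in ys -> m y &
    forall P, is_prime_ideal P -> psubset (igen a ys) P ->
      exists c : nat -> R -> Prop,
       [/\ forall k, (k <= i)%N -> is_prime_ideal (c k) /\ psubset a (c k),
           forall k, (k < i)%N -> psubset (c k) (c k.+1) /\ ~ psubset (c k.+1) (c k) &
           c i = P]].
  have [ys [_ ysm H]] := key d (leqnn d).
  have [//||c [c1 c2 _]] := H m; last by exists c.
  apply: igen_min => //; exact: proper_sub_local.
elim: i => [|i IH] id.
  exists [::]; split=> // P pP aP; exists (fun=> P); split=> // k _; split=> // x.
have [ys [sz ysm H]] := IH (ltnW id).
have iys := igen_ideal ys ia.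
have nrad : ~ psubset m (radical (igen a ys)).
  by move=> /(dmin _ ysm); rewrite sz leqNgt id.
have [P0 [pP0 ysP0 nmP0]] := exists_prime_not_local noeth iys nrad.
have [Ps [Ps1 Ps2]] := finite_primes_below noeth iys.
have [l lP] : exists l, forall P, List.In P l <-> (List.In P Ps /\ ~ psubset m P).
  elim: Ps {Ps1 Ps2} => [|P Ps [l Hl]]; first by exists [::] => P /=; tauto.
  have [mP|nmP] := pselect (psubset m P).
    by exists l => Q; rewrite Hl /=; split=> [[]|[[<-|]]]; tauto.
  by exists (P :: l) => Q /=; rewrite Hl; split=> [[<-|[]]|[[<-|]]]; tauto.
have [|y my Hy] := @prime_avoidance R m l im.
  by move=> P /lP[/Ps1[]].
exists (y :: ys); split; first by rewrite /= sz.
  by move=> z; rewrite inE => /orP[/eqP->|/ysm].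
move=> P pP yP.
have ysP : psubset (igen a ys) P.
  move=> x Hx; apply: yP; move: x Hx; apply: igen_sub => //.
    by move=> z; apply: igen_base.
  by move=> z zys; apply: igen_gen; rewrite // inE zys orbT.
have Py : P y by apply: yP; apply: igen_gen; rewrite ?inE ?eqxx.
(* When P is m itself, a listed prime below P that does not contain m is still required; one lies
   below [P0]. *)
have [P' [inP' P'P nmP']] : exists P', [/\ List.In P' Ps, psubset P' P & ~ psubset m P'].
  have [mP|nmP] := pselect (psubset m P).
    have [P' h1 h2] := Ps2 P0 pP0 ysP0; exists P'; split=> //.
      by move=> x /h2 /(prime_sub_local noeth loc pP0); apply: mP.
    by move=> mP'; apply: nmP0 => x /mP'; apply: h2.
  have [P' h1 h2] := Ps2 P pP ysP; exists P'; split=> //.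
  by move=> mP'; apply: nmP => x /mP'; apply: h2.
have [pP' ysP'] := Ps1 P' inP'.
have [c [c1 c2 c3]] := H P' pP' ysP'.
exists (fun k => if (k <= i)%N then c k else P); split.
- move=> k ki; case: ifP => [kk|_]; first exact: c1.
  by split=> // x ax; apply: ysP; apply: igen_base.
- move=> k ki; rewrite -ltnS ki; case: (ltnP k i) => kk; first exact: c2.
  have -> : k = i by apply/eqP; rewrite eqn_leq kk -ltnS ki.
  rewrite c3; split=> // PP'; apply: (Hy P'); last exact: PP'.
  by apply/lP.
- by rewrite ltnn.
Qed.

End Height.

(** * Complexes and Koszul cones *)

Section Complexes.
Variable R : comNzRingType.

Section LinearMaps.
Variables (V W : lmodType R) (f : V -> W).
Hypothesis lf : is_linear f.
Lemma lin0 : f 0 = 0.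
Proof. by have := lf (-1) 0 0; rewrite scaler0 addr0 scaleN1r addNr. Qed.
Lemma linD x y : f (x + y) = f x + f y.
Proof. by have := lf 1 x y; rewrite !scale1r. Qed.
Lemma linZ r x : f (r *: x) = r *: f x.
Proof. by have := lf r x 0; rewrite !addr0 lin0 addr0. Qed.
Lemma linN x : f (- x) = - f x.
Proof. by rewrite -scaleN1r linZ scaleN1r. Qed.
Lemma linB x y : f (x - y) = f x - f y.
Proof. by rewrite linD linN. Qed.
End LinearMaps.

Record cplx := Cplx {
  cT : nat -> lmodType R;
  cd : forall n, cT n -> cT n.+1;
  cd_lin : forall n, is_linear (@cd n);
  cdd : forall n (x : cT n), cd (cd x) = 0 }.
Arguments cd {c n}.

(** The zero module stands below degree 0, so that boundaries in degree 0 vanish and the cone has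
    one formula in all degrees. *)
Definition shT (K : cplx) (n : nat) : lmodType R :=
  match n with 0%N => 'rV[R]_0 | n'.+1 => cT K n' end.

Definition sd (K : cplx) (n : nat) : shT K n -> cT K n :=
  match n with 0%N => fun _ => 0 | n'.+1 => fun x => cd x end.

Lemma sd_lin K n : is_linear (@sd K n).
Proof. by case: n => [|n] r x y; [rewrite scaler0 addr0|apply: cd_lin]. Qed.

Lemma cd_sd K n (x : shT K n) : cd (sd x) = 0.
Proof. by case: n x => [|n] x /=; [apply: lin0; apply: cd_lin|apply: cdd]. Qed.

(** A subfunctor of the identity, applied termwise, gives a subcomplex; with [full] it gives the
    complex itself. The cone lemmas thus serve X and Gamma(X) alike. *)
Definition subfunctor (G : forall V : lmodType R, V -> Prop) :=
  (forall V, submod (G V)) /\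
  (forall (V W : lmodType R) (f : V -> W), is_linear f -> forall x, G V x -> G W (f x)).

Definition full : forall V : lmodType R, V -> Prop := fun _ _ => True.
Lemma full_subfunctor : subfunctor full. Proof. by []. Qed.

Definition cyc (K : cplx) (G : forall V : lmodType R, V -> Prop) n (u : cT K n) :=
  G _ u /\ cd u = 0.
Definition bd (K : cplx) (G : forall V : lmodType R, V -> Prop) n (u : cT K n) :=
  exists2 v : shT K n, G _ v & sd v = u.
Definition van K G n := forall u, @cyc K G n u -> @bd K G n u.

Section Basic.
Variables (K : cplx) (G : forall V : lmodType R, V -> Prop).
Hypothesis sG : subfunctor G.

Lemma cyc_submod n : submod (@cyc K G n).
Proof.
case: sG => sub _; split.
  by split; [apply: submod0|apply: lin0; apply: cd_lin].
move=> r x y [Gx dx] [Gy dy]; split; first by case: (sub (cT K n)) => _; apply.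
by rewrite cd_lin dx dy scaler0 addr0.
Qed.

Lemma bd_submod n : submod (@bd K G n).
Proof.
case: sG => sub _; split.
  by exists 0; [apply: submod0|apply: lin0; apply: sd_lin].
move=> r x y [p Gp <-] [q Gq <-]; exists (r *: p + q); last exact: sd_lin.
by case: (sub (shT K n)) => _; apply.
Qed.

Lemma bd_cyc n u : @bd K G n u -> @cyc K G n u.
Proof.
move=> [v Gv <-]; split; last exact: cd_sd.
by case: sG => _; apply => //; apply: sd_lin.
Qed.

End Basic.

Lemma pairE (V W : lmodType R) (u : V) (v : W) r u' v' :
  r *: (u, v) + (u', v') = (r *: u + u', r *: v + v') :> (V * W)%type.
Proof. by []. Qed.

(** Naturality along projections and inclusions makes G additive, so applying G to a cone is the
    same as taking the cone after G. *)
Lemma subfunctor_pair G (V W : lmodType R) (u : V) (v : W) : subfunctor G ->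
  G (V * W)%type (u, v) <-> G V u /\ G W v.
Proof.
case=> sub nat; split=> [H|[Gu Gv]].
  split; first exact: (nat _ _ (fun p : V * W => p.1) _ _ H).
  exact: (nat _ _ (fun p : V * W => p.2) _ _ H).
have -> : (u, v) = (u, 0) + (0, v) :> (V * W)%type.
  by congr pair; rewrite ?addr0 ?add0r.
apply: (submodD (sub _)).
  apply: (nat _ _ (fun x : V => (x, 0) : V * W)) Gu => r x y.
  by rewrite pairE scaler0 addr0.
apply: (nat _ _ (fun x : W => (0, x) : V * W)) Gv => r x y.
by rewrite pairE scaler0 addr0.
Qed.

Section Cone.
Variables (x : R) (K : cplx).

Definition cone_T n : lmodType R := (cT K n * shT K n)%type.
Definition cone_d n (p : cone_T n) : cone_T n.+1 := (cd p.1, x *: p.1 - sd p.2).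

Lemma cone_d_lin n : is_linear (@cone_d n).
Proof.
move=> r [u v] [u' v']; rewrite /cone_d /= pairE; congr pair; first exact: cd_lin.
rewrite sd_lin scalerDr scalerBr !scalerA (mulrC x r) opprD.
by rewrite addrACA.
Qed.

Lemma cone_dd n (p : cone_T n) : cone_d (cone_d p) = 0.
Proof.
case: p => u v; rewrite /cone_d /= cdd; congr pair.
have cl := @cd_lin K n.
by rewrite (linB cl) (linZ cl) cd_sd subr0 subrr.
Qed.

(* The fibre of multiplication by x on K: its iterates are Koszul complexes. *)
Definition cone := Cplx cone_d_lin cone_dd.

Variable G : forall V : lmodType R, V -> Prop.
Hypothesis sG : subfunctor G.

Lemma cyc_cone n u v : @cyc cone G n (u, v) <->
  [/\ @G (cT K n) u, @G (shT K n) v, cd u = 0 & x *: u = sd v].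
Proof.
split=> [[/(subfunctor_pair _ _ sG)[Gu Gv] [du /subr0_eq xu]]|[Gu Gv du xu]]; first by split.
split; first exact/subfunctor_pair.
by rewrite /= /cone_d /= du xu subrr.
Qed.

Lemma bd_cone0 u v : @bd cone G 0 (u, v) <-> u = 0.
Proof.
case: (sG) => sub _; split=> [[w _ [<-]]//|->]; exists 0; first exact: (submod0 (sub _)).
by congr pair; apply/matrixP => i [].
Qed.

Lemma bd_coneS n u v : @bd cone G n.+1 (u, v) <->
  exists p q, [/\ @G (cT K n) p, @G (shT K n) q, u = cd p & v = x *: p - sd q].
Proof.
split=> [[[p q] /(subfunctor_pair _ _ sG)[Gp Gq] [<- <-]]|[p [q [Gp Gq -> ->]]]].
  by exists p, q.
by exists (p, q) => //; apply/subfunctor_pair.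
Qed.

Lemma cone_van c : (forall i, (c <= i)%N -> van K G i) ->
  forall i, (c < i)%N -> van cone G i.
Proof.
case: (sG) => sub _ H [//|i] ci [u v] /cyc_cone [Gu Gv du xu]; apply/bd_coneS.
have [|p Gp /= e] := H i.+1 (leqW ci) u; first by [].
have cl := @cd_lin K i.
have [|q Gq e'] := H i ci (x *: p - v).
  split; first by apply: (submodB (sub _)) => //; apply: (submodZ (sub _)).
  by rewrite (linB cl) (linZ cl) e xu subrr.
by exists p, q; split=> //; rewrite e' subKr.
Qed.

End Cone.

Definition kos (L : seq R) (K : cplx) : cplx := foldr cone K L.

(* Multiplication by r is locally nilpotent on the cohomology of G(K). *)
Definition tors_all (K : cplx) G r := forall n u, @cyc K G n u -> radical (fun r => @bd K G n (r *: u)) r.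

Lemma bd_ann_ideal K G n u : subfunctor G -> is_ideal (fun r => @bd K G n (r *: u)).
Proof.
move=> sG; have sb := bd_submod K sG n; split; first by rewrite scale0r; apply: submod0.
split=> [r s Hr Hs|r s Hs]; first by rewrite scalerDl; apply: submodD.
by rewrite -scalerA; apply: submodZ.
Qed.

Lemma tors_all_ideal K G : subfunctor G -> is_ideal (tors_all K G).
Proof.
move=> sG; split=> [n u cu|].
  by apply: ideal0; apply: radical_ideal; apply: bd_ann_ideal.
split=> [r s Hr Hs n u cu|r s Hs n u cu].
  by apply: idealD; [apply: radical_ideal; apply: bd_ann_ideal|apply: Hr|apply: Hs].
by apply: idealMl; [apply: radical_ideal; apply: bd_ann_ideal|apply: Hs].
Qed.

(** One power of r moves the class of (u, v) into the part coming from one degree lower in K, a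
    second power kills that part; exponents add. *)
Lemma tors_all_cone K G x r : subfunctor G -> tors_all K G r -> tors_all (cone x K) G r.
Proof.
move=> sG H n [u v] /(cyc_cone _ sG)[Gu Gv du xu].
have [sub _] := (sG); have [//|k Hk] := H n u.
case: n u v Gu Gv du xu Hk => [|n] u v Gu Gv du xu [w Gw e].
  by exists k; apply/(bd_cone0 _ sG).
have cl := @cd_lin K n; rewrite /= in e xu.
have [|l [q Gq eq]] := H n (r ^+ k *: v - x *: w).
  split; first by apply: (submodB (sub _)); apply: (submodZ (sub _)).
  by rewrite (linB cl) !(linZ cl) e -xu !scalerA mulrC subrr.
exists (k + l)%N; apply/(bd_coneS _ sG); exists (r ^+ l *: w), (- q); split.
- exact: (submodZ (sub _)).
- exact: (submodN (sub _)).
- by rewrite (linZ cl) e scalerA -exprD addnC.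
have sl := @sd_lin K n.
rewrite (linN sl) eq opprK scalerBr !scalerA -exprD addnC addrC.
by rewrite [r ^+ l * x]mulrC subrK.
Qed.

(** Multiplication by x is null-homotopic on its own cone: x (u, v) = d (v, 0) for a cycle (u,
    v). *)
Lemma tors_all_cone_self K G x : subfunctor G -> tors_all (cone x K) G x.
Proof.
move=> sG n [u v] /(cyc_cone _ sG)[Gu Gv du xu]; exists 1%N; rewrite expr1.
have [sub _] := (sG); case: n u v Gu Gv du xu => [|n] u v Gu Gv du xu.
  by apply/(bd_cone0 _ sG).
apply/(bd_coneS _ sG); exists v, 0; split=> //; first exact: (submod0 (sub _)).
by rewrite (lin0 (@sd_lin K n)) subr0.
Qed.

Lemma tors_all_kos K G L r : subfunctor G -> tors_all K G r -> tors_all (kos L K) G r.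
Proof. by move=> sG H; elim: L => //= x L IH; apply: tors_all_cone. Qed.

Lemma tors_all_kos_gen K G (b : R -> Prop) L : subfunctor G -> (forall r, b r -> tors_all K G r) ->
  forall r, igen b L r -> tors_all (kos L K) G r.
Proof.
move=> sG H; apply: igen_min; first exact: tors_all_ideal.
  by move=> r /H; apply: tors_all_kos.
elim: L => [//|x L IH] y; rewrite inE => /orP[/eqP->|yL]; first exact: tors_all_cone_self.
by apply: tors_all_cone => //; apply: IH.
Qed.

Lemma kos_van K G L c : subfunctor G -> (forall i, (c <= i)%N -> van K G i) ->
  forall i, (size L + c <= i)%N -> van (kos L K) G i.
Proof.
move=> sG H; elim: L => [//|x L IH] i /=; rewrite addSn => li.
exact: (cone_van sG IH).
Qed.

(** Follows the exact sequence of the cone. Cycles whose first component bounds form [Z']; the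
    quotient by [Z'] embeds into the cohomology of K in the same degree, and [Z'] modulo boundaries
    is governed by H/xH for H one degree lower. *)
Lemma cc_cone asc K G x n : subfunctor G ->
  (forall i, cc asc (@cyc K G i) (@bd K G i)) ->
  cc asc (@cyc (cone x K) G n) (@bd (cone x K) G n).
Proof.
move=> sG H; have [sub _] := (sG).
have sc := cyc_submod (cone x K) sG n; have sc1 := cyc_submod K sG n.
have sb1 := bd_submod K sG n; have bc1 u := @bd_cyc K G sG n u.
case: n sc sc1 sb1 bc1 => [|n] sc sc1 sb1 bc1.
  apply: (@cc_subquotient _ _ _ _ _ _ _ _ (fun (p : cone_T K 0) u => p.1 = u)) (H 0%N) => //.
  - by split=> [|r u w u2 w2 <- <-].
  - by move=> [u v] /(cyc_cone _ sG)[Gu _ du _]; exists u.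
  - by move=> [u v] w _ /= <- [w' _ <-]; apply/(bd_cone0 _ sG).
pose Z' (p : cone_T K n.+1) := @cyc (cone x K) G n.+1 p /\ @bd K G n.+1 p.1.
have sZ' : submod Z'.
  split; first by split; apply: submod0.
  by move=> r p q [cp bp] [cq bq]; split; [case: sc|case: sb1] => _; apply.
have cl := @cd_lin K n.
apply: (@cc_ext _ _ _ _ Z') => //.
- move=> [u v] /[dup] /(bd_cyc sG) cuv /(bd_coneS _ sG)[p [q [Gp Gq e _]]].
  by split=> //; exists p.
- by move=> p [].
(* The primitive t is determined only up to cycles, so v - x t is defined only up to x times a
   cycle: the relation is genuinely multivalued. *)
- apply: (@cc_subquotient _ _ _ _ _ _ _ _
    (fun (p : cone_T K n.+1) w => exists t, [/\ @G (cT K n) t, cd t = p.1 & w = p.2 - x *: t])) (H n) => //.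
  + split; first by exists 0; rewrite scaler0 subr0 (lin0 cl); split=> //; apply: (submod0 (sub _)).
    move=> r [u v] w [u' v'] w' [t [Gt /= et ->]] [t' [Gt' /= et' ->]].
    exists (r *: t + t'); split; first by case: (sub (cT K n)) => _; apply.
      by rewrite cl et et'.
    by rewrite /= scalerBr (scalerDr x) !scalerA (mulrC x r) opprD addrACA.
  + exact: cyc_submod.
  + exact: bd_submod.
  + by move=> u; apply: bd_cyc.
  + move=> [u v] [/(cyc_cone _ sG)[Gu Gv du xu] [t Gt /= et]].
    exists (v - x *: t); last by exists t.
    split; first by apply: (submodB (sub _)) => //; apply: (submodZ (sub _)).
    by rewrite (linB cl) (linZ cl) et xu subrr.
  + move=> [u v] w _ [t [Gt /= et ->]] [q Gq eq]; apply/(bd_coneS _ sG).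
    exists t, (- q); split=> //; first exact: (submodN (sub _)).
    by rewrite (linN (@sd_lin K n)) eq opprK addrC subrK.
apply: (@cc_subquotient _ _ _ _ _ _ _ _ (fun (p : cone_T K n.+1) u => p.1 = u)) (H n.+1) => //.
- by split=> [|r u w u2 w2 <- <-].
- by move=> [u v] /(cyc_cone _ sG)[Gu _ du _]; exists u.
- by move=> p w cp <- bp; split.
Qed.

Lemma cc_kos asc K G L : subfunctor G ->
  (forall i, cc asc (@cyc K G i) (@bd K G i)) ->
  forall i, cc asc (@cyc (kos L K) G i) (@bd (kos L K) G i).
Proof. by move=> sG H; elim: L => //= x L IH i; apply: cc_cone. Qed.

End Complexes.

(** * Torsion subfunctors on complexes of injectives *)

Section Torsion.
Variable R : comNzRingType.

Definition mult (S : R -> Prop) := S 1 /\ forall x y, S x -> S y -> S (x * y).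

Definition tors (S : R -> Prop) (V : lmodType R) (u : V) := exists2 s, S s & s *: u = 0.

Lemma tors_subfunctor S : mult S -> subfunctor (@tors S).
Proof.
move=> [S1 SM]; split=> [V|V W f lf x [s Ss e]]; last first.
  by exists s; rewrite // -(linZ lf) e (lin0 lf).
split; first by exists 1; rewrite ?scaler0.
move=> r x y [s Ss ex] [t St ey]; exists (s * t); first exact: SM.
rewrite scalerDr scalerA (_ : s * t * r = t * r * s); last by ring.
by rewrite -scalerA ex scaler0 add0r -scalerA ey scaler0.
Qed.

Lemma mult_exp S s n : mult S -> S s -> S (s ^+ n).
Proof.
by move=> [S1 SM] Ss; elim: n => [|n IH]; rewrite ?expr0 // exprS; apply: SM.
Qed.

Definition meetf (G H : forall V : lmodType R, V -> Prop) : forall V : lmodType R, V -> Prop :=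
  fun V u => G V u /\ H V u.

Lemma meetf_subfunctor G H : subfunctor G -> subfunctor H -> subfunctor (meetf G H).
Proof.
move=> [sG nG] [sH nH]; split=> [V|V W f lf x [Gx Hx]]; last first.
  by split; [apply: (nG V W f)|apply: (nH V W f)].
split; first by split; apply: submod0.
by move=> r x y [Gx Hx] [Gy Hy]; split; [case: (sG V)|case: (sH V)] => _; apply.
Qed.

(** Baer's criterion relative to G: maps from an ideal into G V are multiplications by an element of
    G V. The map [f] is total only for convenience; it is constrained on [a] alone. *)
Definition baer (G : forall V : lmodType R, V -> Prop) (V : lmodType R) :=
  forall (a : R -> Prop) (f : R -> V), is_ideal a -> (forall x, a x -> G V (f x)) ->
  (forall r x y, a x -> a y -> f (r * x + y) = r *: f x + f y) ->
  exists2 e, G V e & forall x, a x -> f x = x *: e.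

Lemma ideal_full_eval (V : lmodType R) (a : R -> Prop) (f : R -> V) : is_ideal a ->
  (forall r x y, a x -> a y -> f (r * x + y) = r *: f x + f y) ->
  [/\ f 0 = 0, forall r x, a x -> f (r * x) = r *: f x &
     forall x y, a x -> a y -> f (x - y) = f x - f y].
Proof.
move=> ia lf; have a0 := ideal0 ia.
have f0 : f 0 = 0.
  by have := lf (-1) 0 0 a0 a0; rewrite mulr0 addr0 scaleN1r addNr.
split=> // [r x ax|x y ax ay].
  by have := lf r x 0 ax a0; rewrite !addr0 f0 addr0.
by have := lf (-1) y x ay ax; rewrite mulN1r scaleN1r addrC => ->; rewrite addrC.
Qed.

Hypothesis noeth : noetherian_ring R.

Lemma colon_power_stable (a : R -> Prop) s : is_ideal a ->
  exists n, forall r, a (r * s ^+ n.+1) -> a (r * s ^+ n).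
Proof.
move=> ia; have [n|n r|N HN] := noeth (c := fun n r => a (r * s ^+ n)).
- split; first by rewrite mul0r; apply: ideal0.
  split=> [x y Hx Hy|r x Hx]; first by rewrite mulrDl; apply: idealD.
  by rewrite -mulrA; apply: idealMl.
- by move=> H; rewrite exprSr mulrA; apply: idealMr.
by exists N => r; apply: (HN N.+1).
Qed.

(** As [a] is finitely generated, one s in S kills its image under f. With n stabilizing the colons
    a : s^n and t = s^(n+1), f vanishes on the intersection of a and (t): if r t is in a then so is
    r s^n, and f (r t) = s f (r s^n) = 0. So f extends by zero on (t) to a + (t), and the resulting
    element is killed by t. *)
Lemma baer_tors G S V : subfunctor G -> mult S -> baer G V -> baer (meetf G (@tors S)) V.
Proof.
move=> [sub _] mS bV a f ia fG lf; have [S1 SM] := mS.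
have [f0 fZ fB] := ideal_full_eval ia lf.
have [gs gsP] := noeth_fg noeth ia.
have [s Ss Hs] : exists2 s, S s & forall x, a x -> s *: f x = 0.
  have [s Ss Hs] : exists2 s, S s & forall g, g \in gs -> s *: f g = 0.
    have : forall g, g \in gs -> a g.
      by move=> g ggs; apply/gsP; apply: igen_gen => //; exact: Rzero_ideal.
    elim: gs {gsP} => [|g gs IH] Hgs; first by exists 1.
    have [|s Ss Hs] := IH; first by move=> h hgs; apply: Hgs; rewrite inE hgs orbT.
    have [_ [t St et]] := fG g (Hgs g (mem_head _ _)).
    exists (s * t); first exact: SM.
    move=> h; rewrite inE => /orP[/eqP->|hgs]; first by rewrite -scalerA et scaler0.
    by rewrite mulrC -scalerA Hs // scaler0.
  exists s => // x /gsP.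
  suff H : forall x, igen (@Rzero R) gs x -> a x /\ s *: f x = 0 by case/H.
  move=> {x}; apply: igen_min => [|x ->|y ys].
  - split; first by rewrite f0 scaler0; split=> //; apply: ideal0.
    split=> [x y [ax ex] [ay ey]|r x [ax ex]]; split.
    + exact: idealD.
    + by have := lf 1 x y ax ay; rewrite mul1r scale1r => ->; rewrite scalerDr ex ey addr0.
    + exact: idealMl.
    + by rewrite fZ // scalerA mulrC -scalerA ex scaler0.
  - by rewrite f0 scaler0; split=> //; apply: ideal0.
  - split; last exact: Hs.
    by apply/gsP; apply: igen_gen => //; exact: Rzero_ideal.
have [n Hn] := colon_power_stable s ia.
set t := s ^+ n.+1.
have van r : a (r * t) -> f (r * t) = 0.
  move=> art; have arn := Hn _ art.
  have -> : r * t = s * (r * s ^+ n) by rewrite /t exprS; ring.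
  by rewrite fZ // Hs.
have it := igen_ideal [:: t] ia.
have /choice[g gP] : forall w, exists x, igen a [:: t] w -> a x /\ exists r, w = x + r * t.
  move=> w; have [/igen1P-/(_ ia)[r Hr]|nH] := pselect (igen a [:: t] w); last by exists 0.
  by exists (w - r * t) => _; split=> //; exists r; rewrite subrK.
have key w x r : a x -> w = x + r * t -> f (g w) = f x.
  move=> ax e; have [|ag [q eq]] := gP w.
    by apply/igen1P => //; exists r; rewrite e addrK.
  apply/eqP; rewrite -subr_eq0 -fB //; apply/eqP.
  have e' : g w - x = (r - q) * t.
    have -> : g w = w - q * t by rewrite {2}eq addrK.
    by rewrite e; ring.
  by rewrite e'; apply: van; rewrite -e'; apply: idealB.
have [w Hw|r x y Hx Hy|e Ge He] := bV (igen a [:: t]) (fun w => f (g w)) it.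
- by have [ag _] := gP w Hw; case: (fG _ ag).
- have [agx [p ep]] := gP x Hx; have [agy [q eq]] := gP y Hy.
  rewrite (key _ (r * g x + g y) (r * p + q)) ?lf //; first by apply: idealD => //; apply: idealMl.
  by rewrite {1}ep {1}eq; ring.
exists e; last first.
  move=> x ax; rewrite -He; last exact: igen_base.
  by rewrite (key x x 0) // mul0r addr0.
split=> //; exists t; first exact: mult_exp.
rewrite -He; last by apply: igen_gen; rewrite ?inE.
by rewrite (key t 0 1) ?f0 //; [apply: ideal0|rewrite add0r mul1r].
Qed.

(** For n stabilizing the annihilators of s^n, sending r s^(n+1) to r s^n w is well defined;
    extending this map gives s^(n+1) w' = s^n w. *)
Lemma baer_divisible G V s w : baer G V -> G V w -> submod (G V) ->
  exists2 w', G V w' & exists n, s ^+ n *: (w - s *: w') = 0.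
Proof.
move=> bV Gw sG; have iz := Rzero_ideal R.
have [n Hn] := colon_power_stable s iz.
set t := s ^+ n.+1.
have it := igen_ideal [:: t] iz.
have /choice[g gP] : forall x, exists r, igen (@Rzero R) [:: t] x -> x = r * t.
  move=> x; have [/igen1P-/(_ iz)[r /subr0_eq Hr]|nH] := pselect (igen (@Rzero R) [:: t] x).
    by exists r.
  by exists 0.
have key x r : x = r * t -> g x *: (s ^+ n *: w) = r *: (s ^+ n *: w).
  move=> e; apply/eqP; rewrite -subr_eq0 -scalerBl scalerA.
  have e' : x = g x * t by apply: gP; apply/igen1P => //; exists r; rewrite e subrr.
  have e0 : Rzero ((g x - r) * s ^+ n) by apply: Hn; rewrite /Rzero mulrBl -/t -e' e subrr.
  by rewrite e0 scale0r.
have [x _|r x y Hx Hy|w' Gw' He] := bV (igen (@Rzero R) [:: t]) (fun x => g x *: (s ^+ n *: w)) it.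
- by apply: (submodZ sG); apply: (submodZ sG).
- rewrite (key _ (r * g x + g y)) ?scalerDl ?scalerA ?mulrA //.
  by rewrite {1}(gP x Hx) {1}(gP y Hy); ring.
exists w' => //; exists n; rewrite scalerBr scalerA -exprSr -/t.
rewrite -He; last by apply: igen_gen; rewrite ?inE.
by rewrite (key t 1) ?mul1r // scale1r subrr.
Qed.

(** * Cohomology of the S-torsion subcomplex *)

Section TorsionSubcomplex.
Variables (K : cplx R) (G : forall V : lmodType R, V -> Prop) (S : R -> Prop).
Hypotheses (sG : subfunctor G) (mS : mult S).
Hypothesis bK : forall n, baer G (cT K n).
Let GS := meetf G (@tors S).
Let sGS : subfunctor GS := meetf_subfunctor sG (tors_subfunctor mS).

(* Divisibility of the terms makes the cohomology of G(K)/GS(K) the localization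
   of the cohomology of G(K) at S; this is the elementwise form of that fact. *)
Lemma tors_split n (u : cT K n) s : @G (cT K n) u -> S s -> bd G (s *: u) ->
  exists u' b, [/\ u = u' + b, GS u' & bd G b].
Proof.
have [sub _] := sG; have [S1 SM] := mS.
move=> Gu Ss; case: n u Gu => [|n] u Gu [v Gv e].
  exists u, 0; rewrite addr0; split=> //; last by apply: (submod0 (bd_submod _ _ _)).
  by split=> //; exists s.
(* Dividing v by s up to torsion: s (u - d w) = d (v - s w) is killed by s^k, so u - d w is the
   torsion part and d w the boundary. *)
have [w Gw [k Hk]] := baer_divisible s (@bK n) Gv (sub (cT K n)).
have cl := @cd_lin _ K n.
exists (u - cd w), (cd w); rewrite subrK; split=> //; last by exists w.
split.
  apply: (submodB (sub _)) => //; have [_ nat] := sG; exact: (nat _ _ _ cl).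
exists (s ^+ k * s); first by apply: SM => //; apply: mult_exp.
rewrite -scalerA scalerBr -e -(linZ cl) -(linB cl) -(linZ cl).
by rewrite /= Hk (lin0 cl).
Qed.

Definition tors_at n := forall u : cT K n, cyc G u -> exists2 s, S s & bd G (s *: u).

(** A multiple s v of a primitive v is a cycle; if cohomology there is torsion, a further multiple
    bounds, and [tors_split] replaces v by its torsion part without changing its differential. *)
Lemma bd_tors n (u : cT K n) : (forall n', n = n'.+1 -> tors_at n') ->
  bd G u -> tors S u -> bd GS u.
Proof.
have [sub _] := sG; have [S1 SM] := mS.
case: n u => [|n] u H [v Gv e] [s Ss es].
  by exists 0; rewrite -?e //; apply: (submod0 (sGS.1 _)).
have cl := @cd_lin _ K n; rewrite /= in e.
have [|t St Ht] := H n erefl (s *: v).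
  by split; [apply: (submodZ (sub _))|rewrite (linZ cl) e].
rewrite scalerA in Ht.
have [v' [b [ev GSv' [q Gq eq]]]] := tors_split Gv (SM _ _ St Ss) Ht.
by exists v' => //=; rewrite -e ev (linD cl) -eq cd_sd addr0.
Qed.

Lemma van_tors n : (forall k, tors_at k) -> van K G n -> van K GS n.
Proof.
by move=> H vn u [[Gu tu] du]; apply: bd_tors => //; apply: vn.
Qed.

(** Vanishing in degree n supplies the torsion condition for free; one degree is the price when the
    cohomology is not known to be S-torsion. *)
Lemma van_torsS n : van K G n -> van K G n.+1 -> van K GS n.+1.
Proof.
move=> vn vn1 u [[Gu tu] du]; apply: bd_tors => //; last exact: vn1.
by move=> _ [<-] w cw; exists 1; [case: mS|rewrite scale1r; apply: vn].
Qed.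

Lemma tors_all_tors r : (forall k, tors_at k) -> tors_all K G r -> tors_all K GS r.
Proof.
move=> H tr n u [[Gu tu] du]; have [//|k Hk] := tr n u.
by exists k; apply: bd_tors => //; apply: (submodZ ((tors_subfunctor mS).1 _)).
Qed.

Lemma cyc_tors n (u : cT K n) : (forall k, tors_at k) -> cyc G u ->
  exists2 u' : cT K n, cyc GS u' & bd G (u - u').
Proof.
move=> H cu; have [s Ss Hs] := H n u cu; have [Gu du] := cu.
have [u' [b [e GSu' bb]]] := tors_split Gu Ss Hs.
exists u'; last by rewrite e addrC addKr.
split=> //; have [_ db] := bd_cyc sG bb.
by have := du; rewrite e (linD (@cd_lin _ K n)) db addr0.
Qed.

End TorsionSubcomplex.

(** * Gamma_{I,J} as a finite intersection of torsion functors *)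

Section Pair.
Variables (J m : R -> Prop).
Hypotheses (iJ : is_ideal J) (im : is_ideal m).

Definition Smul (y : R) : R -> Prop := fun s => exists n j, J j /\ s = y ^+ n - j.

Lemma Smul_mult y : mult (Smul y).
Proof.
split; first by exists 0%N, 0; rewrite subr0; split=> //; apply: ideal0.
move=> _ _ [n [j [Jj ->]]] [k [i [Ji ->]]].
exists (n + k)%N, (y ^+ n * i + j * y ^+ k - j * i); split; last by rewrite exprD; ring.
by apply: idealB; [|apply: idealD|] => //; [apply: idealMl|apply: idealMr|apply: idealMl].
Qed.

Definition gam : forall V : lmodType R, V -> Prop :=
  fun V u => forall y, m y -> tors (Smul y) u.

Fixpoint torl (zs : seq R) : forall V : lmodType R, V -> Prop :=
  match zs with
  | [::] => @full R
  | z :: zs' => meetf (torl zs') (@tors (Smul z))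
  end.

Lemma torl_subfunctor zs : subfunctor (torl zs).
Proof.
elim: zs => [|z zs IH]; first exact: full_subfunctor.
by apply: meetf_subfunctor => //; apply: tors_subfunctor; apply: Smul_mult.
Qed.

Lemma torl_baer zs V : baer (@full R) V -> baer (torl zs) V.
Proof.
move=> bV; elim: zs => [//|z zs IH].
by apply: baer_tors => //; [apply: torl_subfunctor|apply: Smul_mult].
Qed.

Lemma torl_mem zs (V : lmodType R) (u : V) : torl zs u <-> forall z, z \in zs -> tors (Smul z) u.
Proof.
elim: zs => [|z zs IH] /=; first by split.
split=> [[/IH H t] y|H]; first by rewrite inE => /orP[/eqP->|/H].
by split; [apply/IH => y yz; apply: H; rewrite inE yz orbT|apply: H; rewrite mem_head].
Qed.

Lemma tors_SmulP y (V : lmodType R) (u : V) : tors (Smul y) u <-> exists n j, J j /\ y ^+ n *: u = j *: u.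
Proof.
split=> [[_ [n [j [Jj ->]]] e]|[n [j [Jj e]]]].
  by exists n, j; split=> //; apply/eqP; rewrite -subr_eq0 -scalerBl e.
by exists (y ^+ n - j); [exists n, j|rewrite scalerBl e subrr].
Qed.

(* {r | r u in J u} is an ideal containing J; u is Smul y-torsion iff y lies in
   its radical. *)
Definition Jann (V : lmodType R) (u : V) : R -> Prop := fun r => exists2 j, J j & r *: u = j *: u.

Lemma Jann_ideal (V : lmodType R) (u : V) : is_ideal (Jann u).
Proof.
split; first by exists 0 => //; apply: ideal0.
split=> [r s [j Jj e] [k Jk e']|r s [j Jj e]].
  by exists (j + k); [apply: idealD|rewrite !scalerDl e e'].
by exists (r * j); [apply: idealMl|rewrite -!scalerA e].
Qed.

Lemma Jann_base (V : lmodType R) (u : V) r : J r -> Jann u r.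
Proof. by exists r. Qed.

Lemma tors_Jann y (V : lmodType R) (u : V) : tors (Smul y) u <-> radical (Jann u) y.
Proof.
split=> [/tors_SmulP[n [j [Jj e]]]|[n [j Jj e]]]; first by exists n; exists j.
by apply/tors_SmulP; exists n, j.
Qed.

(** The radical of [Jann u] is an ideal containing J, so conditions on [zs] spread to m. The freedom
    to choose [zs] matters: the same functor is written once with parameters, once with elements
    nilpotent on the cohomology at hand. *)
Lemma gam_torl zs : (forall z, z \in zs -> m z) -> psubset m (radical (igen J zs)) ->
  gam = torl zs.
Proof.
move=> zm mz; apply: functional_extensionality_dep => V.
apply: functional_extensionality_dep => u; apply: propositional_extensionality; split.
  by move=> H; apply/torl_mem => z zzs; apply: H; apply: zm.
move=> /torl_mem H y my; apply/tors_Jann; apply: radical_radical.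
apply: radical_mono (mz y my); apply: igen_min.
- by apply: radical_ideal; apply: Jann_ideal.
- by move=> x Jx; apply: radical_base; apply: Jann_base.
- by move=> z zzs; apply/tors_Jann; apply: H.
Qed.

Lemma tors_all_torl (K : cplx R) zs : (forall n, baer (@full R) (cT K n)) ->
  (forall z, z \in zs -> tors_all K (@full R) z) ->
  forall r, tors_all K (@full R) r -> tors_all K (torl zs) r.
Proof.
move=> bK; elim: zs => [//|z zs IH] H r Hr.
apply: tors_all_tors => [| |n|k u cu|].
- exact: torl_subfunctor.
- exact: Smul_mult.
- exact: torl_baer.
- have [||l Hl] := IH _ z _ _ _ cu.
  + by move=> y ys; apply: H; rewrite inE ys orbT.
  + by apply: H; rewrite mem_head.
  by exists (z ^+ l) => //; exists l, 0; rewrite subr0; split=> //; apply: ideal0.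
- by apply: IH => // y ys; apply: H; rewrite inE ys orbT.
Qed.

Lemma torl_tors_at (K : cplx R) z zs : (forall n, baer (@full R) (cT K n)) ->
  (forall y, y \in zs -> tors_all K (@full R) y) -> tors_all K (@full R) z ->
  forall k, tors_at K (torl zs) (Smul z) k.
Proof.
move=> bK H Hz k u cu; have [l Hl] := tors_all_torl bK H Hz cu.
by exists (z ^+ l) => //; exists l, 0; rewrite subr0; split=> //; apply: ideal0.
Qed.

(** Elements of [zs] act nilpotently, and their powers belong to [Smul] with j = 0, so the
    cohomology is already torsion and no degree is lost; each element of [ys] costs one degree. *)
Lemma van_torl (K : cplx R) zs ys c : (forall n, baer (@full R) (cT K n)) ->
  (forall z, z \in zs -> tors_all K (@full R) z) ->
  (forall i, (c <= i)%N -> van K (@full R) i) ->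
  forall i, (size ys + c <= i)%N -> van K (torl (ys ++ zs)) i.
Proof.
move=> bK tz vK; elim: ys => [|y ys IH] i /=.
  rewrite add0n => ci; elim: zs tz => [|z zs IHz] tz; first exact: vK.
  have tz' y : y \in zs -> tors_all K (@full R) y by move=> ys; apply: tz; rewrite inE ys orbT.
  apply: van_tors; [exact: torl_subfunctor|exact: Smul_mult|by move=> n; apply: torl_baer| |].
    by apply: torl_tors_at => //; apply: tz; rewrite mem_head.
  exact: IHz.
case: i => [//|i]; rewrite addSn ltnS => ci.
apply: van_torsS; [exact: torl_subfunctor|exact: Smul_mult|by move=> n; apply: torl_baer| |].
  exact: IH.
by apply: IH; apply: leqW.
Qed.

Lemma cyc_torl (K : cplx R) zs n (u : cT K n) : (forall n, baer (@full R) (cT K n)) ->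
  (forall z, z \in zs -> tors_all K (@full R) z) -> cyc (@full R) u ->
  exists2 u' : cT K n, cyc (torl zs) u' & bd (@full R) (u - u').
Proof.
move=> bK + cu; elim: zs => [|z zs IH] tz.
  exists u => //; rewrite subrr; apply: submod0; apply: bd_submod; exact: full_subfunctor.
have tz' y : y \in zs -> tors_all K (@full R) y by move=> ys; apply: tz; rewrite inE ys orbT.
have [u' cu' bu'] := IH tz'.
have [||m0|k|u2 cu2 bu2] := @cyc_tors K (torl zs) (Smul z) _ _ _ n u' _ cu'.
- exact: torl_subfunctor.
- exact: Smul_mult.
- exact: torl_baer.
- by apply: torl_tors_at => //; apply: tz; rewrite mem_head.
exists u2 => //; have -> : u - u2 = (u - u') + (u' - u2) by rewrite addrA subrK.
apply: submodD => //; first by apply: bd_submod; exact: full_subfunctor.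
by case: bu2 => v _ <-; exists v.
Qed.

Lemma bd_torl (K : cplx R) zs n (u : cT K n) : (forall n, baer (@full R) (cT K n)) ->
  (forall z, z \in zs -> tors_all K (@full R) z) ->
  bd (@full R) u -> torl zs u -> bd (torl zs) u.
Proof.
move=> bK; elim: zs => [//|z zs IH] tz bu [tu tzu].
have tz' y : y \in zs -> tors_all K (@full R) y by move=> ys; apply: tz; rewrite inE ys orbT.
apply: bd_tors => //; [exact: torl_subfunctor|exact: Smul_mult|by move=> k; apply: torl_baer| |].
  by move=> k _; apply: torl_tors_at => //; apply: tz; rewrite mem_head.
exact: IH.
Qed.

Lemma baer_full_pair V W : baer (@full R) V -> baer (@full R) W -> baer (@full R) (V * W)%type.
Proof.
move=> bV bW a f ia _ lf.
have [//|r x y ax ay|e _ He] := bV a (fun x => (f x).1) ia; first by rewrite lf.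
have [//|r x y ax ay|e' _ He'] := bW a (fun x => (f x).2) ia; first by rewrite lf.
by exists (e, e') => // x ax; rewrite [f x]surjective_pairing He // He'.
Qed.

Lemma baer_kos (K : cplx R) L : (forall n, baer (@full R) (cT K n)) ->
  forall n, baer (@full R) (cT (kos L K) n).
Proof.
move=> bK; elim: L => [//|x L IH] n /=; apply: baer_full_pair => //.
case: n => [|n] //= a f ia _ _; exists 0 => // y _; apply/matrixP => i [].
by [].
Qed.

Lemma gam_subfunctor : subfunctor gam.
Proof.
split=> [V|V W f lf x gx y my].
  split; first by move=> y _; apply: (submod0 ((tors_subfunctor (Smul_mult y)).1 V)).
  move=> r u v gu gv y my; have [_] := (tors_subfunctor (Smul_mult y)).1 V.
  by apply; [apply: gu|apply: gv].
by apply: (tors_subfunctor (Smul_mult y)).2 => //; apply: gx.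
Qed.

(** Both sides are statements about the ideal [Jann u], which contains J: it contains a power of I
    iff its radical contains I, hence iff its radical contains m, the radical of I + J. *)
Lemma gammaIJ_gam (I : R -> Prop) : is_ideal I -> is_primary_to (ideal_add I J) m ->
  forall (V : lmodType R) (u : V), gammaIJ I J u <-> gam u.
Proof.
move=> iI [_ [_ [_ rad]]] V u; split.
  move=> [k [k0 H]] y /rad[n [a [b [Ia [Jb e]]]]]; apply/tors_Jann; exists (n * k)%N.
  rewrite exprM e.
  have iA := Jann_ideal u.
  have Aa : Jann u (a ^+ k).
    by have [|j [Jj ej]] := H (a ^+ k); [apply: ideal_pow_mem|exists j].
  have -> : (a + b) ^+ k = a ^+ k + ((a + b) ^+ k - a ^+ k) by rewrite [RHS]addrC subrK.
  apply: idealD => //; apply: Jann_base; rewrite subrXX addrAC subrr add0r.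
  by apply: idealMr.
move=> gu; have [gs gsP] := noeth_fg noeth iI.
have [|||k Hk] := @ideal_pow_sub_of_radical _ I (Jann u) gs.
- exact: Jann_ideal.
- move=> g ggs; apply/tors_Jann; apply: gu; apply/rad; exists 1%N; rewrite expr1.
  exists g, 0; rewrite addr0; do !split; [|exact: ideal0].
  by apply/gsP; apply: igen_gen => //; exact: Rzero_ideal.
- move=> x /gsP; apply: igen_sub; first exact: Jann_ideal.
    by move=> z ->; apply: ideal0; apply: igen_ideal; apply: Jann_ideal.
  by move=> y ys; apply: igen_gen => //; apply: Jann_ideal.
(* The successor meets the requirement of a positive exponent. *)
exists k.+1; split=> // a Ha; have [|j Jj e] := Hk a; last by exists j.
exact: ideal_pow_decr Ha.
Qed.

End Pair.

End Torsion.

(** * Melkersson's criterion and attached primes *)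

Section Artinian.
Variable R : comNzRingType.

Section OneModule.
Variables (V : lmodType R) (Z B : V -> Prop).
Hypotheses (sZ : submod Z) (sB : submod B) (BZ : psubset B Z).

(* Melkersson's criterion. For a descending chain P the submodules W k n of the
   socle {u | x u in B} decrease in both indices, so their diagonal determines
   when P stabilizes. *)
Lemma melkersson x : (forall u, Z u -> exists k, B (x ^+ k *: u)) ->
  cc false (fun u => Z u /\ B (x *: u)) B -> cc false Z B.
Proof.
move=> tx c0 P sP BP PZ Pd.
(* [W k n] is x^k times the part of P n that x^(k+1) sends into B, plus B. *)
pose W k n (w : V) := exists u, [/\ P n u, B (x ^+ k.+1 *: u) & B (w - x ^+ k *: u)].
have sW k n : submod (W k n).
  split; first by exists 0; rewrite !scaler0 subr0; split; apply: submod0.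
  move=> r w w' [u [Pu Bu Bw]] [u' [Pu' Bu' Bw']]; exists (r *: u + u'); split.
  - by case: (sP n) => _; apply.
  - by rewrite scalerDr scalerA mulrC -scalerA; case: sB => _; apply.
  - rewrite scalerDr scalerA mulrC -scalerA opprD addrACA -scalerBr.
    by case: sB => _; apply.
have WB k n : psubset B (W k n).
  by move=> w Bw; exists 0; rewrite !scaler0 subr0; split=> //; apply: submod0.
have WZ k n : psubset (W k n) (fun u => Z u /\ B (x *: u)).
  move=> w [u [Pu Bu Bw]]; split.
    apply: (submod_subl sZ (y := x ^+ k *: u)); first exact: BZ.
    by apply: submodZ => //; apply: PZ Pu.
  apply: (submod_subl sB (y := x *: (x ^+ k *: u))).
    by rewrite -scalerBr; apply: submodZ.
  by rewrite scalerA -exprS.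
have Pdec a b : (a <= b)%N -> psubset (P b) (P a).
  by move=> ab; apply: (@up_to_mono false _ P).
have Wn k a b : (a <= b)%N -> psubset (W k b) (W k a).
  by move=> ab w [u [Pu Bu Bw]]; exists u; split=> //; apply: Pdec Pu.
have Wk1 k n : psubset (W k.+1 n) (W k n).
  move=> w [u [Pu Bu Bw]]; exists (x *: u); split; first exact: submodZ.
    by rewrite scalerA -exprSr.
  by rewrite scalerA -exprSr.
have Wk a b n : (a <= b)%N -> psubset (W b n) (W a n).
  by apply: (@up_to_mono false _ (fun k => W k n)) => k; apply: Wk1.
have [n|n|n|n|N HN] := c0 (fun n => W n n); [exact: sW|exact: WB|exact: WZ| |].
  by move=> w Hw; apply: (Wk1 n n w); apply: (Wn _ n n.+1).
have /choice[M HM] : forall k, exists M, forall n, (M <= n)%N -> psubset (W k M) (W k n).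
  move=> k; have [n|n|n|n|M HM] := c0 (W k); [exact: sW|exact: WB|exact: WZ| |].
    by apply: (Wn k n n.+1).
  by exists M.
(* Rows k >= N are controlled by the diagonal from N on; each of the finitely many rows k < N
   stabilizes at its own [M k]. T bounds all these indices. *)
pose T := (N + \sum_(k < N) M k)%N.
have WT k n : (T <= n)%N -> psubset (W k T) (W k n).
  move=> Tn w Hw; have [Nk|kN] := leqP N k.
    have Hn : W N N w by apply: (Wk _ _ _ Nk); apply: Wn Hw; apply: leq_addr.
    have : W (maxn k n) (maxn k n) w.
      by apply: (HN (maxn k n)) => //; apply: leq_trans Nk (leq_maxl _ _).
    by move=> H; apply: (Wk _ _ _ (leq_maxl k n)); apply: Wn H; apply: leq_maxr.
  have MT : (M k <= T)%N.
    by rewrite /T (bigD1 (Ordinal kN)) //= addnCA leq_addr.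
  by apply: (HM k); [apply: leq_trans MT Tn|apply: Wn Hw].
exists T => n Tn u Pu; have [k] := tx u (PZ _ _ Pu).
elim: k u Pu => [|k IH] u Pu Bu; first by rewrite expr0 scale1r in Bu; apply: BP.
have /(WT k n Tn)[u' [Pu' Bu' Bw]] : W k T (x ^+ k *: u).
  by exists u; rewrite subrr; split=> //; apply: submod0.
apply: (submod_subl (sP n) (y := u')) => //; apply: IH; last by rewrite scalerBr.
by apply: submodB => //; apply: (Pdec T n).
Qed.

Lemma dcc_ind (Phi : (V -> Prop) -> Prop) : cc false Z B ->
  (forall K, submod K -> psubset B K -> psubset K Z ->
     (forall K', submod K' -> psubset B K' -> psubset K' K -> ~ psubset K K' -> Phi K') -> Phi K) ->
  Phi Z.
Proof.
move=> c step; apply: contrapT => nZ.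
pose T := {K : V -> Prop | [/\ submod K, psubset B K, psubset K Z & ~ Phi K]}.
pose Q (t t' : T) := psubset (sval t') (sval t) /\ ~ psubset (sval t) (sval t').
have p0 : [/\ submod Z, psubset B Z, psubset Z Z & ~ Phi Z] by split.
have [|f [_ fP]] := @dependent_choice T Q (exist _ Z p0).
  move=> [K pK]; have [sK BK KZ nK] := pK; apply: contrapT => H; apply: (nK).
  apply: step => // K' sK' BK' K'K nKK'; apply: contrapT => nK'; apply: H.
  have pK' : [/\ submod K', psubset B K', psubset K' Z & ~ Phi K'].
    by split=> // u /K'K /KZ.
  by exists (exist _ K' pK').
have [n|n|n|n|N HN] := c (fun n => sval (f n)).
- by case: (svalP (f n)).
- by case: (svalP (f n)).
- by case: (svalP (f n)).
- by case: (fP n).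
by case: (fP N) => _; apply; apply: HN.
Qed.

(* Secondary representation of an artinian Z/B: the list collects the attached
   primes that do not contain m. *)
Lemma attached_primes (m : R -> Prop) : cc false Z B ->
  exists Ps : seq (R -> Prop),
    (forall P, List.In P Ps -> is_prime_ideal P /\ ~ psubset m P) /\
    forall x, (forall P, List.In P Ps -> ~ P x) -> forall y, m y ->
      exists e, forall u, Z u -> exists2 w, Z w & B (y ^+ e *: u - x *: w).
Proof.
move=> cZ; apply: (@dcc_ind (fun Z => exists Ps : seq (R -> Prop),
    (forall P, List.In P Ps -> is_prime_ideal P /\ ~ psubset m P) /\
    forall x, (forall P, List.In P Ps -> ~ P x) -> forall y, m y ->
      exists e, forall u, Z u -> exists2 w, Z w & B (y ^+ e *: u - x *: w)) cZ).
move=> K sK BK KZ IH.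
have [[K1 [K2 [[s1 B1 K1K n1] [s2 B2 K2K n2] H]]]|irr] := pselect (exists K1 K2 : V -> Prop,
   [/\ [/\ submod K1, psubset B K1, psubset K1 K & ~ psubset K K1],
       [/\ submod K2, psubset B K2, psubset K2 K & ~ psubset K K2] &
       forall u, K u -> exists2 u1, K1 u1 & K2 (u - u1)]).
  have [Ps [Ps1 Ps2]] := IH K1 s1 B1 K1K n1.
  have [Qs [Qs1 Qs2]] := IH K2 s2 B2 K2K n2.
  exists (Ps ++ Qs); split; first by move=> P /List.in_app_iff[/Ps1|/Qs1].
  move=> x Hx y my.
  have [|e1 He1] := Ps2 x _ y my.
    by move=> P HP; apply: Hx; apply/List.in_app_iff; left.
  have [|e2 He2] := Qs2 x _ y my.
    by move=> P HP; apply: Hx; apply/List.in_app_iff; right.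
  exists (e1 + e2)%N => u /H[u1 Ku1 Ku2].
  have [w1 Kw1 Bw1] := He1 _ Ku1; have [w2 Kw2 Bw2] := He2 _ Ku2.
  exists (y ^+ e2 *: w1 + y ^+ e1 *: w2).
    by apply: submodD => //; apply: submodZ => //; [apply: K1K|apply: K2K].
  have -> : y ^+ (e1 + e2) *: u - x *: (y ^+ e2 *: w1 + y ^+ e1 *: w2)
     = y ^+ e2 *: (y ^+ e1 *: u1 - x *: w1) + y ^+ e1 *: (y ^+ e2 *: (u - u1) - x *: w2).
    rewrite !scalerBr addrACA -opprD; congr (_ - _).
      by rewrite !scalerA -!exprD (addnC e2 e1) addrC subrK.
    by rewrite scalerDr !scalerA !(mulrC x).
  by apply: submodD => //; apply: submodZ.
(* Fitting's argument: once the images x^n K are stable modulo B, K is the sum of x^N K and the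
   kernel of x^N, and sum-irreducibility makes one of the two equal to K. *)
have dich x : (exists n, forall u, K u -> B (x ^+ n *: u)) \/
    (forall u, K u -> exists2 w, K w & B (u - x *: w)).
  pose P n v := exists2 w, K w & B (v - x ^+ n *: w).
  have sP n : submod (P n).
    split; first by exists 0; rewrite ?scaler0 ?subr0; apply: submod0.
    move=> r v v' [w Kw Bw] [w' Kw' Bw']; exists (r *: w + w').
      by case: sK => _; apply.
    rewrite scalerDr scalerA mulrC -scalerA opprD addrACA -scalerBr.
    by case: sB => _; apply.
  have PK n : psubset (P n) K.
    move=> v [w Kw Bw]; apply: (submod_subl sK (y := x ^+ n *: w)); first exact: BK.
    exact: submodZ.
  have BP n : psubset B (P n).
    by move=> v Bv; exists 0; rewrite ?scaler0 ?subr0 //; apply: submod0.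
  have Pd n : psubset (P n.+1) (P n).
    move=> v [w Kw Bw]; exists (x *: w); first exact: submodZ.
    by rewrite scalerA -exprSr.
  have [//|//|n v /PK /KZ //|//|N HN] := cZ P.
  pose K2 u := K u /\ B (x ^+ N *: u).
  have s2 : submod K2.
    split; first by rewrite /K2 scaler0; split; apply: submod0.
    move=> r u v [Ku Bu] [Kv Bv]; split; first by case: sK => _; apply.
    by rewrite scalerDr scalerA mulrC -scalerA; case: sB => _; apply.
  have dec u : K u -> exists2 u1, P N u1 & K2 (u - u1).
    move=> Ku; have : P N (x ^+ N *: u) by exists u; rewrite // subrr; apply: submod0.
    move=> /(HN (N + N)%N (leq_addr _ _))[w Kw Bw].
    exists (x ^+ N *: w); first by exists w; rewrite // subrr; apply: submod0.
    split; first by apply: submodB => //; apply: submodZ.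
    by rewrite scalerBr scalerA -exprD.
  have [KP|nKP] := pselect (psubset K (P N)).
    right=> u /KP /(HN N.+1 (leqnSn N))[w Kw Bw].
    exists (x ^+ N *: w); first exact: submodZ.
    by rewrite scalerA -exprS.
  have [KK2|nKK2] := pselect (psubset K K2); first by left; exists N => u /KK2[].
  exfalso; apply: irr; exists (P N), K2; split=> //; split=> //.
    by move=> v Bv; split; [apply: BK|apply: submodZ].
  by move=> v [].
pose q x := exists n, forall u, K u -> B (x ^+ n *: u).
have iq0 : is_ideal (fun r => forall u, K u -> B (r *: u)).
  split; first by move=> u _; rewrite scale0r; apply: submod0.
  split=> [a b Ha Hb u Ku|r a Ha u Ku]; last by rewrite -scalerA; apply: submodZ => //; apply: Ha.
  by rewrite scalerDl; apply: submodD => //; [apply: Ha|apply: Hb].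
have iq : is_ideal q by apply: (radical_ideal iq0).
have [mq|nmq] := pselect (psubset m q).
  exists [::]; split=> // x _ y /mq[e He]; exists e => u Ku; exists 0; first exact: submod0.
  by rewrite scaler0 subr0; apply: He.
exists [:: q]; split; last first.
  move=> x /(_ q (or_introl erefl)) nqx y _; exists 0%N => u Ku.
  have [//|H] := dich x; have [w Kw Bw] := H u Ku.
  by exists w; rewrite // expr0 scale1r.
move=> P [<-|//]; split=> //; split=> //; split.
  move=> [n Hn]; apply: nmq => x _; exists 0%N => u Ku.
  by have := Hn u Ku; rewrite expr1n expr0.
move=> a b [n Hn]; have [qa|H] := dich a; [by left|right].
have surj k u : K u -> exists2 w, K w & B (u - a ^+ k *: w).
  elim: k u => [|k IHk] u Ku; first by exists u; rewrite // expr0 scale1r subrr; apply: submod0.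
  have [w Kw Bw] := IHk u Ku; have [w' Kw' Bw'] := H w Kw.
  exists w' => //; apply: (submod_subl sB (y := a ^+ k *: (w - a *: w'))).
    by rewrite scalerBr scalerA -exprSr opprB addrA subrK.
  exact: submodZ.
exists n => u Ku; have [w Kw Bw] := surj n u Ku.
apply: (submod_subl sB (y := b ^+ n *: (a ^+ n *: w))).
  by rewrite -scalerBr; apply: submodZ.
by rewrite scalerA mulrC -exprMn; apply: Hn.
Qed.

End OneModule.
End Artinian.

(** * Vanishing and nonvanishing of Koszul cohomology *)

Section KoszulCohomology.
Variable R : comNzRingType.
Hypothesis noeth : noetherian_ring R.
Variables m J : R -> Prop.
Hypotheses (loc : local_ring m) (iJ : is_ideal J).

Notation Gam := (gam J m).

Lemma cc_restrict asc (V : lmodType R) (Z Z' B : V -> Prop) :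
  submod Z -> submod Z' -> submod B -> psubset B Z -> psubset Z' Z -> cc asc Z B -> cc asc Z' B.
Proof.
move=> sZ sZ' sB BZ ZZ c; apply: (@cc_subquotient _ _ _ _ _ _ _ _ (fun u w => u = w)) c => //.
- by split=> // r u w u' w' -> ->.
- by move=> u /ZZ Zu; exists u.
- by move=> u w _ ->.
Qed.

(** The part killed by all generators of m is noetherian over the residue field, hence artinian,
    saturation being automatic because elements outside m are units. Melkersson's criterion then
    drops the generators one by one. *)
Lemma noeth_tors_dcc (V : lmodType R) (Z B : V -> Prop) (zs : seq R) :
  submod Z -> submod B -> psubset B Z -> cc true Z B ->
  (forall z, z \in zs -> forall u, Z u -> exists k, B (z ^+ k *: u)) ->
  (forall x, m x <-> igen (@Rzero R) zs x) -> cc false Z B.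
Proof.
move=> sZ sB BZ cZ tz mzs.
have sK (ws : seq R) : submod (fun u => Z u /\ forall z, z \in ws -> B (z *: u)).
  split; first by split=> [|z _]; rewrite ?scaler0; apply: submod0.
  move=> r u v [Zu Hu] [Zv Hv]; split; first by case: sZ => _; apply.
  move=> z zws; rewrite scalerDr scalerA mulrC -scalerA.
  by case: sB => _; apply; [apply: Hu|apply: Hv].
have base : cc false (fun u => Z u /\ forall z, z \in zs -> B (z *: u)) B.
  move=> D sD BD DZ Dd.
  apply: (@noeth_killed_dcc _ V m (fun u => Z u /\ forall z, z \in zs -> B (z *: u)) B) => //.
  - apply: cc_restrict cZ => //; by move=> u [].
  - move=> p u /mzs Hp [Zu Hu]; move: p Hp.
    apply: (@igen_min R _ _ (fun p => B (p *: u))) => //.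
    + split; first by rewrite scale0r; apply: submod0.
      split=> [a b Ha Hb|r a Ha]; first by rewrite scalerDl; apply: submodD.
      by rewrite -scalerA; apply: submodZ.
    + by move=> _ ->; rewrite scale0r; apply: submod0.
  - by move=> n s u ns; apply: (local_scale_inv noeth loc).
suff key (ws : seq R) : {subset ws <= zs} -> cc false (fun u => Z u /\ forall z, z \in ws -> B (z *: u)) B ->
    cc false Z B by apply: key base.
elim: ws => [|w ws IH] sub cw.
  apply: cc_restrict cw => //; first by move=> u Bu; split=> //; apply: BZ.
apply: IH => [z zws|]; first by apply: sub; rewrite inE zws orbT.
apply: (@melkersson _ _ _ _ _ _ _ w) => //.
- by move=> u Bu; split=> [|z _]; [apply: BZ|apply: submodZ].
- by move=> u [Zu _]; apply: (tz w) => //; apply: sub; rewrite mem_head.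
apply: cc_restrict cw => //.
- split; first by split; [apply: (submod0 (sK ws))|rewrite scaler0; apply: submod0].
  move=> r u v [Hu Bu] [Hv Bv]; split; first by case: (sK ws) => _; apply.
  by rewrite scalerDr scalerA mulrC -scalerA; case: sB => _; apply.
- by move=> u Bu; split=> [|z _]; [apply: BZ|apply: submodZ].
- move=> u [[Zu Hu] Bu]; split=> // z; rewrite inE => /orP[/eqP->//|]; exact: Hu.
Qed.

Lemma sGam : subfunctor Gam. Proof. exact: gam_subfunctor. Qed.

Section OneComplex.
Variable X : cplx R.
Hypothesis bX : forall n, baer (@full R) (cT X n).
Hypothesis nX : forall i, cc true (@cyc R X (@full R) i) (@bd R X (@full R) i).

(** On Gam a relation y^k u = j u holds with j in J, and j is nilpotent on Koszul cohomology because
    it lies in (L); so y is nilpotent too. *)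
Lemma tors_gam_kos L : psubset J (igen (@Rzero R) L) ->
  forall y, m y -> tors_all (kos L X) Gam y.
Proof.
move=> JL y my n u cu; have [Gu du] := cu.
have /tors_SmulP[k [j [Jj e]]] := Gu y my.
have [|l Hl] := @tors_all_kos_gen R X Gam (@Rzero R) L sGam _ j (JL _ Jj) n u cu.
  by move=> r ->; apply: ideal0; apply: tors_all_ideal; apply: sGam.
exists (k * l)%N; rewrite exprM.
suff -> : (y ^+ k) ^+ l *: u = j ^+ l *: u by [].
elim: l {Hl} => [|l IH]; first by rewrite !expr0.
by rewrite exprS -scalerA IH scalerA mulrC -scalerA e scalerA exprSr.
Qed.

(** After adding generators [zs] of m to L, the Koszul cohomology of X is noetherian and m-torsion,
    and applying Gam does not enlarge it, so it is artinian. Melkersson's criterion removes the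
    elements of [zs] again. *)
Lemma artinian_kos L n : psubset J (igen (@Rzero R) L) ->
  cc false (@cyc R (kos L X) Gam n) (@bd R (kos L X) Gam n).
Proof.
move=> JL; have im := local_ideal loc.
have [zs mzs] := noeth_fg noeth im.
have iz := Rzero_ideal R.
have zm z : z \in zs -> m z by move=> zz; apply/mzs; apply: igen_gen.
have mrad : psubset m (radical (igen J zs)).
  move=> x /mzs Hx; apply: radical_base; move: x Hx; apply: igen_sub => //.
    by move=> x ->; apply: ideal0; apply: igen_ideal.
  by move=> z zz; apply: igen_gen.
have full0 r : Rzero r -> tors_all X (@full R) r.
  by move=> ->; apply: ideal0; apply: tors_all_ideal; exact: full_subfunctor.
have base k : cc false (@cyc R (kos (zs ++ L) X) Gam k) (@bd R (kos (zs ++ L) X) Gam k).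
  have bK := @baer_kos R X (zs ++ L) bX.
  have tz z : z \in zs -> tors_all (kos (zs ++ L) X) (@full R) z.
    move=> zz; apply: (tors_all_kos_gen (full_subfunctor R) full0).
    by apply: igen_gen; rewrite // mem_cat zz.
  have eG : Gam = torl J zs by apply: gam_torl.
  have sT := torl_subfunctor iJ zs.
  have sF := full_subfunctor R.
  rewrite eG; apply: (noeth_tors_dcc _ _ _ _ _ mzs).
  - exact: cyc_submod.
  - exact: bd_submod.
  - by move=> u; apply: bd_cyc.
  - apply: (@cc_subquotient _ _ _ _ _ _ _ _ (fun u w => u = w)) (@cc_kos R true X _ (zs ++ L) sF nX k).
    + by split=> // r u w u' w' -> ->.
    + exact: cyc_submod.
    + exact: cyc_submod.
    + exact: bd_submod.
    + by move=> u; apply: bd_cyc.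
    + by move=> u [_ du]; exists u.
    + by move=> u w [Tu _] <- bw; apply: bd_torl.
  - by move=> z zz u cu; apply: (tors_all_torl noeth iJ bK tz (tz z zz)).
suff desc (ws : seq R) : (forall w, w \in ws -> m w) ->
    (forall k, cc false (@cyc R (kos (ws ++ L) X) Gam k) (@bd R (kos (ws ++ L) X) Gam k)) ->
    cc false (@cyc R (kos L X) Gam n) (@bd R (kos L X) Gam n) by apply: (desc zs).
elim: ws => [|w ws IH] wm H; first exact: H.
apply: IH => [z zz|k]; first by apply: wm; rewrite inE zz orbT.
have JwL : psubset J (igen (@Rzero R) (ws ++ L)).
  move=> x /JL; apply: igen_sub => //; first by move=> z; apply: igen_base.
  by move=> z zL; apply: igen_gen; rewrite // mem_cat zL orbT.
have sG := sGam; set K := kos (ws ++ L) X.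
have sc := cyc_submod K sG k; have sb := bd_submod K sG k.
have bc u := @bd_cyc R K Gam sG k u.
have sW : submod (fun u : cT K k => cyc Gam u /\ bd Gam (w *: u)).
  split; first by rewrite scaler0; split; apply: submod0.
  move=> r u v [cu bu] [cv bv]; split; first by case: sc => _; apply.
  by rewrite scalerDr scalerA mulrC -scalerA; case: sb => _; apply.
apply: (@melkersson _ _ _ _ _ _ _ w) => //.
  by move=> u cu; apply: (tors_gam_kos JwL _ cu); apply: wm; rewrite mem_head.
(* A class killed by w lifts to a cycle (u, v) of the cone, so the kernel of w is a subquotient of
   the cohomology of the cone. *)
apply: (@cc_subquotient _ _ _ _ _ _ _ _ (fun u (p : cone_T K k) => u = p.1)) (H k) => //.
- by split=> // r u p u' p' -> ->.
- exact: cyc_submod.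
- exact: bd_submod.
- by move=> p; apply: bd_cyc.
- move=> u [[Gu du] [v Gv e]]; exists (u, v) => //.
  by apply/cyc_cone.
- move=> u [u' v] _ ->; case: (k) u' v => [|k'] u' v.
    by move=> /(bd_cone0 _ sG) /= ->; apply: (submod0 (bd_submod _ sG _)).
  by move=> /(bd_coneS _ sG)[p [q [Gp _ -> _]]]; exists p.
Qed.

End OneComplex.

Lemma fg_cc (V : lmodType R) (B : V -> Prop) vs : submod B -> cc true (lspan (@Rtrue R) B vs) B.
Proof.
move=> sB; have iT := Rtrue_ideal R; elim: vs => [|v vs IH].
  by move=> P sP BP PZ _; exists 0%N => n _ x /(PZ n); apply: BP.
have s1 := lspan_submod iT vs sB; have s2 := lspan_submod iT (v :: vs) sB.
apply: (cc_ext s2 s1 _ _ IH).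
- by move=> x; apply: lspan_base.
- by move=> x Hx; exists 0; rewrite // scale0r subr0.
apply: (@cc_subquotient R true V R^o _ _ (@Rtrue R) (@Rzero R)
   (fun u (r : R^o) => lspan (@Rtrue R) B vs (u - r *: v))) => //.
- split; first by rewrite scale0r subr0; apply: submod0.
  move=> r u w u' w' Hu Hu'.
  have -> : r *: u + u' - (r *: w + w') *: v = r *: (u - w *: v) + (u' - w' *: v).
    by rewrite scalerDl -scalerA scalerBr opprD addrACA.
  by case: s1 => _; apply.
- exact/ideal_submod/Rzero_ideal.
- by move=> u w _ + w0; rewrite [w]w0 scale0r subr0.
- exact: noeth_ring_cc.
Qed.

Lemma lspan_scale (V : lmodType R) (A : R -> Prop) (B : V -> Prop) vs x v :
  is_ideal A -> submod B -> A x -> lspan (@Rtrue R) (fun u => u = 0) vs v -> lspan A B vs (x *: v).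
Proof.
move=> iA sB Ax; have sl := lspan_submod iA vs sB.
apply: (@lspan_min R V (@Rtrue R) _ _ (fun v => lspan A B vs (x *: v))).
- split; first by rewrite scaler0; apply: submod0.
  move=> r u w Hu Hw; rewrite scalerDr scalerA mulrC -scalerA.
  by case: sl => _; apply.
- by move=> u ->; rewrite scaler0; apply: submod0.
- by move=> u j uvs _; rewrite scalerA; apply: lspan_gen => //; apply: idealMr.
Qed.

Definition annM (M : lmodType R) : R -> Prop := fun r => forall x : M, r *: x = 0.

Lemma annM_ideal M : is_ideal (annM M).
Proof.
split; first by move=> x; rewrite scale0r.
split=> [a b Ha Hb x|r a Ha x]; first by rewrite scalerDl Ha Hb addr0.
by rewrite -scalerA Ha scaler0.
Qed.

(** * Koszul complexes on an injective resolution of M *)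

Section Resolution.
Variables (M : lmodType R) (gs : seq M).
Hypothesis gsP : forall x : M, lspan (@Rtrue R) (fun u => u = 0) gs x.
Variables (X : cplx R) (eps : M -> cT X 0).
Hypotheses (eps_lin : is_linear eps) (eps_inj : injective eps).
Hypothesis eps_im : forall u : cT X 0, cd u = 0 <-> exists x, eps x = u.
Hypothesis exX : forall i, (1 <= i)%N -> van X (@full R) i.
Hypothesis bX : forall n, baer (@full R) (cT X n).

Let sF := full_subfunctor R.

Lemma zero_submod (V : lmodType R) : submod (fun u : V => u = 0).
Proof. by split=> // r x y -> ->; rewrite scaler0 addr0. Qed.

Lemma bd0 G (u : cT X 0) : bd G u -> u = 0.
Proof. by move=> [v _ <-]. Qed.

Lemma res_cc i : cc true (@cyc R X (@full R) i) (@bd R X (@full R) i).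
Proof.
case: i => [|i]; last first.
  move=> P sP BP PZ _; exists 0%N => n _ x /(PZ n) cx; apply: BP.
  exact: exX.
apply: (@cc_subquotient _ _ _ M _ _ (fun _ => True) (fun u => u = 0)
   (fun u a => u = eps a)) => //.
- by split=> [|r u w u' w' -> ->]; rewrite ?(lin0 eps_lin).
- exact: cyc_submod.
- exact: zero_submod.
- by move=> u [_ /eps_im[a <-]]; exists a.
- by move=> u a _ -> ->; rewrite (lin0 eps_lin); apply: (submod0 (bd_submod _ sF _)).
have H := @fg_cc M _ gs (zero_submod M).
by move=> P sP BP _; apply: H => // n x _; apply: gsP.
Qed.

Lemma res_tors_ann r : annM M r -> tors_all X (@full R) r.
Proof.
move=> ar [|n] u cu; last by exists 0%N; rewrite expr0 scale1r; apply: exX.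
have [_ /eps_im[a e]] := cu; exists 1%N; rewrite expr1 -e -(linZ eps_lin) ar (lin0 eps_lin).
exact: (submod0 (bd_submod _ sF _)).
Qed.

Lemma res_kos_van L i : (size L < i)%N -> van (kos L X) (@full R) i.
Proof. by move=> Li; apply: (@kos_van R X (@full R) L 1 sF exX); rewrite addn1. Qed.

(* phi L induces an isomorphism from M / (L) M onto the top cohomology of kos L X. *)
Fixpoint phi (L : seq R) : M -> cT (kos L X) (size L) :=
  match L with
  | [::] => eps
  | x :: L' => fun a => (0, phi L' a)
  end.

(** Membership in (L) M, unfolded one element of L at a time to match the iterated cones. *)
Fixpoint LM (L : seq R) (a : M) : Prop :=
  match L with
  | [::] => a = 0
  | x :: L' => exists a', LM L' (a - x *: a')
  end.

Lemma phi_lin L : is_linear (phi L).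
Proof.
elim: L => [|x L IH] r a b; first exact: eps_lin.
by rewrite /= IH pairE scaler0 addr0.
Qed.

Lemma phi_cyc L a : cyc (@full R) (phi L a).
Proof.
elim: L => [|x L [_ IH]]; first by split=> //; apply/eps_im; exists a.
apply/(cyc_cone _ sF); split=> //; first exact: (lin0 (@cd_lin _ _ _)).
by rewrite scaler0 /= IH.
Qed.

Lemma phi_onto L (u : cT (kos L X) (size L)) : cyc (@full R) u ->
  exists a, bd (@full R) (u - phi L a).
Proof.
elim: L u => [|x L IH] u.
  move=> [_ /eps_im[a <-]]; exists a; rewrite subrr.
  exact: (submod0 (bd_submod _ sF _)).
case: u => u v /(cyc_cone _ sF)[_ _ du xu].
have [|p _ /= ep] := @res_kos_van L (size L).+1 (ltnSn _) u; first by [].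
have cl := @cd_lin _ (kos L X) (size L).
have [|a [q _ eq]] := IH (v - x *: p).
  by split=> //; rewrite (linB cl) (linZ cl) ep xu subrr.
exists a; apply/(bd_coneS _ sF); exists p, (- q); split=> //; first by rewrite subr0.
rewrite (linN (@sd_lin _ (kos L X) (size L))) eq opprK [RHS]addrC.
by rewrite [RHS]addrAC subrK.
Qed.

Lemma phi_bd L a : bd (@full R) (phi L a) -> LM L a.
Proof.
elim: L a => [|x L IH] a.
  by move=> /bd0; rewrite -(lin0 eps_lin) => /eps_inj.
move=> /(bd_coneS _ sF)[p [q [_ _ e1 e2]]].
have {}e2 : phi L a = x *: p - sd q := e2.
have [|a' [q' _ eq']] := @phi_onto L p; first by split.
exists a'; apply: IH; rewrite (linB (phi_lin L)) (linZ (phi_lin L)) e2.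
exists (x *: q' - q) => //.
rewrite (linB (@sd_lin _ _ _)) (linZ (@sd_lin _ _ _)) eq' scalerBr.
by rewrite addrAC.
Qed.

Lemma LM_lspan L a : LM L a -> lspan (igen (@Rzero R) L) (fun u => u = 0) gs a.
Proof.
have iz := Rzero_ideal R.
elim: L a => [|x L IH] a.
  by move=> ->; apply: submod0; apply: lspan_submod => //; exact: zero_submod.
move=> [a' /IH H]; have iL := igen_ideal (x :: L) iz.
have sl := lspan_submod iL gs (zero_submod M).
apply: (submod_subl sl (y := x *: a')).
  apply: lspan_min H => //; first by move=> u ->; apply: submod0.
  move=> v j vgs Hj; apply: lspan_gen => //; first exact: zero_submod.
  move: j Hj; apply: igen_sub => //; first by move=> j; apply: igen_base.
  by move=> z zL; apply: igen_gen; rewrite // inE zL orbT.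
apply: lspan_scale => //; first exact: zero_submod.
by apply: igen_gen; rewrite // mem_head.
Qed.

(** By the determinant trick some r^n + t with t in (L) kills M. *)
Lemma LM_ann L r : (forall a, LM L (r *: a)) -> radical (igen (annM M) L) r.
Proof.
move=> H; have iz := Rzero_ideal R; have iL := igen_ideal L iz.
have [|n [t [At Ht]]] := @determinant_trick R M (igen (@Rzero R) L) (fun u => u = 0) gs r iL (zero_submod M).
  by move=> v _; apply: LM_lspan.
have ia := annM_ideal M.
exists n; rewrite -[r ^+ n](addrK t); apply: idealB; first exact: igen_ideal.
  apply: igen_base => x; move: x (gsP x).
  apply: (@lspan_min R M (@Rtrue R) _ _ (fun x => (r ^+ n + t) *: x = 0)).
  - split; first by rewrite scaler0.
    by move=> s x y ex ey; rewrite scalerDr ey scalerA mulrC -scalerA ex scaler0 addr0.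
  - by move=> x ->; rewrite scaler0.
  - by move=> v j vgs _; rewrite scalerA mulrC -scalerA Ht // scaler0.
move: t At {Ht}; apply: igen_sub => //; first by move=> x ->; apply: ideal0; apply: igen_ideal.
by move=> y yL; apply: igen_gen.
Qed.

Hypothesis M_nonzero : ~ annM M 1.

Let iA : is_ideal (annM M) := annM_ideal M.
Let im : is_ideal m := local_ideal loc.

Lemma annM_local : psubset (annM M) m.
Proof. exact: proper_sub_local. Qed.

(** Generators of Ann M and the elements of L are nilpotent on the cohomology of [kos L X], so as
    torsion conditions they cost no degree. *)
Lemma kos_tors_gens L : exists2 zs, (forall z, z \in zs -> annM M z \/ z \in L) &
  (forall z, z \in zs -> tors_all (kos L X) (@full R) z) /\
  (forall x, igen (annM M) L x -> igen J zs x).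
Proof.
have iz := Rzero_ideal R.
have [as_ asP] := noeth_fg noeth iA.
have aA z : z \in as_ -> annM M z by move=> za; apply/asP; apply: igen_gen.
exists (as_ ++ L); last split.
- by move=> z; rewrite mem_cat => /orP[/aA|]; [left|right].
- move=> z; rewrite mem_cat => Hz; apply: (tors_all_kos_gen sF res_tors_ann).
  case/orP: Hz => [/aA|] Hz; [exact: igen_base|exact: igen_gen].
apply: igen_sub => //; last by move=> y yL; apply: igen_gen; rewrite // mem_cat yL orbT.
move=> x /asP; apply: igen_sub => //; first by move=> z ->; apply: ideal0; apply: igen_ideal.
by move=> y ya; apply: igen_gen; rewrite // mem_cat ya.
Qed.

Lemma kos_van_gam L ys : (forall z, z \in L -> m z) -> (forall y, y \in ys -> m y) ->
  psubset m (radical (igen (ideal_add J (igen (annM M) L)) ys)) ->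
  forall i, (size ys + size L < i)%N -> van (kos L X) Gam i.
Proof.
move=> Lm ym mrad i li; have [zs zP [tz Az]] := kos_tors_gens L.
have zm z : z \in ys ++ zs -> m z.
  by rewrite mem_cat => /orP[/ym//|/zP[/annM_local//|/Lm]].
have -> : Gam = torl J (ys ++ zs).
  apply: gam_torl => // x /mrad; apply: radical_mono; apply: igen_sub => //.
    move=> _ [a [b [Ja [Hb ->]]]]; apply: idealD; [exact: igen_ideal|exact: igen_base|].
    move: b Hb => b /Az; apply: igen_sub => //; first by move=> z; apply: igen_base.
    by move=> y yz; apply: igen_gen; rewrite // mem_cat yz orbT.
  by move=> y yy; apply: igen_gen; rewrite // mem_cat yy.
apply: (@van_torl _ noeth J iJ (kos L X) zs ys (size L).+1) => //.
- exact: baer_kos.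
- by move=> k; apply: res_kos_van.
- by rewrite addnS.
Qed.

Lemma LM_not_all L : (forall z, z \in L -> m z) -> ~ (forall a, LM L a).
Proof.
move=> Lm H; apply: (local_n1 loc).
have [|n] := @LM_ann L 1; first by move=> a; apply: H.
by rewrite expr1n; apply: igen_min => //; exact: annM_local.
Qed.

(** Were it zero from degree size L on, adding generators [zs] of m would leave no top cohomology of
    Gam in degree size (zs ++ L). There classes of the full complex have representatives in Gam, so
    M / (zs, L) M would vanish, against Nakayama. *)
Lemma kos_gam_nonzero L : (forall z, z \in L -> m z) ->
  ~ (forall i, (size L <= i)%N -> van (kos L X) Gam i).
Proof.
move=> Lm H; have [zs mzs] := noeth_fg noeth im; have iz := Rzero_ideal R.
have zm z : z \in zs -> m z by move=> zz; apply/mzs; apply: igen_gen.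
have L'm z : z \in zs ++ L -> m z by rewrite mem_cat => /orP[/zm|/Lm].
apply: (LM_not_all L'm) => a; apply: phi_bd.
have tz z : z \in zs -> tors_all (kos (zs ++ L) X) (@full R) z.
  move=> zz; apply: (tors_all_kos_gen sF res_tors_ann).
  by apply: igen_gen; rewrite // mem_cat zz.
have eG : Gam = torl J zs.
  apply: gam_torl => // x /mzs Hx; apply: radical_base; move: x Hx; apply: igen_sub => //.
    by move=> x ->; apply: ideal0; apply: igen_ideal.
  by move=> z zz; apply: igen_gen.
have [u cu [v _ ev]] := cyc_torl noeth iJ (@baer_kos R X (zs ++ L) bX) tz (phi_cyc (zs ++ L) a).
have vK : van (kos (zs ++ L) X) Gam (size (zs ++ L)).
  rewrite /kos foldr_cat -/(kos L X) -/(kos zs (kos L X)).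
  by apply: (@kos_van R (kos L X) Gam zs (size L) sGam H); rewrite size_cat.
have [w _ ew] : bd Gam u by apply: vK; rewrite eG.
exists (v + w) => //; rewrite (linD (@sd_lin _ _ _)) ev ew.
by rewrite subrK.
Qed.

Lemma radical_igen_cons (b : R -> Prop) x ys : is_ideal b ->
  psubset m (radical (igen (igen b [:: x]) ys)) -> psubset m (radical (igen b (x :: ys))).
Proof.
move=> ib H y /H; apply: radical_mono; apply: igen_sub => //.
  apply: igen_sub => //; first by move=> z; apply: igen_base.
  by move=> z; rewrite inE => /eqP->; apply: igen_gen; rewrite // mem_head.
by move=> z zy; apply: igen_gen; rewrite // inE zy orbT.
Qed.

Lemma igen_cons (b : R -> Prop) x L y : igen b (x :: L) y <-> igen (igen b L) [:: x] y.
Proof. by []. Qed.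

(* With H the top cohomology of kos L, that of kos (x :: L) is H/xH. It is killed
   by y^e, hence equal to H/(x, y^e)H, the top cohomology of the next cone. *)
Lemma kos_top_drop L x y e n :
  van (kos L X) Gam n.+1 ->
  (forall u : cT (kos L X) n, cyc Gam u ->
     exists2 w : cT (kos L X) n, cyc Gam w & bd Gam (y ^+ e *: u - x *: w)) ->
  van (kos (y ^+ e :: x :: L) X) Gam n.+2 ->
  van (kos (x :: L) X) Gam n.+1.
Proof.
move=> vL Hxy vtop p cp; have sG := sGam; have [sub nat] := sG.
set K := kos L X in vL Hxy p cp *; set K' := kos (x :: L) X in vtop p cp *.
have sb := bd_submod K' sG n.+1.
have [p0 [q [Gp0 Gq e1 e2]]] : exists p0 q, [/\ @Gam (cT K' n.+1) p0, @Gam (shT K' n.+1) q,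
    0 = cd p0 & p = y ^+ e *: p0 - sd q].
  have /vtop/(bd_coneS _ sG)// : @cyc R (kos (y ^+ e :: x :: L) X) Gam n.+2 (0, p).
  apply/(cyc_cone _ sG); case: cp => Gp dp; split=> //.
  - exact: (submod0 (sub _)).
  - exact: (lin0 (@cd_lin _ _ _)).
  - by rewrite scaler0; symmetry; exact: dp.
rewrite e2; apply: (submodB sb); last by exists q.
case: p0 Gp0 e1 {e2} => u v Gp0 e1.
have /(cyc_cone _ sG)[Gu Gv du /= xu] : @cyc R K' Gam n.+1 (u, v) by split.
have [|t Gt /= et] := vL u; first by split.
have cl := @cd_lin _ K n.
have [|w [Gw dw] [q' Gq' eq']] := Hxy (v - x *: t).
  split; first by apply: (submodB (sub _)) => //; apply: (submodZ (sub _)).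
  by rewrite (linB cl) (linZ cl) et xu subrr.
apply/(bd_coneS _ sG); exists (y ^+ e *: t + w), (- q'); split.
- by apply: (submodD (sub _)) => //; apply: (submodZ (sub _)).
- exact: (submodN (sub _)).
- by rewrite (linD cl) (linZ cl) et dw addr0.
rewrite (linN (@sd_lin _ _ _)) eq' opprK scalerDr scalerBr !scalerA (mulrC x).
rewrite -addrA [x *: w + _]addrC subrK addrC subrK.
by [].
Qed.

(** The elements of M whose top class comes from Gam form N1. Over x :: L every class comes from
    Gam, which gives M = N1 + x M and, by Nakayama, M = N1. Hence M/(L)M is a quotient of a subset
    of m-torsion classes, and powers of each y in m send M into (L) M. *)
Lemma kos_bottom L x : psubset J (igen (@Rzero R) L) -> (forall z, z \in x :: L -> m z) ->
  (forall i, (size L < i)%N -> van (kos L X) Gam i) ->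
  psubset m (radical (igen (annM M) (x :: L))) ->
  psubset m (radical (igen (annM M) L)).
Proof.
move=> JL L'm vL mrad; have sG := sGam; have [sub nat] := sG.
set n := size L in vL *; set K := kos L X in vL *.
have mx : m x by apply: L'm; rewrite mem_head.
have [zs zP [tz Az]] := kos_tors_gens (x :: L).
have zm z : z \in zs -> m z by move=> /zP[/annM_local|/L'm].
have eG : Gam = torl J zs.
  by apply: gam_torl => // y /mrad; apply: radical_mono => w; apply: Az.
have cl k := @cd_lin _ K k.
pose N1 a := exists2 g : cT K n, cyc Gam g & bd (@full R) (phi L a - g).
have sN1 : submod N1.
  have sc := cyc_submod K sG n; have sbf := bd_submod K sF n.
  split.
    exists 0; first exact: submod0.
    by rewrite (lin0 (phi_lin L)) subr0; apply: submod0.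
  move=> r a b [g cg bg] [h ch bh]; exists (r *: g + h); first by case: sc => _; apply.
  by rewrite phi_lin opprD addrACA -scalerBr; case: sbf => _; apply.
have step a : exists a1, N1 (a - x *: a1).
  have [u cu bu] := cyc_torl noeth iJ (@baer_kos R X (x :: L) bX) tz (phi_cyc (x :: L) a).
  rewrite -eG in cu; case: u cu bu => u' v' cu' bu'.
  have {bu'}[p [q [_ _ e1 e2]]] : exists (p : cT K n) (q : shT K n), [/\ True, True,
      0 - u' = cd p & phi L a - v' = x *: p - sd q].
    by move/(bd_coneS _ sF): bu' => [p [q [_ _ e1 e2]]]; exists p, q.
  have /(cyc_cone _ sG)[Gu' Gv' du' /= xu'] := cu'.
  have [|t Gt /= et] := vL n.+1 (ltnSn n) u'; first by split.
  have [|a1 [q1 _ eq1]] := @phi_onto L (p + t).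
    by split=> //; rewrite (linD (cl n)) -e1 et sub0r addNr.
  exists a1; exists (v' - x *: t).
    split; first by apply: (submodB (sub _)) => //; apply: (submodZ (sub _)).
    by rewrite (linB (cl n)) (linZ (cl n)) et xu' subrr.
  exists (x *: q1 - q) => //.
  rewrite (linB (@sd_lin _ _ _)) (linZ (@sd_lin _ _ _)) eq1.
  rewrite (linB (phi_lin L)) (linZ (phi_lin L)).
  have -> : phi L a = x *: p - sd q + v' by rewrite -e2 subrK.
  rewrite !scalerBr scalerDr !opprB.
  move: (x *: p) (x *: t) (x *: phi L a1) (sd q) v' {e1 e2 cu' Gv' xu'} => A B C D E.
  rewrite [A - D + E - C]addrAC addrACA subrr addr0.
  by rewrite [LHS]addrAC [RHS]addrAC; congr (_ - _); rewrite addrAC.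
have pm := local_prime noeth loc.
have [|s ns Hs] := @local_nakayama R m pm M N1 gs sN1.
  move=> g ggs; exists 1; first exact: (local_n1 loc).
  have [a1 Ha1] := step g; rewrite scale1r.
  have sl := lspan_submod im gs sN1.
  apply: (submod_subl sl (y := x *: a1)); first exact: lspan_base.
  exact: lspan_scale.
have all1 a : N1 a.
  move: a (gsP a); apply: lspan_min => //; first by move=> u ->; apply: submod0.
  move=> v j vgs _; apply: submodZ => //; apply: (local_scale_inv noeth loc sN1 ns).
  exact: Hs.
move=> y my; apply: radical_radical.
have each a : exists k, LM L (y ^+ k *: a).
  have [g cg [q _ eq]] := all1 a.
  have [k [q' _ eq']] := tors_gam_kos JL my cg.
  exists k; apply: phi_bd; exists (y ^+ k *: q + q') => //.
  by rewrite (linD (@sd_lin _ _ _)) (linZ (@sd_lin _ _ _)) eq eq' (linZ (phi_lin L)) scalerBr subrK.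
have sLM : submod (fun a => bd (@full R) (phi L a)).
  have sbf := bd_submod K sF n; split; first by rewrite (lin0 (phi_lin L)); apply: submod0.
  by move=> r a b Ha Hb; rewrite phi_lin; case: sbf => _; apply.
have [k Hk] : exists k, forall g, g \in gs -> bd (@full R) (phi L (y ^+ k *: g)).
  elim: (gs) => [|g l [k Hk]]; first by exists 0%N.
  have [h ch [q _ eq]] := all1 g.
  have [k' [q' _ eq']] := tors_gam_kos JL my ch.
  exists (k + k')%N => g'; rewrite inE => /orP[/eqP->|gl].
    rewrite exprD -scalerA; apply: (submodZ sLM); exists (y ^+ k' *: q + q') => //.
    by rewrite (linD (@sd_lin _ _ _)) (linZ (@sd_lin _ _ _)) eq eq' (linZ (phi_lin L)) scalerBr subrK.
  by rewrite addnC exprD -scalerA; apply: (submodZ sLM); apply: Hk.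
exists k; apply: LM_ann => a; apply: phi_bd; move: a (gsP a).
apply: (@lspan_min R M (@Rtrue R) _ _ (fun a => bd (@full R) (phi L (y ^+ k *: a)))).
- split; first by rewrite scaler0; apply: (submod0 sLM).
  move=> r a b Ha Hb; rewrite scalerDr scalerA mulrC -scalerA.
  by case: sLM => _; apply.
- by move=> u ->; rewrite scaler0; apply: (submod0 sLM).
- by move=> v j vgs _; rewrite scalerA mulrC -scalerA; apply: (submodZ sLM); apply: Hk.
Qed.

(* Noetherian induction on b: the chosen x avoids the attached primes other than
   m of the top cohomology H, so H/xH is killed by a power of each y in m. *)
Lemma parameters_of_vanishing : forall b, is_ideal b -> forall c L,
  psubset J (igen (@Rzero R) L) -> (forall z, z \in L -> m z) ->
  psubset b (igen (annM M) L) ->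
  (forall i, (c + size L <= i)%N -> van (kos L X) Gam i) ->
  exists ys, [/\ forall y, y \in ys -> m y, (size ys < c)%N &
    psubset m (radical (igen (igen (annM M) L) ys))].
Proof.
have iz := Rzero_ideal R; have sG := sGam.
apply: (noeth_ind noeth) => b ib IHb; elim=> [|c _] L JL Lm bL vL.
  by exfalso; apply: (kos_gam_nonzero Lm).
have iAL := igen_ideal L iA.
have [mL|nmL] := pselect (psubset m (radical (igen (annM M) L))).
  by exists [::]; split.
have [P0 [pP0 LP0 nmP0]] := exists_prime_not_local noeth iAL nmL.
have sc := cyc_submod (kos L X) sG (c + size L).
have sb := bd_submod (kos L X) sG (c + size L).
have bc u := @bd_cyc R (kos L X) Gam sG (c + size L)%N u.
have [Ps [Ps1 Ps2]] := attached_primes sc sb bc m (artinian_kos bX res_cc (n := c + size L) JL).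
(* Avoiding [P0] makes Ann M + (x :: L) strictly larger than b, as the induction requires; avoiding
   the attached primes gives the near divisibility by x. *)
have [|x mx Hx] := @prime_avoidance R m (P0 :: Ps) im.
  by move=> P [<-|/Ps1//]; split.
have {}Ps2 y : m y -> exists e, forall u : cT (kos L X) (c + size L), cyc Gam u ->
    exists2 w : cT (kos L X) (c + size L), cyc Gam w & bd Gam (y ^+ e *: u - x *: w).
  by move=> my; apply: Ps2 => // P HP; apply: Hx; right.
have ix := igen_ideal (x :: L) iA.
have L'm z : z \in x :: L -> m z by rewrite inE => /orP[/eqP->|/Lm].
have JL' : psubset J (igen (@Rzero R) (x :: L)).
  move=> z /JL; apply: igen_sub => //; first by move=> w; apply: igen_base.
  by move=> w wL; apply: igen_gen; rewrite // inE wL orbT.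
have bx : psubset b (igen (annM M) (x :: L)).
  move=> z /bL Hz; apply/igen_cons; exact: igen_base.
have nxb : ~ psubset (igen (annM M) (x :: L)) b.
  move=> H; apply: (Hx P0); first by left.
  by apply: LP0; apply: bL; apply: H; apply: igen_gen; rewrite // mem_head.
have IHx c' := IHb _ ix bx nxb c' (x :: L) JL' L'm (fun z Hz => Hz).
have fin ys : (forall y, y \in ys -> m y) -> (size ys < c)%N ->
    psubset m (radical (igen (igen (annM M) (x :: L)) ys)) ->
    exists ys, [/\ forall y, y \in ys -> m y, (size ys < c.+1)%N &
    psubset m (radical (igen (igen (annM M) L) ys))].
  move=> ym sz H; exists (x :: ys); split=> //.
    by move=> z; rewrite inE => /orP[/eqP->|/ym].
  exact: radical_igen_cons.
have vL' : forall i, (c.+1 + size (x :: L) <= i)%N -> van (kos (x :: L) X) Gam i.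
  by move=> i; rewrite /= addnS => H; apply: (cone_van sG vL).
have [ys [ym sz mrad]] := IHx _ vL'.
(* With fewer than c parameters over x :: L, adding x finishes. With exactly c, the vanishing over x
   :: L must first be improved by one degree. *)
have [szc|] := ltnP (size ys) c; first exact: (fin ys).
move=> szc; have {sz szc} sz : size ys = c by apply/eqP; rewrite eqn_leq szc -ltnS sz.
case: c => [|c] in vL sc sb bc Ps2 IHx fin vL' sz *.
  exfalso; apply: nmL; apply: (kos_bottom JL L'm) => //.
  by move/size0nil: sz mrad => ->.
case: ys => [//|y ys] in ym sz mrad *.
have my : m y by apply: ym; rewrite mem_head.
have [e0 He0] := Ps2 y my.
(* The exponent e0 + 1 ensures that the power of y lies in m even if e0 = 0. *)
have He u : cyc Gam u -> exists2 w : cT (kos L X) (c.+1 + size L), cyc Gam w & bd Gam (y ^+ e0.+1 *: u - x *: w).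
  move=> /He0[w cw bw]; exists (y *: w); first exact: submodZ.
  by rewrite exprS [x *: _]scalerA (mulrC x) -!scalerA -scalerBr; apply: submodZ.
have [|ys3 [ym3 sz3 H3]] := IHx c.+1; last exact: (fin ys3).
move=> i; rewrite leq_eqVlt => /orP[/eqP <-|]; last first.
  by move=> H; apply: vL'; rewrite addSn.
rewrite [size (x :: L)]/= addnS.
apply: (@kos_top_drop L x y e0.+1) => //.
  by apply: vL; rewrite addSn.
(* Only c parameters remain over y^e :: x :: L, so cohomology vanishes above c + (size L + 2); the
   degree needed by [kos_top_drop] is the next one. *)
apply: (@kos_van_gam (y ^+ e0.+1 :: x :: L) ys).
- move=> z; rewrite inE => /orP[/eqP->|/L'm//]; exact: idealX.
- by move=> z zy; apply: ym; rewrite inE zy orbT.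
- move=> z /mrad Hz; apply: radical_radical; apply: radical_mono Hz.
  set D := igen (ideal_add J _) ys.
  have iyxL := igen_ideal (y ^+ e0.+1 :: x :: L) iA.
  have iD : is_ideal D by apply: igen_ideal; apply: ideal_add_ideal.
  have sD w : igen (annM M) (y ^+ e0.+1 :: x :: L) w -> D w.
    by move=> Hw; apply: igen_base; exists 0, w; rewrite add0r; split=> //; apply: ideal0.
  apply: igen_min; first exact: radical_ideal.
    move=> w Hw; apply: radical_base; apply: sD.
    by apply/igen_cons; apply: igen_base.
  move=> w; rewrite inE => /orP[/eqP->|wy].
    by exists e0.+1; apply: sD; apply: igen_gen; rewrite // mem_head.
  apply: radical_base; apply: igen_gen => //; exact: ideal_add_ideal.
- by move: sz => /= [->]; rewrite !addnS addSn.
Qed.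

End Resolution.
End KoszulCohomology.

(** * Injective resolutions *)

Section Quotient.
Variables (R : comNzRingType) (V : lmodType R) (N : V -> Prop).
Hypothesis sN : submod N.

Lemma coset_nonempty v : exists w, `[< N (w - v) >].
Proof. by exists v; apply/asboolP; rewrite subrr; apply: submod0. Qed.

(** [xchoose] depends only on the extension of its predicate, so a whole coset gets one
    representative and the quotient can be the set of fixed points. *)
Definition coset_rep (v : V) : V := xchoose (coset_nonempty v).

Lemma coset_repP v : N (coset_rep v - v).
Proof. by have /asboolP := xchooseP (coset_nonempty v). Qed.

Lemma coset_rep_eq v w : N (v - w) -> coset_rep v = coset_rep w.
Proof.
move=> Nvw; apply: eq_xchoose => u; apply: asbool_equiv_eq; split=> H.
  have -> : u - w = (u - v) + (v - w) by rewrite addrA subrK.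
  exact: submodD.
have -> : u - v = (u - w) - (v - w) by rewrite opprB addrA subrK.
exact: submodB.
Qed.

Lemma coset_repK v : coset_rep (coset_rep v) = coset_rep v.
Proof. by apply: coset_rep_eq; apply: coset_repP. Qed.

Record quotm := Quotm { qval : V; qvalP : coset_rep qval = qval }.

HB.instance Definition _ := gen_eqMixin quotm.
HB.instance Definition _ := gen_choiceMixin quotm.

Definition qpi (v : V) : quotm := Quotm (coset_repK v).

Lemma qval_inj : injective qval.
Proof.
by move=> [u pu] [v pv] /= e; subst v; congr Quotm; apply: Prop_irrelevance.
Qed.

Lemma qpiK (q : quotm) : qpi (qval q) = q.
Proof. by apply: qval_inj; rewrite /= qvalP. Qed.

Lemma qpi_eq v w : qpi v = qpi w <-> N (v - w).
Proof.
split=> [e|H]; last by apply: qval_inj; apply: coset_rep_eq.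
have ev : coset_rep v = coset_rep w := congr1 qval e.
have := submodB sN (coset_repP w) (coset_repP v).
by rewrite ev opprB addrC addrA subrK.
Qed.

Lemma qpi_val v : N (qval (qpi v) - v).
Proof. exact: coset_repP. Qed.

Definition qadd p q := qpi (qval p + qval q).
Definition qopp p := qpi (- qval p).
Definition qscale r p := qpi (r *: qval p).

Lemma qaddE v w : qadd (qpi v) (qpi w) = qpi (v + w).
Proof.
apply/qpi_eq; rewrite opprD addrACA.
by apply: submodD => //; apply: qpi_val.
Qed.

Lemma qoppE v : qopp (qpi v) = qpi (- v).
Proof. by apply/qpi_eq; rewrite -opprD; apply: submodN => //; apply: qpi_val. Qed.

Lemma qscaleE r v : qscale r (qpi v) = qpi (r *: v).
Proof. by apply/qpi_eq; rewrite -scalerBr; apply: submodZ => //; apply: qpi_val. Qed.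

Lemma qaddA : associative qadd.
Proof. by move=> p q r; rewrite -(qpiK p) -(qpiK q) -(qpiK r) !qaddE addrA. Qed.
Lemma qaddC : commutative qadd.
Proof. by move=> p q; rewrite /qadd addrC. Qed.
Lemma qadd0 : left_id (qpi 0) qadd.
Proof. by move=> p; rewrite -(qpiK p) qaddE add0r. Qed.
Lemma qaddN : left_inverse (qpi 0) qopp qadd.
Proof. by move=> p; rewrite -(qpiK p) qoppE qaddE addNr. Qed.

HB.instance Definition _ := GRing.isZmodule.Build quotm qaddA qaddC qadd0 qaddN.

Lemma qscaleA a b v : qscale a (qscale b v) = qscale (a * b) v.
Proof. by rewrite -(qpiK v) !qscaleE scalerA. Qed.
Lemma qscale1 : left_id 1 qscale.
Proof. by move=> v; rewrite -(qpiK v) qscaleE scale1r. Qed.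
Lemma qscaleDr : right_distributive qscale +%R.
Proof.
by move=> a u v; rewrite -(qpiK u) -(qpiK v) [LHS]/= /GRing.add /= !(qscaleE, qaddE) scalerDr.
Qed.
Lemma qscaleDl v : {morph qscale^~ v : a b / a + b}.
Proof.
by move=> a b; rewrite /= -(qpiK v) {2}/GRing.add /= !(qscaleE, qaddE) scalerDl.
Qed.

HB.instance Definition _ := GRing.Zmodule_isLmodule.Build R quotm
  qscaleA qscale1 qscaleDr qscaleDl.

Definition quot_mod : lmodType R := quotm.

Lemma qpi_lin : is_linear (qpi : V -> quot_mod).
Proof.
by move=> r x y; rewrite -qaddE -qscaleE.
Qed.

Lemma qpi_eq0 v : qpi v = 0 :> quot_mod <-> N v.
Proof. by rewrite -[0 : quot_mod]/(qpi 0) qpi_eq subr0. Qed.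

End Quotient.

(** * Q/Z is divisible and detects nonzero elements of abelian groups *)

Section DivisibleGroup.

Let Zin_submod : @submod int (zmodule rat) (fun x => (x : rat) \is a Num.int).
Proof.
split; first by rewrite rpred0.
by move=> r x y xi yi; apply: rpredD => //; rewrite scalezrE rpredMz.
Qed.

Definition QmodZ : zmodType := quot_mod Zin_submod.

Definition toQZ (x : rat) : QmodZ := qpi Zin_submod (x : zmodule rat).

Lemma toQZ_eq0 x : toQZ x = 0 <-> x \is a Num.int.
Proof. exact: qpi_eq0. Qed.

Lemma toQZD x y : toQZ (x + y) = toQZ x + toQZ y.
Proof. exact: (linD (qpi_lin Zin_submod)). Qed.

Lemma toQZ_mulrn x n : toQZ x *+ n = toQZ (x *+ n).
Proof.
elim: n => [|n IH]; last by rewrite !mulrS IH toQZD.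
by rewrite !mulr0n; symmetry; apply/toQZ_eq0; rewrite rpred0.
Qed.

Lemma QmodZ_divisible (d : QmodZ) n : (0 < n)%N -> exists d', d' *+ n = d.
Proof.
move=> n0; pose q : rat := qval d; exists (toQZ (q / n%:R)).
have e : (q / n%:R) *+ n = q by rewrite -mulr_natr mulfVK // pnatr_eq0 -lt0n.
by rewrite toQZ_mulrn e; apply: qpiK.
Qed.

Definition additive_map (A B : zmodType) (h : A -> B) := forall x y, h (x + y) = h x + h y.

(** The graph of a homomorphism on a subgroup of A: a subgroup of A x B meeting 0 x B trivially.
    Zorn's lemma is applied to graphs under inclusion. *)
Definition partial_hom (A B : zmodType) (G : A -> B -> Prop) :=
  [/\ G 0 0, forall x y d e, G x d -> G y e -> G (x - y) (d - e) & forall d, G 0 d -> d = 0].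

Section PartialHom.
Variables (A B : zmodType) (G : A -> B -> Prop).
Hypothesis pG : partial_hom G.

Lemma partial_homB x y d e : G x d -> G y e -> G (x - y) (d - e).
Proof. by case: pG => _ H _; apply: H. Qed.
Lemma partial_homN x d : G x d -> G (- x) (- d).
Proof. by case: pG => G0 _ _ H; rewrite -[- x]add0r -[- d]add0r; apply: partial_homB. Qed.
Lemma partial_homD x y d e : G x d -> G y e -> G (x + y) (d + e).
Proof. by move=> H /partial_homN H'; rewrite -[y]opprK -[e]opprK; apply: partial_homB. Qed.
Lemma partial_homM x d n : G x d -> G (x *+ n) (d *+ n).
Proof.
case: (pG) => G0 _ _ H; elim: n => [|n IH]; first by rewrite !mulr0n.
by rewrite !mulrS; apply: partial_homD.
Qed.
Lemma partial_hom_inj x d e : G x d -> G x e -> d = e.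
Proof.
move=> H H'; apply/eqP; rewrite -subr_eq0; apply/eqP; case: (pG) => _ _; apply.
by rewrite -(subrr x); apply: partial_homB.
Qed.
End PartialHom.

Lemma subr_rearrange (A : zmodType) (b b' x y x' y' : A) :
  (b + x - y) - (b' + x' - y') = b - b' + (x + y') - (y + x').
Proof.
rewrite !opprD opprK addrACA (addrACA b) -!addrA; congr (_ + (_ + (_ + _))).
by rewrite addrC (addrC (- y)) addrA.
Qed.

(** The value at [b0] is an n-th part of the value at n [b0], for the least n > 0 with n [b0] in the
    domain, and 0 if there is none. *)
Lemma partial_hom_step (A : zmodType) (G : A -> QmodZ -> Prop) b0 : partial_hom G ->
  exists G', [/\ partial_hom G', forall b d, G b d -> G' b d & exists d, G' b0 d].
Proof.
move=> pG; have [G0 _ Gf] := (pG).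
have [d0 key] : exists d0, forall (l : nat) d, G (b0 *+ l) d -> d = d0 *+ l.
  have [H|nH] := pselect (exists n, `[< (0 < n)%N /\ exists c, G (b0 *+ n) c >]).
    have [n /asboolP[n0 [c Hc]] nmin] := ex_minnP H.
    have [d0 ed0] := QmodZ_divisible c n0; exists d0 => l d Hl.
    have := partial_homB pG Hl (partial_homM pG (l %/ n) Hc).
    rewrite -mulrnA {1}(divn_eq l n) (mulnC n) mulrnDr addrAC subrr add0r => Hr.
    have r0 : (l %% n = 0)%N.
      apply/eqP; rewrite -leqn0 leqNgt; apply/negP => rpos.
      have nm : ~~ (n <= l %% n)%N by rewrite -ltnNge ltn_mod.
      move/negP: nm; apply; apply: nmin; apply/asboolP; split=> //.
      by eexists; exact: Hr.
    move: Hr; rewrite r0 mulr0n => /Gf/subr0_eq ->.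
    by rewrite -ed0 -mulrnA mulnC {2}(divn_eq l n) r0 addn0.
  exists 0 => l d Hl; rewrite mul0rn; case: (posnP l) => [l0|lpos].
    by apply: Gf; rewrite l0 mulr0n in Hl.
  by exfalso; apply: nH; exists l; apply/asboolP; split=> //; exists d.
(* An integer multiple of [b0] is written with the natural coefficients l and k as l - k. *)
exists (fun x e => exists b d (l k : nat),
  [/\ G b d, x = b + b0 *+ l - b0 *+ k & e = d + d0 *+ l - d0 *+ k]); split.
- split; first by exists 0, 0, 0%N, 0%N; rewrite !mulr0n !addr0 !subr0.
    move=> _ _ _ _ [b [d [l [k [H -> ->]]]]] [b' [d' [l' [k' [H' -> ->]]]]].
    exists (b - b'), (d - d'), (l + k')%N, (k + l')%N; split; first exact: partial_homB.
      by rewrite subr_rearrange !mulrnDr.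
    by rewrite subr_rearrange !mulrnDr.
  move=> e [b [d [l [k [H eb ->]]]]].
  have [kl|lk] := leqP k l.
    have Hb : b = - (b0 *+ (l - k)).
      by apply/eqP; rewrite -addr_eq0 mulrnBr // addrA -eb.
    have := partial_homN pG H; rewrite Hb opprK => /key ed.
    by rewrite -addrA -mulrnBr // -ed subrr.
  have Hb : b = b0 *+ (k - l).
    by apply/eqP; rewrite -subr_eq0 mulrnBr ?(ltnW lk) // opprB addrA -eb.
  by move: H; rewrite Hb => /key ->; rewrite mulrnBr ?(ltnW lk) // subrK subrr.
- by move=> b d H; exists b, d, 0%N, 0%N; rewrite !mulr0n !addr0 !subr0.
- by exists d0, 0, 0, 1%N, 0%N; rewrite !mulr1n !mulr0n !subr0 !add0r.
Qed.

Lemma partial_hom_extends (A : zmodType) (G0 : A -> QmodZ -> Prop) : partial_hom G0 ->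
  exists h : A -> QmodZ, additive_map h /\ forall x d, G0 x d -> h x = d.
Proof.
move=> pG0.
pose T := {G : A -> QmodZ -> Prop | partial_hom G /\ forall x d, G0 x d -> G x d}.
have p0 : partial_hom G0 /\ forall x d, G0 x d -> G0 x d by split.
pose t0 : T := exist _ G0 p0.
pose Rel (s t : T) := `[< forall x d, sval s x d -> sval t x d >].
have [s|r s t /asboolP H /asboolP H'|C Ctot|G Gmax] := @ZL_preorder T t0 Rel.
- by apply/asboolP.
- by apply/asboolP => x d /H; apply: H'.
(* [t0] is adjoined so that the empty chain has an upper bound as well. *)
- pose U x d := exists s : T, (s = t0 \/ C s) /\ sval s x d.
  have comp s t : (s = t0 \/ C s) -> (t = t0 \/ C t) -> Rel s t \/ Rel t s.
    move=> [->|Cs]; first by move=> _; left; apply/asboolP; case: (svalP t).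
    move=> [->|Ct]; last exact: Ctot.
    by right; apply/asboolP; case: (svalP s).
  have pU : partial_hom U /\ forall x d, G0 x d -> U x d.
    split; last by move=> x d H; exists t0; split=> //; left.
    split.
    + by exists t0; split; [left|case: pG0].
    + move=> x y d e [s [Cs Hs]] [t [Ct Ht]].
      have [/asboolP st|/asboolP ts] := comp s t Cs Ct.
        exists t; split=> //; have [pt _] := svalP t.
        by apply: (partial_homB pt) => //; apply: st.
      exists s; split=> //; have [ps _] := svalP s.
      by apply: (partial_homB ps) => //; apply: ts.
    + by move=> d [s [_ Hs]]; have [[_ _ H] _] := svalP s; apply: H.
  exists (exist _ U pU) => s Cs; apply/asboolP => x d Hs /=.
  by exists s; split=> //; right.
have [pG GG] := svalP G.
have tot x : exists d, sval G x d.
  have [G' [pG' GG' [d Hd]]] := partial_hom_step x pG.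
  have pt : partial_hom G' /\ forall x d, G0 x d -> G' x d.
    by split=> // y e /GG /GG'.
  have RG : Rel G (exist _ G' pt) by apply/asboolP.
  by have /asboolP H := Gmax _ RG; exists d; apply: H.
have [h hP] := choice tot; exists h; split.
  move=> x y; apply: (partial_hom_inj pG (hP _)).
  by apply: partial_homD.
by move=> x d /GG; apply: partial_hom_inj.
Qed.

(** v is sent to the class of 1/n, where n is its order, or 2 if the order is infinite; divisibility
    of Q/Z extends this from the subgroup of multiples of v. *)
Lemma QmodZ_cogenerates (A : zmodType) (v : A) : v != 0 ->
  exists h : A -> QmodZ, additive_map h /\ h v <> 0.
Proof.
move=> v0.
have inv_nint n : (1 < n)%N -> (n%:R^-1 : rat) \isn't a Num.int.
  move=> n1; apply/negP => H; have n0 : (n%:R : rat) != 0 by rewrite pnatr_eq0; case: n n1 {H}.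
  have p : (0 < n%:R^-1 :> rat) by rewrite invr_gt0 ltr0n; case: n n1 {H n0}.
  have l : (n%:R^-1 < 1 :> rat) by rewrite invf_lt1 ?ltr1n // ltr0n; case: n n1 {H n0 p}.
  move: H p l => /intrP[z ->]; rewrite ltr0z ltrz1; lia.
have [n [n1 Hn]] : exists n, (1 < n)%N /\ forall l, v *+ l = 0 -> (n %| l)%N.
  have [H|nH] := pselect (exists n, `[< (0 < n)%N /\ v *+ n = 0 >]); last first.
    exists 2; split=> // -[//|l] e; exfalso; apply: nH; exists l.+1; exact/asboolP.
  have [n /asboolP[n0 en] nmin] := ex_minnP H; exists n; split.
    by case: n n0 en {nmin} => [//|[_|//]]; rewrite mulr1n => e; rewrite e eqxx in v0.
  move=> l el; rewrite /dvdn eqn0Ngt; apply/negP => rpos.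
  have nm : ~~ (n <= l %% n)%N by rewrite -ltnNge ltn_mod.
  move/negP: nm; apply; apply: nmin; apply/asboolP; split=> //; move: el; rewrite {1}(divn_eq l n) mulrnDr mulnC mulrnA en.
  by rewrite mul0rn add0r.
set d := toQZ n%:R^-1.
have dn l : (n %| l)%N -> d *+ l = 0.
  move=> /dvdnP[q ->]; rewrite /d toQZ_mulrn; apply/toQZ_eq0.
  have -> : (n%:R^-1 *+ (q * n) : rat) = q%:R.
    by rewrite mulnC mulrnA -[_ *+ n]mulr_natr mulVf // pnatr_eq0; case: (n) n1.
  exact: rpred_nat.
have [|h [ah Hh]] := @partial_hom_extends A
   (fun x e => exists l k : nat, x = v *+ l - v *+ k /\ e = d *+ l - d *+ k).
  split; first by exists 0%N, 0%N; rewrite !mulr0n !subr0.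
    move=> _ _ _ _ [l [k [-> ->]]] [l' [k' [-> ->]]]; exists (l + k')%N, (k + l')%N.
    have := @subr_rearrange _ 0 0 (v *+ l) (v *+ k) (v *+ l') (v *+ k').
    have := @subr_rearrange _ 0 0 (d *+ l) (d *+ k) (d *+ l') (d *+ k').
    by rewrite !subr0 !add0r -!mulrnDr.
  move=> _ [l [k [e ->]]]; have [kl|/ltnW lk] := leqP k l.
    by rewrite -mulrnBr // dn // Hn // mulrnBr.
  by rewrite -opprB -mulrnBr // dn ?oppr0 // Hn // mulrnBr // -opprB -e oppr0.
exists h; split=> //; rewrite (Hh v d); last first.
  by exists 1%N, 0%N; rewrite !mulr1n !mulr0n !subr0.
by move/toQZ_eq0; apply/negP; apply: inv_nint.
Qed.

End DivisibleGroup.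

(** * Coinduced modules and their injectivity *)

Section Coinduced.
Variables (R : comNzRingType) (W : Type).

(* Hom_Z(R, (Q/Z)^W), with R acting through its own multiplication. *)
Record coind := Coind { cfun :> R -> W -> QmodZ;
  cfunD : forall r s w, cfun (r + s) w = cfun r w + cfun s w }.

HB.instance Definition _ := gen_eqMixin coind.
HB.instance Definition _ := gen_choiceMixin coind.

Lemma coindP (f g : coind) : (forall r w, f r w = g r w) -> f = g.
Proof.
case: f g => [f fD] [g gD] /= H.
have e : f = g by apply/funext => r; apply/funext => w.
by subst g; congr Coind; apply: Prop_irrelevance.
Qed.

Definition czero := @Coind (fun _ _ => 0) (fun _ _ _ => esym (addr0 0)).

Lemma cadd_proof (f g : coind) r s w : f (r + s) w + g (r + s) w = (f r w + g r w) + (f s w + g s w).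
Proof. by rewrite !cfunD addrACA. Qed.
Definition cadd (f g : coind) := @Coind (fun r w => f r w + g r w) (cadd_proof f g).

Lemma copp_proof (f : coind) r s w : - f (r + s) w = - f r w + - f s w.
Proof. by rewrite cfunD opprD. Qed.
Definition copp (f : coind) := @Coind (fun r w => - f r w) (copp_proof f).

Lemma cscale_proof a (f : coind) r s w : f ((r + s) * a) w = f (r * a) w + f (s * a) w.
Proof. by rewrite mulrDl cfunD. Qed.
Definition cscale a (f : coind) := @Coind (fun r w => f (r * a) w) (cscale_proof a f).

Lemma caddA : associative cadd.
Proof. by move=> f g h; apply: coindP => r w /=; rewrite addrA. Qed.
Lemma caddC : commutative cadd.
Proof. by move=> f g; apply: coindP => r w /=; rewrite addrC. Qed.
Lemma cadd0 : left_id czero cadd.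
Proof. by move=> f; apply: coindP => r w /=; rewrite add0r. Qed.
Lemma caddN : left_inverse czero copp cadd.
Proof. by move=> f; apply: coindP => r w /=; rewrite addNr. Qed.

HB.instance Definition _ := GRing.isZmodule.Build coind caddA caddC cadd0 caddN.

Lemma cscaleA a b v : cscale a (cscale b v) = cscale (a * b) v.
Proof. by apply: coindP => r w /=; rewrite mulrA. Qed.
Lemma cscale1 : left_id 1 cscale.
Proof. by move=> f; apply: coindP => r w /=; rewrite mulr1. Qed.
Lemma cscaleDr : right_distributive cscale +%R.
Proof. by move=> a f g; apply: coindP. Qed.
Lemma cscaleDl v : {morph cscale^~ v: a b / a + b}.
Proof. by move=> a b; apply: coindP => r w /=; rewrite mulrDr cfunD. Qed.

HB.instance Definition _ := GRing.Zmodule_isLmodule.Build R coind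
  cscaleA cscale1 cscaleDr cscaleDl.

Definition coind_mod : lmodType R := coind.

(** R-maps from B into the coinduced module correspond to families of additive maps from B to Q/Z,
    by evaluation at 1. Each member of the family extends, and b is then sent to the map r -> h (r
    b). *)
Lemma coind_injective : is_injective_mod coind_mod.
Proof.
move=> A B f g lf fi lg.
have ex w : exists h : B -> QmodZ, additive_map h /\ forall a, h (f a) = (g a : coind) 1 w.
  have [|h [ah Hh]] := @partial_hom_extends B
     (fun b d => exists a, b = f a /\ d = (g a : coind) 1 w).
    split; first by exists 0; rewrite (lin0 lf) (lin0 lg).
      move=> _ _ _ _ [a [-> ->]] [a' [-> ->]]; exists (a - a').
      by rewrite (linB lf) (linB lg).
    move=> d [a [e ->]]; have -> : a = 0 by apply: fi; rewrite (lin0 lf).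
    by rewrite (lin0 lg).
  by exists h; split=> // a; apply: Hh; exists a.
have [hh hhP] := choice ex.
have hD b r s w : hh w ((r + s) *: b) = hh w (r *: b) + hh w (s *: b).
  by rewrite scalerDl; case: (hhP w) => H _; apply: H.
exists (fun b => @Coind (fun r w => hh w (r *: b)) (hD b)); split.
  move=> r x y; apply: coindP => s w /=; rewrite scalerDr scalerA.
  by case: (hhP w) => H _; apply: H.
move=> a; apply: coindP => r w /=; case: (hhP w) => _ H.
by rewrite -(linZ lf) H (linZ lg) /= mul1r.
Qed.

End Coinduced.

Section Resolutions.
Variable R : comNzRingType.

(** The index set is V itself: the coordinate w uses a character nonzero at w, so v <> 0 is detected
    at r = 1 in the coordinate v. *)
Lemma enough_injectives (V : lmodType R) :
  exists e : V -> coind_mod R V, is_linear e /\ injective e.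
Proof.
have ex w : exists h : V -> QmodZ, additive_map h /\ (w != 0 -> h w <> 0).
  have [->|w0] := eqVneq w 0.
    by exists (fun _ => 0); split=> // x y; rewrite addr0.
  by have [h [ah Hh]] := QmodZ_cogenerates w0; exists h.
have [phi phiP] := choice ex.
have pD v r s w : phi w ((r + s) *: v) = phi w (r *: v) + phi w (s *: v).
  by rewrite scalerDl; case: (phiP w) => H _; apply: H.
have le : is_linear (fun v => @Coind R V (fun r w => phi w (r *: v)) (pD v) : coind_mod R V).
  move=> r x y; apply: coindP => s w /=; rewrite scalerDr scalerA.
  by case: (phiP w) => H _; apply: H.
exists (fun v => @Coind R V (fun r w => phi w (r *: v)) (pD v)); split=> // x y e.
apply/eqP; rewrite -subr_eq0; apply/negPn/negP => xy.
case: (phiP (x - y)) => _ /(_ xy); apply.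
have := linB le x y; rewrite /= e subrr => /(congr1 (fun f : coind R V => f 1 (x - y))) /=.
by rewrite scale1r.
Qed.

Definition emb (V : lmodType R) : V -> coind_mod R V := sval (cid (enough_injectives V)).
Lemma emb_lin V : is_linear (@emb V).
Proof. by rewrite /emb; case: cid => e []. Qed.
Lemma emb_inj V : injective (@emb V).
Proof. by rewrite /emb; case: cid => e []. Qed.

Definition emb_im (V : lmodType R) (y : coind_mod R V) := exists x, emb x = y.
Lemma emb_im_submod V : submod (@emb_im V).
Proof.
split; first by exists 0; apply: (lin0 (@emb_lin V)).
by move=> r _ _ [x <-] [y <-]; exists (r *: x + y); apply: emb_lin.
Qed.

Definition cosyzygy (V : lmodType R) : lmodType R := quot_mod (emb_im_submod V).
Definition cosyz_pi (V : lmodType R) : coind_mod R V -> cosyzygy V := qpi (emb_im_submod V).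

Definition cosyz_seq (V : lmodType R) (n : nat) : lmodType R := iter n cosyzygy V.

Lemma inj_res_exists (V : lmodType R) : inhabited (inj_res V).
Proof.
pose E n := coind_mod R (cosyz_seq V n).
pose d n (y : E n) : E n.+1 := @emb (cosyz_seq V n.+1) (cosyz_pi y).
have pl n : is_linear (@cosyz_pi (cosyz_seq V n)) by apply: qpi_lin.
have p0 n (y : E n) : cosyz_pi y = 0 <-> exists x, emb x = y by apply: qpi_eq0.
have e0 (W : lmodType R) (y : W) : emb y = 0 <-> y = 0.
  split=> [|->]; last exact: (lin0 (@emb_lin W)).
  by rewrite -(lin0 (@emb_lin W)) => /emb_inj.
split; apply: (@InjRes R V E (@emb V) d).
- by move=> n; apply: coind_injective.
- exact: emb_lin.
- by move=> n r x y; rewrite /d pl emb_lin.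
- exact: emb_inj.
- move=> y; split=> [/e0/(p0 0%N)//|/(p0 0%N) H]; exact/e0.
- move=> n y; split=> [/e0/(p0 n.+1)[x <-]|[x <-]]; last by apply/e0/(p0 n.+1); exists (cosyz_pi x).
  by exists (qval x); congr emb; apply: qpiK.
Qed.

(** Injectivity is applied to the pushout (E x R) / {(f x, -x)} of f along the inclusion of the
    ideal, so the ideal itself never has to be made into a module. The retraction onto E sends the
    class of (0, 1) to the required element. *)
Lemma injective_baer (E : lmodType R) : is_injective_mod E -> baer (@full R) E.
Proof.
move=> iE a f ia _ lf; have [f0 fZ fB] := ideal_full_eval ia lf.
pose N (p : E * R^o) := exists2 x, a x & p = (f x, - x).
have sN : @submod R (E * R^o)%type N.
  split; first by exists 0; [apply: ideal0|rewrite f0 oppr0].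
  move=> r _ _ [x ax ->] [y ay ->]; exists (r * x + y).
    by apply: idealD => //; apply: idealMl.
  by rewrite lf // pairE opprD scalerN.
have ql := qpi_lin sN.
have [||//|h [lh Hh]] := iE E (quot_mod sN) (fun e => qpi sN (e, 0)) id.
- by move=> r x y; rewrite -ql pairE scaler0 addr0.
- move=> x y; rewrite qpi_eq => -[z az [e1 e2]].
  move: e2; rewrite subr0 => /eqP; rewrite eq_sym oppr_eq0 => /eqP z0.
  by apply/eqP; rewrite -subr_eq0 e1 z0 f0.
exists (h (qpi sN (0, 1))) => // x ax.
rewrite -(linZ lh) -(linZ ql) -(Hh (f x)); congr h; apply/qpi_eq.
by exists x => //; congr pair; rewrite /= ?scaler0 ?subr0 ?sub0r //= /GRing.scale /= mulr1.
Qed.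

End Resolutions.

(** * The supremum equals the dimension *)

Section Main.
Variable R : comNzRingType.
Hypothesis noeth : noetherian_ring R.
Variables (m I J : R -> Prop) (M : lmodType R).
Hypotheses (loc : local_ring m) (iI : is_ideal I) (iJ : is_ideal J).
Hypothesis prim : is_primary_to (ideal_add I J) m.

Lemma res_dd (X : inj_res M) n (x : ir_E X n) : ir_d (ir_d x) = 0.
Proof. by apply/(@ir_exact _ _ X); exists x. Qed.

Definition res_cplx (X : inj_res M) : cplx R := Cplx (@ir_d_lin _ _ X) (@res_dd X).

Lemma res_coh_nzP (X : inj_res M) i :
  res_coh_nz I J X i <-> ~ van (res_cplx X) (gam J m) i.
Proof.
have gP V u : gammaIJ I J (V := V) u <-> gam J m u by apply: gammaIJ_gam.
case: i => [|i]; split.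
- move=> [x [/gP gx [dx x0]]] /(_ x); apply: contra_not x0 => H.
  by have [|v _ <-] := H; first by split.
- move=> /existsNP[x /not_implyP[[gx dx] nb]]; exists x; split; first exact/gP.
  split=> // x0; apply: nb; exists 0; last by rewrite x0.
  exact: (submod0 ((sGam m iJ).1 _)).
- move=> [x [/gP gx [dx nb]]] /(_ x) H; apply: nb.
  by have [|v /gP gv <-] := H; [split|exists v].
- move=> /existsNP[x /not_implyP[[gx dx] nb]]; exists x; split; first exact/gP.
  by split=> // -[y [/gP gy dy]]; apply: nb; exists y.
Qed.

Section FixedResolution.
Variable Y : inj_res M.
Let X := res_cplx Y.

Lemma res_baer n : baer (@full R) (cT X n).
Proof. by apply: injective_baer; apply: ir_inj. Qed.

Lemma res_exact i : (1 <= i)%N -> van X (@full R) i.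
Proof.
by case: i => [//|i] _ u [_ du]; have /ir_exact[x e] := du; exists x.
Qed.

End FixedResolution.

Lemma fin_gen_lspan : fin_gen M ->
  exists gs : seq M, forall x, lspan (@Rtrue R) (fun u => u = 0) gs x.
Proof.
move=> [gs H]; exists gs => x; have sl := lspan_submod (Rtrue_ideal R) gs (zero_submod M).
move: x (H x); apply: fsum_min; [exact: submod0|by move=> *; apply: submodD|].
move=> _ [r [v [vgs ->]]]; apply: lspan_gen => //; exact: zero_submod.
Qed.

Lemma J_local : psubset J m.
Proof.
case: prim => _ [_ [_ rad]] x Jx; apply/rad; exists 1%N; rewrite expr1.
by exists 0, x; rewrite add0r; split=> //; apply: ideal0.
Qed.

(** If x M lies in J M, the determinant trick gives x^n in Ann M + J; so both ideals lie under the
    same primes. *)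
Lemma prime_over_ann_quot gs L P : (forall x : M, lspan (@Rtrue R) (fun u => u = 0) gs x) ->
  (forall x, J x <-> igen (@Rzero R) L x) -> is_prime_ideal P ->
  psubset (ann_quot J M) P <-> psubset (igen (annM M) L) P.
Proof.
move=> gsP JL pP; have [iP _] := pP; have iz := Rzero_ideal R; split=> H x.
  move: x; apply: igen_min => // [x ax|y yL]; apply: H => v.
    by rewrite ax; apply: fsum0.
  apply: fsum_in; exists y, v; split=> //; apply/JL; exact: igen_gen.
move=> ax; have [|n [t [Jt Ht]]] := @determinant_trick R M J (fun u => u = 0) gs x iJ (zero_submod M).
  move=> v _; have sl := lspan_submod iJ gs (zero_submod M).
  move: (x *: v) (ax v); apply: fsum_min; [exact: submod0|by move=> *; apply: submodD|].
  by move=> _ [r [w [Jr ->]]]; apply: lspan_scale => //; exact: zero_submod.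
apply: (prime_exp (n := n) pP); rewrite -[x ^+ n](addrK t); apply: idealB => //; apply: H.
  apply: igen_base => v; move: v (gsP v).
  apply: (@lspan_min R M (@Rtrue R) _ _ (fun v => (x ^+ n + t) *: v = 0)).
  - split; first by rewrite scaler0.
    by move=> s u w eu ew; rewrite scalerDr ew scalerA mulrC -scalerA eu scaler0 addr0.
  - by move=> u ->; rewrite scaler0.
  - by move=> v j vgs _; rewrite scalerA mulrC -scalerA Ht // scaler0.
move/JL: Jt; apply: igen_sub; first exact: annM_ideal.
  by move=> z ->; apply: ideal0; apply: igen_ideal; apply: annM_ideal.
by move=> y yL; apply: igen_gen => //; apply: annM_ideal.
Qed.

Lemma van_zero_module (Y : inj_res M) : annM M 1 -> forall i, van (res_cplx Y) (gam J m) i.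
Proof.
move=> M0 i; have im := local_ideal loc; have iz := Rzero_ideal R.
have [zs mzs] := noeth_fg noeth im.
have -> : gam J m = torl J zs.
  apply: gam_torl => // [z zz|x /mzs Hx]; first by apply/mzs; apply: igen_gen.
  apply: radical_base; move: x Hx; apply: igen_sub => //.
    by move=> x ->; apply: ideal0; apply: igen_ideal.
  by move=> z zz; apply: igen_gen.
have vX k : van (res_cplx Y) (@full R) k.
  case: k => [|k]; last exact: res_exact.
  move=> u [_ du]; have /ir_exact0[x <-] := du; exists 0 => //=.
  by rewrite -[x]scale1r M0 (lin0 (@ir_eps_lin _ _ Y)).
apply: (@van_torl _ noeth J iJ (res_cplx Y) zs [::] 0) => //; first exact: res_baer.
by move=> z _ n u cu; exists 0%N; rewrite expr0 scale1r; apply: vX.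
Qed.

Lemma local_cohomology_sup (gs : seq M) :
  (forall x, lspan (@Rtrue R) (fun u => u = 0) gs x) -> ~ annM M 1 ->
  exists d, is_sup_opt (HIJ_nonzero I J M) (Some d) /\ dim_quot J M (Some d).
Proof.
move=> gsP M1; have im := local_ideal loc; have iz := Rzero_ideal R.
have ia := annM_ideal M; have Jm := J_local.
have [L JL] := noeth_fg noeth iJ.
have JL' : psubset J (igen (@Rzero R) L) by move=> x /JL.
have LJ z : z \in L -> J z by move=> zL; apply/JL; apply: igen_gen.
have Lm z : z \in L -> m z by move=> /LJ; apply: Jm.
set a := igen (annM M) L; have iA : is_ideal a by apply: igen_ideal.
have na1 : ~ a 1.
  move=> a1; apply: (local_n1 loc); move: a1; apply: igen_min => //.
  exact: annM_local M1.
have [zs mzs] := noeth_fg noeth im.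
(* The number d is the least size of a sequence in m whose sum with Ann M + J has m in its
   radical. *)
pose par n := exists ys, [/\ forall y, y \in ys -> m y, size ys = n & psubset m (radical (igen a ys))].
have [|d /asboolP[ys [ym sz mrad]] dmin] := @ex_minnP (fun n => `[< par n >]).
  exists (size zs); apply/asboolP; exists zs; split=> //.
    by move=> y yz; apply/mzs; apply: igen_gen.
  move=> x /mzs Hx; apply: radical_base; move: x Hx; apply: igen_sub => //.
    by move=> x ->; apply: ideal0; apply: igen_ideal.
  by move=> z zz; apply: igen_gen.
have vanish (Y : inj_res M) i : (d < i)%N -> van (res_cplx Y) (gam J m) i.
  move=> di.
  apply: (@kos_van_gam R noeth m J loc iJ M (res_cplx Y) (ir_eps Y) (@ir_eps_lin _ _ Y) (@ir_exact0 _ _ Y)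
    (@res_exact Y) (@res_baer Y) M1 [::] ys) => //; last by rewrite addn0 sz.
  move=> x /mrad; apply: radical_mono.
  have iad : is_ideal (ideal_add J (annM M)) by apply: ideal_add_ideal.
  apply: igen_sub => //; last by move=> y yy; apply: igen_gen.
  apply: igen_sub => //.
    by move=> z az; apply: igen_base; exists 0, z; rewrite add0r; split=> //; apply: ideal0.
  move=> z /LJ Jz; apply: igen_base; exists z, 0; rewrite addr0; split=> //; split=> //.
  exact: ideal0.
have nonvanish (Y : inj_res M) : ~ van (res_cplx Y) (gam J m) d.
  move=> vd.
  (* If degree d vanished as well, the Koszul complex on the generators L of J would vanish from
     degree d + size L on, which yields fewer than d parameters. *)
  have vge i : (d <= i)%N -> van (res_cplx Y) (gam J m) i.
    by rewrite leq_eqVlt => /orP[/eqP<-//|]; apply: vanish.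
  have [||ys' [ym' sz' mrad']] := @parameters_of_vanishing R noeth m J loc iJ M gs gsP (res_cplx Y)
    (ir_eps Y) (@ir_eps_lin _ _ Y) (@ir_eps_mono _ _ Y) (@ir_exact0 _ _ Y)
    (@res_exact Y) (@res_baer Y) M1 a iA d L JL' Lm.
  - by [].
  - by move=> i; rewrite addnC => H; apply: (@kos_van R (res_cplx Y) _ L d (sGam m iJ) vge).
  - have : (d <= size ys')%N by apply: dmin; apply/asboolP; exists ys'.
    by rewrite leqNgt sz'.
have chainE n : prime_chain_above (ann_quot J M) n <-> prime_chain_above a n.
  split=> -[c [c1 c2]]; exists c; split=> // k kn; have [pc Hc] := c1 k kn;
    by split=> //; apply/(prime_over_ann_quot gsP JL pc).
have [Y] := inj_res_exists M.
exists d; split; split.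
- by exists Y; apply/res_coh_nzP; apply: nonvanish.
- move=> i [Y' /res_coh_nzP nv]; rewrite leqNgt; apply/negP => di; apply: nv.
  exact: vanish.
- apply/chainE; apply: (chain_of_parameters noeth loc) => // ys' ym' mrad'.
  by apply: dmin; apply/asboolP; exists ys'.
- by move=> n /chainE; rewrite -sz; apply: (chain_length_le noeth loc).
Qed.

End Main.

Theorem theorem4p5 (R : comNzRingType) (m I J : R -> Prop) (M : lmodType R) :
  noetherian_ring R -> local_ring m ->
  is_ideal I -> is_ideal J -> is_primary_to (ideal_add I J) m ->
  fin_gen M ->
  exists o : option nat,
    is_sup_opt (HIJ_nonzero I J M) o /\ dim_quot J M o.
Proof.
move=> noeth loc iI iJ prim /fin_gen_lspan[gs gsP].
have [M0|M1] := pselect (annM M 1); last first.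
  by have [d H] := local_cohomology_sup noeth loc iI iJ prim gsP M1; exists (Some d).
(* For M = 0 the annihilator of M/JM is the unit ideal, contained in no prime, so there is not even
   a chain of length 0. *)
exists None; split=> [i [Y /(res_coh_nzP noeth iI iJ prim)]|n [c [c1 _]]].
  by apply; apply: van_zero_module.
have [[_ [P1 _]] aP] := c1 0%N isT; apply: P1; apply: aP => x.
by rewrite M0; apply: fsum0.
Qed.
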